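(* Let $\mathcal T$ be a triangular algebra of size $n=3$ over a field $k$, $X$ a $\mathcal T$-bimodule, and $E_r^{t,s}$ the spectral sequence associated with the filtration by length of trajectories of the relative Hochschild complex of $\mathcal T$ with coefficients in $X$. Then the term $E_1^{1,*}$ is $$\mathrm{Ext}^{*}_{A_2-A_1}({}_2M_1,{}_2X_1)\oplus \mathrm{Ext}^{*}_{A_3-A_2}({}_3M_2,{}_3X_2)\oplus \mathrm{Ext}^{*}_{A_3-A_1}({}_3M_1,{}_3X_1).$$
   Context: Throughout, $k$ is a field and $\otimes=\otimes_k$; bimodules over $k$-algebras have $k$ acting centrally. $\mathrm{Ext}_{B-A}$ denotes Ext in the category of $B$-$A$-bimodules, i.e. of left $B\otimes A^{op}$-modules. Triangular algebra of size $3$: $A_1,A_2,A_3$ are unital associative $k$-algebras, ${}_jM_i$ is a nonzero $A_j$-$A_i$-bimodule for $1\le i<j\le 3$, and $\mu:{}_3M_2\otimes{}_2M_1\to{}_3M_1$ is an $A_3$-$A_1$-bimodule morphism that is $A_2$-balanced. $\mathcal T$ is the algebra of lower triangular $3\times3$ matrices with $(i,i)$ entry in $A_i$ and $(j,i)$ entry in ${}_jM_i$, with matrix multiplication (using $\mu$). $e_i\in\mathcal T$ is the image of $1_{A_i}$, $R=\bigoplus_i k e_i\subset\mathcal T$, and ${}_jX_i=e_jXe_i$. The relative Hochschild complex $\mathcal H$ has $\mathcal H^l=\mathrm{Hom}_{R-R}(\mathcal T^{\otimes_R l},X)$ ($R$-bimodule morphisms; $\mathcal T^{\otimes_R 0}=R$)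 with the Hochschild coboundary: $x\mapsto(t\mapsto tx-xt)$ in degree $0$ and $(\delta f)(t_1\otimes\dots\otimes t_{l+1})=t_1f(t_2\otimes\dots\otimes t_{l+1})+\sum_{i=1}^l(-1)^if(\dots\otimes t_it_{i+1}\otimes\dots)+(-1)^{l+1}f(t_1\otimes\dots\otimes t_l)t_{l+1}$. The quiver of $\mathcal T$ is $e_1\to e_2\to e_3$. To the trivial path at $e_i$ is associated $M_{e_i}=A_i$, to the path $\gamma$ from $e_i$ to $e_j$ ($i<j$) is associated $M_\gamma={}_jM_i$. An $l$-trajectory is a sequence $\tau=(\gamma_l,\dots,\gamma_1)$ of consecutive paths (trivial ones allowed; for $l=0$, a vertex); $M_\tau=M_{\gamma_l}\otimes\dots\otimes M_{\gamma_1}$ ($=ke_i$ for the $0$-trajectory $e_i$), and $|\tau|$ is the number of non-trivial $\gamma_i$. Then $\mathcal T^{\otimes_Rl}=\bigoplus_\tau M_\tau$, and $F^t\mathcal H^l=\mathrm{Hom}_{R-R}(\bigoplus_{|\tau|\ge t}M_\tau,X)$ (maps vanishing on $M_\tau$ with $|\tau|<t$) defines a decreasing filtration of $\mathcal H$. The spectral sequence has $E_0^{t,s}=F^t\mathcal H^{t+s}/F^{t+1}\mathcal H^{t+s}$. *)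

(* Defs.v *)
From HB Require Import structures.
From mathcomp Require Import all_boot all_algebra.
From mathcomp Require Import boolp functions zify.

Set Implicit Arguments.
Unset Strict Implicit.
Unset Printing Implicit Defensive.

Import GRing.Theory.
Local Open Scope ring_scope.
Local Open Scope quotient_scope.

Section Subspace.
Variables (k : fieldType) (V : lmodType k) (P : submodClosed V).

Record subsp := Subsp { subsp_val : V; subsp_valP : subsp_val \in P }.

HB.instance Definition _ := [isSub for subsp_val].
HB.instance Definition _ := [Choice of subsp by <:].
HB.instance Definition _ := [SubChoice_isSubLmodule of subsp by <:].

End Subspace.

Section QuotientSpace.
Variables (k : fieldType) (V : lmodType k) (P : submodClosed V).

Definition quotsp_rel (u v : V) : bool := u - v \in P.

Fact quotsp_relP : equiv_class_of quotsp_rel.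
Proof.
have PN v : v \in P -> - v \in P by move=> Pv; rewrite -scaleN1r rpredZ.
split=> [u | u v | v u w]; rewrite /quotsp_rel ?subrr ?rpred0 //.
  by apply/idP/idP=> /PN; rewrite opprB.
by move=> Puv Pvw; rewrite -(subrKA v) rpredD.
Qed.

Canonical quotsp_equiv := EquivRelPack quotsp_relP.
Canonical quotsp_encModRel := defaultEncModRel quotsp_rel.

Definition quotsp : Type := {eq_quot quotsp_rel}.
HB.instance Definition _ := EqQuotient.on quotsp.
HB.instance Definition _ := Choice.on quotsp.

Definition quotsp_pi (v : V) : quotsp := \pi_quotsp v.

Lemma quotsp_piE (u v : V) : (quotsp_pi u == quotsp_pi v) = (u - v \in P).
Proof. by rewrite /quotsp_pi piE. Qed.

Lemma quotsp_reprK : cancel repr quotsp_pi.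
Proof. exact: reprK. Qed.

Definition quotsp_add (x y : quotsp) := quotsp_pi (repr x + repr y).
Definition quotsp_opp (x : quotsp) := quotsp_pi (- repr x).
Definition quotsp_scale (c : k) (x : quotsp) := quotsp_pi (c *: repr x).

Let repr_pi v : repr (quotsp_pi v) - v \in P.
Proof. by rewrite -quotsp_piE quotsp_reprK. Qed.

Fact quotsp_add_pi u v :
  quotsp_add (quotsp_pi u) (quotsp_pi v) = quotsp_pi (u + v).
Proof. by apply/eqP; rewrite quotsp_piE opprD addrACA rpredD. Qed.

Fact quotsp_scale_pi c v : quotsp_scale c (quotsp_pi v) = quotsp_pi (c *: v).
Proof. by apply/eqP; rewrite quotsp_piE -scalerBr rpredZ. Qed.

Fact quotsp_opp_pi v : quotsp_opp (quotsp_pi v) = quotsp_pi (- v).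
Proof.
by apply/eqP; rewrite quotsp_piE -opprD -[- (_ - _)]scaleN1r rpredZ.
Qed.

Fact quotsp_addA : associative quotsp_add.
Proof.
move=> x y z; rewrite -[x]quotsp_reprK -[y]quotsp_reprK -[z]quotsp_reprK.
by rewrite !quotsp_add_pi addrA.
Qed.

Fact quotsp_addC : commutative quotsp_add.
Proof. by move=> x y; rewrite /quotsp_add addrC. Qed.

Fact quotsp_add0 : left_id (quotsp_pi 0) quotsp_add.
Proof. by move=> x; rewrite -[x]quotsp_reprK quotsp_add_pi add0r. Qed.

Fact quotsp_addN : left_inverse (quotsp_pi 0) quotsp_opp quotsp_add.
Proof.
by move=> x; rewrite -[x]quotsp_reprK quotsp_opp_pi quotsp_add_pi addNr.
Qed.

HB.instance Definition _ := GRing.isZmodule.Build quotsp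
  quotsp_addA quotsp_addC quotsp_add0 quotsp_addN.

Lemma quotsp_piD : {morph quotsp_pi : u v / u + v}.
Proof. by move=> u v; rewrite -quotsp_add_pi. Qed.

Fact quotsp_scaleA c d x :
  quotsp_scale c (quotsp_scale d x) = quotsp_scale (c * d) x.
Proof. by rewrite -[x]quotsp_reprK !quotsp_scale_pi scalerA. Qed.

Fact quotsp_scale1 : left_id 1 quotsp_scale.
Proof. by move=> x; rewrite -[x]quotsp_reprK quotsp_scale_pi scale1r. Qed.

Fact quotsp_scaleDr : right_distributive quotsp_scale +%R.
Proof.
move=> c x y; rewrite -[x]quotsp_reprK -[y]quotsp_reprK.
by rewrite -quotsp_piD !quotsp_scale_pi scalerDr quotsp_piD.
Qed.

Fact quotsp_scaleDl x : {morph quotsp_scale^~ x : c d / c + d}.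
Proof.
move=> c d; rewrite -[x]quotsp_reprK.
by rewrite !quotsp_scale_pi scalerDl quotsp_piD.
Qed.

HB.instance Definition _ := GRing.Zmodule_isLmodule.Build k quotsp
  quotsp_scaleA quotsp_scale1 quotsp_scaleDr quotsp_scaleDl.

Fact quotsp_pi_linear : linear quotsp_pi.
Proof. by move=> c u v; rewrite quotsp_piD -quotsp_scale_pi. Qed.
HB.instance Definition _ := GRing.isLinear.Build k V quotsp _ quotsp_pi
  quotsp_pi_linear.

End QuotientSpace.

Record complex (k : fieldType) := Complex {
  cpx_obj :> nat -> lmodType k;
  cpx_d : forall n, {linear cpx_obj n -> cpx_obj n.+1};
  cpx_dd : forall n v, cpx_d n.+1 (cpx_d n v) = 0
}.
Arguments cpx_d {k C} n : rename.

Section Cohomology.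
Variables (k : fieldType) (C : complex k).

Definition cocycle n : {pred C n} := fun z => cpx_d n z == 0.

Fact cocycle_closed n : submod_closed (@cocycle n).
Proof.
split=> [|c u v]; rewrite !unfold_in ?linear0 // => /eqP u0 /eqP v0.
by rewrite linearP u0 v0 scaler0 addr0.
Qed.
HB.instance Definition _ n :=
  GRing.isSubmodClosed.Build k (C n) (@cocycle n) (cocycle_closed n).

Definition coboundary n : {pred subsp (@cocycle n)} :=
  match n return {pred subsp (@cocycle n)} with
  | 0 => fun z => z == 0
  | m.+1 => fun z => `[< exists u : C m, val z = cpx_d m u >]
  end.

Fact coboundary_closed n : submod_closed (@coboundary n).
Proof.
case: n => [|n]; split=> [|c x y]; rewrite !unfold_in /=.
- by [].
- by move=> /eqP-> /eqP->; rewrite scaler0 addr0.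
- by apply/asboolP; exists 0; rewrite linear0.
move=> /asboolP[u xu] /asboolP[v yv]; apply/asboolP; exists (c *: u + v).
by rewrite !linearP xu yv.
Qed.
HB.instance Definition _ n :=
  GRing.isSubmodClosed.Build k _ (@coboundary n) (coboundary_closed n).

Definition cohomology (n : int) : lmodType k :=
  match n with
  | Posz m => quotsp (@coboundary m)
  | Negz _ => 'rV[k]_0
  end.

End Cohomology.

Record fcomplex (k : fieldType) := FComplex {
  fcpx :> complex k;
  fcpx_F : nat -> forall n, submodClosed (fcpx n);
  fcpx_Fdec : forall t n v, v \in fcpx_F t.+1 n -> v \in fcpx_F t n;
  fcpx_Fd : forall t n v, v \in fcpx_F t n -> cpx_d n v \in fcpx_F t n.+1
}.

Section SpectralSequence.
Variables (k : fieldType) (C : fcomplex k) (t : nat).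

Definition Fnext n : {pred subsp (fcpx_F C t n)} :=
  fun x => val x \in fcpx_F C t.+1 n.

Lemma Fnext_in n x : (x \in @Fnext n) = (val x \in fcpx_F C t.+1 n).
Proof. by []. Qed.

Fact Fnext_closed n : submod_closed (@Fnext n).
Proof.
split=> [|c x y]; rewrite !Fnext_in ?raddf0 ?rpred0 // => Fx Fy.
by rewrite linearP /= rpredD // rpredZ.
Qed.
HB.instance Definition _ n :=
  GRing.isSubmodClosed.Build k _ (@Fnext n) (Fnext_closed n).

Definition E0_obj n : lmodType k := quotsp (@Fnext n).

Definition E0_lift n (x : E0_obj n) : subsp (fcpx_F C t n.+1) :=
  Subsp (fcpx_Fd (subsp_valP (repr x))).

Definition E0_d n (x : E0_obj n) : E0_obj n.+1 := quotsp_pi _ (E0_lift x).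

Fact E0_d_pi n (x : subsp (fcpx_F C t n)) (y : subsp (fcpx_F C t n.+1)) :
  val y = cpx_d n (val x) -> E0_d (quotsp_pi _ x) = quotsp_pi _ y.
Proof.
move=> yE; apply/eqP; rewrite /E0_d quotsp_piE Fnext_in.
rewrite raddfB /= yE -raddfB; apply: fcpx_Fd.
set r := repr _.
have : r - x \in @Fnext n by rewrite -quotsp_piE quotsp_reprK.
by rewrite Fnext_in raddfB.
Qed.

Fact E0_d_linear n : linear (@E0_d n).
Proof.
move=> c x y; rewrite -{1}[x]quotsp_reprK -{1}[y]quotsp_reprK -linearP.
rewrite /E0_d -linearP; apply: E0_d_pi.
by rewrite !linearP.
Qed.
HB.instance Definition _ n :=
  GRing.isLinear.Build k _ _ _ (@E0_d n) (@E0_d_linear n).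

Fact E0_dd n (x : E0_obj n) : E0_d (E0_d x) = 0.
Proof.
rewrite [E0_d x]/E0_d -(linear0 (quotsp_pi _)); apply: E0_d_pi.
by rewrite /= cpx_dd.
Qed.

(* The column $E_0^{t,*}$ with its differential $d_0$, indexed by the total
   degree $t+s$. *)
Definition E0 : complex k :=
  @Complex k E0_obj (fun n => @E0_d n) E0_dd.

Definition E1 (s : int) : lmodType k := cohomology E0 (t%:Z + s).

End SpectralSequence.

(* [lact] and [ract] are bilinear over k, so k acts centrally. *)
Record bimod (k : fieldType) (B A : algType k) := Bimod {
  bimod_sort :> lmodType k;
  lact : B -> bimod_sort -> bimod_sort;
  ract : bimod_sort -> A -> bimod_sort;
  lact_linearl : forall x, linear (lact^~ x);
  lact_linearr : forall b, linear (lact b);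
  ract_linearl : forall a, linear (ract^~ a);
  ract_linearr : forall x, linear (ract x);
  lact1 : forall x, lact 1 x = x;
  ract1 : forall x, ract x 1 = x;
  lactA : forall b c x, lact (b * c) x = lact b (lact c x);
  ractA : forall x a c, ract x (a * c) = ract (ract x a) c;
  lractA : forall b x a, ract (lact b x) a = lact b (ract x a)
}.

Section Actions.
Variables (k : fieldType) (B A : algType k) (M : bimod B A).

HB.instance Definition _ (b : B) :=
  GRing.isLinear.Build k M M _ (@lact k B A M b) (@lact_linearr _ _ _ M b).
HB.instance Definition _ (x : M) :=
  GRing.isLinear.Build k A M _ (@ract k B A M x) (@ract_linearr _ _ _ M x).

Lemma lact0l (x : M) : lact 0 x = 0.
Proof. by have := lact_linearl x (-1) 0 0; rewrite /= scaler0 addr0 scaleN1r addNr. Qed.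

Lemma lactDl (b c : B) (x : M) : lact (b + c) x = lact b x + lact c x.
Proof. by have := lact_linearl x 1 b c; rewrite /= !scale1r. Qed.

Lemma lactZl a (b : B) (x : M) : lact (a *: b) x = a *: lact b x.
Proof. by have := lact_linearl x a b 0; rewrite /= lact0l !addr0. Qed.

Lemma ract0l (a : A) : ract (0 : M) a = 0.
Proof.
by have := ract_linearl a (-1) (0 : M) 0; rewrite /= scaler0 addr0 scaleN1r addNr.
Qed.

Lemma ractDl (a : A) (x y : M) : ract (x + y) a = ract x a + ract y a.
Proof. by have := ract_linearl a 1 x y; rewrite /= !scale1r. Qed.

Lemma ractZl c (a : A) (x : M) : ract (c *: x) a = c *: ract x a.
Proof. by have := ract_linearl a c x 0; rewrite /= ract0l !addr0. Qed.

End Actions.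

Definition is_bihom (k : fieldType) (B A : algType k) (M N : bimod B A)
    (f : M -> N) : Prop :=
  [/\ linear f, forall b x, f (lact b x) = lact b (f x)
    & forall x a, f (ract x a) = ract (f x) a].

Definition projective (k : fieldType) (B A : algType k) (P : bimod B A) : Prop :=
  forall (U V : bimod B A) (g : U -> V) (h : P -> V),
    is_bihom g -> is_bihom h -> (forall v, exists u, g u = v) ->
    exists2 h' : P -> U, is_bihom h' & forall x, g (h' x) = h x.

Record proj_resolution (k : fieldType) (B A : algType k) (M : bimod B A) :=
  ProjResolution {
  res_obj :> nat -> bimod B A;
  res_d : forall n, res_obj n.+1 -> res_obj n;
  res_aug : res_obj 0 -> M;
  res_proj : forall n, projective (res_obj n);
  res_d_hom : forall n, is_bihom (@res_d n);
  res_aug_hom : is_bihom res_aug;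
  res_aug_surj : forall m, exists x, res_aug x = m;
  res_aug_exact : forall x, res_aug x = 0 <-> exists y, x = @res_d 0 y;
  res_exact : forall n x, @res_d n x = 0 <-> exists y, x = @res_d n.+1 y
}.
Arguments res_d {k B A M} p n x.

Section Hom.
Variables (k : fieldType) (B A : algType k) (M N : bimod B A).

Definition bihom_pred : {pred M -> N} := fun f => `[< is_bihom f >].

Fact bihom_closed : submod_closed bihom_pred.
Proof.
split=> [|c f g]; rewrite !unfold_in.
  have z0 x : (0 : M -> N) x = 0 by [].
  apply/asboolP; split=> [a x y|b x|x a]; rewrite !z0 ?linear0 ?ract0l //.
  by rewrite addr0.
move=> /asboolP[fL fl fr] /asboolP[gL gl gr]; apply/asboolP.
split=> [a x y|b x|x a] /=.
- rewrite !fctE /= fL gL !scalerDr !scalerA (mulrC c a) -!addrA.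
  by congr (_ + _); rewrite addrCA.
- by rewrite !fctE /= fl gl linearP.
- by rewrite !fctE /= fr gr ractDl ractZl.
Qed.
HB.instance Definition _ :=
  GRing.isSubmodClosed.Build k (M -> N) bihom_pred bihom_closed.

Definition bihom : lmodType k := subsp bihom_pred.

End Hom.

Section Ext.
Variables (k : fieldType) (B A : algType k) (M : bimod B A).
Variables (P : proj_resolution M) (N : bimod B A).

Fact hom_d_subproof n (f : bihom (P n) N) :
  (fun x => val f (res_d P n x)) \in @bihom_pred k B A (P n.+1) N.
Proof.
have /asboolP[fL fl fr] := subsp_valP f.
have [dL dl dr] := res_d_hom P n.
apply/asboolP; split=> [c x y|b x|x a] /=; first by rewrite dL fL.
  by rewrite dl fl.
by rewrite dr fr.
Qed.

Definition hom_d n (f : bihom (P n) N) : bihom (P n.+1) N :=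
  Subsp (hom_d_subproof f).

Fact hom_d_linear n : linear (@hom_d n).
Proof. by move=> c f g; apply: val_inj. Qed.
HB.instance Definition _ n :=
  GRing.isLinear.Build k _ _ _ (@hom_d n) (@hom_d_linear n).

Fact hom_dd n (f : bihom (P n) N) : hom_d (hom_d f) = 0.
Proof.
apply: val_inj; apply/funext=> x /=.
have /asboolP[fL _ _] := subsp_valP f.
have -> : res_d P n (res_d P n.+1 x) = 0.
  by apply/res_exact; exists x.
by have := fL (-1) 0 0; rewrite scaler0 addr0 scaleN1r addNr => ->.
Qed.

Definition hom_complex : complex k := 
  @Complex k (fun n => bihom (P n) N) (fun n => @hom_d n) hom_dd.

(* Up to isomorphism this does not depend on the resolution P. *)
Definition Ext (s : int) : lmodType k := cohomology hom_complex s.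

End Ext.

(* The free bimodule on S: formal expressions modulo the identities that hold
   in every bimodule. *)
Section FreeBimod.
Variables (k : fieldType) (B A : algType k) (S : Type).

Inductive fexpr :=
  | FGen of S
  | FZero
  | FAdd of fexpr & fexpr
  | FOpp of fexpr
  | FScale of k & fexpr
  | FLact of B & fexpr
  | FRact of fexpr & A.

HB.instance Definition _ := gen_eqMixin fexpr.
HB.instance Definition _ := gen_choiceMixin fexpr.

Fixpoint feval (N : bimod B A) (g : S -> N) (x : fexpr) : N :=
  match x with
  | FGen s => g s
  | FZero => 0
  | FAdd x y => feval g x + feval g y
  | FOpp x => - feval g x
  | FScale c x => c *: feval g x
  | FLact b x => lact b (feval g x)
  | FRact x a => ract (feval g x) a
  end.

Definition feq (x y : fexpr) : bool :=
  `[< forall (N : bimod B A) (g : S -> N), feval g x = feval g y >].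

Fact feqP : equiv_class_of feq.
Proof.
split=> [x|x y|y x z]; first exact/asboolP.
  by apply/asboolP/asboolP=> xy N g; rewrite xy.
by move=> /asboolP xy /asboolP yz; apply/asboolP=> N g; rewrite xy yz.
Qed.
Canonical feq_equiv := EquivRelPack feqP.
Canonical feq_encModRel := defaultEncModRel feq.

Definition freebim : Type := {eq_quot feq}.
HB.instance Definition _ := EqQuotient.on freebim.
HB.instance Definition _ := Choice.on freebim.

Definition fpi (x : fexpr) : freebim := \pi_freebim x.
Definition flift (N : bimod B A) (g : S -> N) (x : freebim) : N :=
  feval g (repr x).

Lemma flift_pi (N : bimod B A) (g : S -> N) x : flift g (fpi x) = feval g x.
Proof.
have : fpi (repr (fpi x)) == fpi x by rewrite /fpi reprK.
by rewrite {1}/fpi [X in _ == X]/fpi piE => /asboolP; apply.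
Qed.

Lemma freebim_eq (x y : freebim) :
  (forall (N : bimod B A) (g : S -> N), flift g x = flift g y) -> x = y.
Proof.
move=> xy; rewrite -[x]reprK -[y]reprK; apply/eqP.
by rewrite piE; apply/asboolP=> N g; apply: xy.
Qed.

Definition f_zero := fpi FZero.
Definition f_add (x y : freebim) := fpi (FAdd (repr x) (repr y)).
Definition f_opp (x : freebim) := fpi (FOpp (repr x)).
Definition f_scale c (x : freebim) := fpi (FScale c (repr x)).
Definition f_lact b (x : freebim) := fpi (FLact b (repr x)).
Definition f_ract (x : freebim) a := fpi (FRact (repr x) a).

Let fE := (flift_pi, scalerDr, scalerDl, scalerA, scale1r).

Fact f_addA : associative f_add.
Proof.
by move=> x y z; apply: freebim_eq => N g; rewrite !fE /= -!/(flift _ _) !fE addrA.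
Qed.
Fact f_addC : commutative f_add.
Proof. by move=> x y; apply: freebim_eq => N g; rewrite !fE /= addrC. Qed.
Fact f_add0 : left_id f_zero f_add.
Proof.
by move=> x; apply: freebim_eq => N g; rewrite !fE /= -!/(flift _ _) !fE /= add0r.
Qed.
Fact f_addN : left_inverse f_zero f_opp f_add.
Proof.
by move=> x; apply: freebim_eq => N g; rewrite !fE /= -!/(flift _ _) !fE /= addNr.
Qed.
HB.instance Definition _ := GRing.isZmodule.Build freebim
  f_addA f_addC f_add0 f_addN.

Lemma fliftD (N : bimod B A) (g : S -> N) : {morph flift g : x y / x + y}.
Proof. by move=> x y; apply: flift_pi. Qed.

Fact f_scaleA c d x : f_scale c (f_scale d x) = f_scale (c * d) x.
Proof. by apply: freebim_eq => N g; rewrite !fE /= -!/(flift _ _) !fE. Qed.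
Fact f_scale1 : left_id 1 f_scale.
Proof. by move=> x; apply: freebim_eq => N g; rewrite !fE /= !fE. Qed.
Fact f_scaleDr : right_distributive f_scale +%R.
Proof.
move=> c x y; apply: freebim_eq => N g.
by rewrite !fliftD !fE /= -!/(flift _ _) fliftD !fE.
Qed.
Fact f_scaleDl x : {morph f_scale^~ x : c d / c + d}.
Proof. by move=> c d; apply: freebim_eq => N g; rewrite fliftD !fE /= !fE. Qed.
HB.instance Definition _ := GRing.Zmodule_isLmodule.Build k freebim
  f_scaleA f_scale1 f_scaleDr f_scaleDl.

Lemma flift_linear (N : bimod B A) (g : S -> N) : linear (flift g).
Proof. by move=> c x y; rewrite fliftD; congr (_ + _); apply: flift_pi. Qed.

Lemma flift_lact (N : bimod B A) (g : S -> N) b x :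
  flift g (f_lact b x) = lact b (flift g x).
Proof. exact: flift_pi. Qed.
Lemma flift_ract (N : bimod B A) (g : S -> N) x a :
  flift g (f_ract x a) = ract (flift g x) a.
Proof. exact: flift_pi. Qed.

Let gE := (flift_lact, flift_ract, flift_linear).

Fact f_lact_linearl x : linear (f_lact^~ x).
Proof.
by move=> c b d; apply: freebim_eq => N g; rewrite !gE lactDl lactZl.
Qed.
Fact f_lact_linearr b : linear (f_lact b).
Proof. by move=> c x y; apply: freebim_eq => N g; rewrite !gE linearP. Qed.
Fact f_ract_linearl a : linear (f_ract^~ a).
Proof.
by move=> c x y; apply: freebim_eq => N g; rewrite !gE ractDl ractZl.
Qed.
Fact f_ract_linearr x : linear (f_ract x).
Proof. by move=> c x' y; apply: freebim_eq => N g; rewrite !gE linearP. Qed.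
Fact f_lact1 x : f_lact 1 x = x.
Proof. by apply: freebim_eq => N g; rewrite !gE lact1. Qed.
Fact f_ract1 x : f_ract x 1 = x.
Proof. by apply: freebim_eq => N g; rewrite !gE ract1. Qed.
Fact f_lactA b c x : f_lact (b * c) x = f_lact b (f_lact c x).
Proof. by apply: freebim_eq => N g; rewrite !gE lactA. Qed.
Fact f_ractA x a c : f_ract x (a * c) = f_ract (f_ract x a) c.
Proof. by apply: freebim_eq => N g; rewrite !gE ractA. Qed.
Fact f_lractA b x a : f_ract (f_lact b x) a = f_lact b (f_ract x a).
Proof. by apply: freebim_eq => N g; rewrite !gE lractA. Qed.

Definition free_bimod : bimod B A := Bimod
  f_lact_linearl f_lact_linearr f_ract_linearl f_ract_linearr
  f_lact1 f_ract1 f_lactA f_ractA f_lractA.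

Definition fgen (s : S) : free_bimod := fpi (FGen s).

Lemma flift_gen (N : bimod B A) (g : S -> N) s : flift g (fgen s) = g s.
Proof. exact: flift_pi. Qed.

Lemma flift_hom (N : bimod B A) (g : S -> N) :
  is_bihom (flift g : free_bimod -> N).
Proof.
split; [exact: flift_linear | exact: flift_lact | exact: flift_ract].
Qed.

Lemma free_bimod_ext (N : bimod B A) (h h' : free_bimod -> N) :
  is_bihom h -> is_bihom h' -> (forall s, h (fgen s) = h' (fgen s)) -> h =1 h'.
Proof.
move=> [hL hl hr] [hL' hl' hr'] hg x; rewrite -[x]reprK -/(fpi _).
have E (f : free_bimod -> N) : linear f ->
    [/\ f 0 = 0, {morph f : u v / u + v}, {morph f : u / - u} &
      forall c, {morph f : u / c *: u}].
  move=> fL; have f0 : f 0 = 0.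
    by have := fL (-1) 0 0; rewrite scaler0 addr0 scaleN1r addNr.
  have fZ c : {morph f : u / c *: u}.
    by move=> u; have := fL c u 0; rewrite f0 !addr0.
  split=> // [u v|u]; first by have := fL 1 u v; rewrite !scale1r.
  by rewrite -scaleN1r fZ scaleN1r.
have [h0 hD hN hZ] := E _ hL; have [h0' hD' hN' hZ'] := E _ hL'.
have pE y : fpi y = feval fgen y :> free_bimod.
  apply: freebim_eq => N' g; rewrite flift_pi; have [gL gl gr] := flift_hom g.
  have [g0 gD gN gZ] : [/\ flift g 0 = 0, {morph flift g : u v / u + v},
      {morph flift g : u / - u} & forall c, {morph flift g : u / c *: u}].
    split; [exact: flift_pi | exact: fliftD | | ].
      by move=> u; apply: flift_pi.
    by move=> c u; apply: flift_pi.
  elim: y => [s||y IHy z IHz|y IHy|c y IHy|b y IHy|y IHy a] /=.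
  - by rewrite flift_gen.
  - by rewrite g0.
  - by rewrite gD IHy IHz.
  - by rewrite gN IHy.
  - by rewrite gZ IHy.
  - by rewrite gl IHy.
  by rewrite gr IHy.
rewrite pE; elim: (repr x) => [s||y IHy z IHz|y IHy|c y IHy|b y IHy|y IHy a] /=.
- exact: hg.
- by rewrite h0 h0'.
- by rewrite hD hD' IHy IHz.
- by rewrite hN hN' IHy.
- by rewrite hZ hZ' IHy.
- by rewrite hl hl' IHy.
by rewrite hr hr' IHy.
Qed.

Lemma free_bimod_projective : projective free_bimod.
Proof.
move=> U V g h gh hh gsurj.
have [u uE] := choice (fun s => gsurj (h (fgen s))).
exists (flift u); first exact: flift_hom.
move=> x; apply: (@free_bimod_ext V (g \o flift u) h) => // [|s].
  have [gL gl gr] := gh; have [uL ul ur] := flift_hom u.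
  by split=> [c y z|b y|y a] /=; rewrite ?uL ?gL ?ul ?gl ?ur ?gr.
by rewrite /= flift_gen uE.
Qed.

End FreeBimod.

Section KernelBimod.
Variables (k : fieldType) (B A : algType k) (M N : bimod B A) (f : M -> N).
Hypothesis fhom : is_bihom f.

Definition ker_pred : {pred M} := fun x => f x == 0.

Let f0 : f 0 = 0.
Proof.
have [fL _ _] := fhom.
by have := fL (-1) 0 0; rewrite scaler0 addr0 scaleN1r addNr.
Qed.

Fact ker_closed : submod_closed ker_pred.
Proof.
have [fL _ _] := fhom; split=> [|c x y]; rewrite !unfold_in ?f0 //.
by move=> /eqP fx /eqP fy; rewrite fL fx fy scaler0 addr0.
Qed.
HB.instance Definition _ := GRing.isSubmodClosed.Build k M ker_pred ker_closed.

Fact ker_lact_subproof b (x : subsp ker_pred) : lact b (val x) \in ker_pred.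
Proof.
have [_ fl _] := fhom; have /eqP fx : f (val x) == 0 := subsp_valP x.
by apply/eqP; rewrite fl fx linear0.
Qed.
Fact ker_ract_subproof (x : subsp ker_pred) a : ract (val x) a \in ker_pred.
Proof.
have [_ _ fr] := fhom; have /eqP fx : f (val x) == 0 := subsp_valP x.
by apply/eqP; rewrite fr fx ract0l.
Qed.
Definition ker_lact b x := Subsp (ker_lact_subproof b x).
Definition ker_ract x a := Subsp (ker_ract_subproof x a).

Definition ker_bimod : bimod B A.
Proof.
apply: (@Bimod k B A (subsp ker_pred) ker_lact ker_ract) => *;
  try (move=> ? ? ?); apply: val_inj.
- exact: lact_linearl.
- exact: lact_linearr.
- exact: ract_linearl.
- exact: ract_linearr.
- exact: lact1.
- exact: ract1.
- exact: lactA.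
- exact: ractA.
exact: lractA.
Defined.

End KernelBimod.

Section ResolutionExists.
Variables (k : fieldType) (B A : algType k) (M : bimod B A).

Record bicover := BiCover {
  cov_tgt : bimod B A;
  cov_src : bimod B A;
  cov_map : cov_src -> cov_tgt;
  cov_hom : is_bihom cov_map;
  cov_surj : forall v, exists u, cov_map u = v;
  cov_proj : projective cov_src
}.

Definition free_cover (N : bimod B A) : bicover.
Proof.
apply: (@BiCover N (free_bimod B A N) (flift (id : N -> N))).
- exact: flift_hom.
- by move=> v; exists (fgen B A v); rewrite flift_gen.
exact: free_bimod_projective.
Defined.

Fixpoint free_covers n : bicover :=
  if n is m.+1 then free_cover (ker_bimod (cov_hom (free_covers m)))
  else free_cover M.

Lemma proj_resolution_exists : inhabited (proj_resolution M).
Proof.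
constructor.
pose K n := ker_bimod (cov_hom (free_covers n)).
pose d n (x : cov_src (free_covers n.+1)) : cov_src (free_covers n) :=
  subsp_val (cov_map x : K n).
have dE n (x : cov_src (free_covers n)) :
    cov_map x = 0 <-> exists y, x = d n y.
  split=> [x0|[y ->]].
    have xK : x \in @ker_pred _ _ _ _ _ (@cov_map (free_covers n)) by apply/eqP.
    have [y yE] := cov_surj (Subsp xK : cov_tgt (free_covers n.+1)).
    by exists y; rewrite /d yE.
  by apply/eqP; exact: (subsp_valP (cov_map y : K n)).
apply: (@ProjResolution k B A M (fun n => cov_src (free_covers n)) d
  (@cov_map (free_covers 0))).
- by move=> n; apply: cov_proj.
- move=> n; have [L l r] := cov_hom (free_covers n.+1).
  by split=> [c x y|b x|x a]; rewrite /d ?L ?l ?r.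
- exact: cov_hom.
- exact: (@cov_surj (free_covers 0)).
- exact: dE.
move=> n x; rewrite -dE; split=> [x0|x0]; last by rewrite /d x0.
exact: val_inj.
Qed.

End ResolutionExists.

(* An [A2]-balanced morphism of bimodules $N\otimes M\to L$. *)
Record balanced_map (k : fieldType) (A1 A2 A3 : algType k)
    (N : bimod A3 A2) (M : bimod A2 A1) (L : bimod A3 A1) := BalancedMap {
  bal_map :> N -> M -> L;
  bal_linearl : forall y, linear (bal_map^~ y);
  bal_linearr : forall x, linear (bal_map x);
  bal_balanced : forall x a y, bal_map (ract x a) y = bal_map x (lact a y);
  bal_lact : forall b x y, bal_map (lact b x) y = lact b (bal_map x y);
  bal_ract : forall x y a, bal_map x (ract y a) = ract (bal_map x y) a
}.

(* The matrix with entry [ent_ji] in row j and column i. *)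
Record triang (k : fieldType) (A1 A2 A3 : algType k)
    (M21 : bimod A2 A1) (M32 : bimod A3 A2) (M31 : bimod A3 A1)
    (mu : balanced_map M32 M21 M31) := Triang {
  ent11 : A1; ent22 : A2; ent33 : A3;
  ent21 : M21; ent32 : M32; ent31 : M31
}.

Section Triangular.
Variables (k : fieldType) (A1 A2 A3 : algType k).
Variables (M21 : bimod A2 A1) (M32 : bimod A3 A2) (M31 : bimod A3 A1).
Variable mu : balanced_map M32 M21 M31.
Local Notation T := (triang mu).
Implicit Types x y z : T.

Lemma bal0l v : mu 0 v = 0.
Proof.
by have := bal_linearl mu v (-1) 0 0; rewrite /= scaler0 addr0 scaleN1r addNr.
Qed.
Lemma bal0r u : mu u 0 = 0.
Proof.
by have := bal_linearr mu u (-1) 0 0; rewrite /= scaler0 addr0 scaleN1r addNr.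
Qed.
Lemma balDl u u' v : mu (u + u') v = mu u v + mu u' v.
Proof. by have := bal_linearl mu v 1 u u'; rewrite /= !scale1r. Qed.
Lemma balDr u v v' : mu u (v + v') = mu u v + mu u v'.
Proof. by have := bal_linearr mu u 1 v v'; rewrite /= !scale1r. Qed.
Lemma balZl c u v : mu (c *: u) v = c *: mu u v.
Proof. by have := bal_linearl mu v c u 0; rewrite /= bal0l !addr0. Qed.
Lemma balZr c u v : mu u (c *: v) = c *: mu u v.
Proof. by have := bal_linearr mu u c v 0; rewrite /= bal0r !addr0. Qed.

Definition triang_tuple x :=
  (ent11 x, ent22 x, ent33 x, ent21 x, ent32 x, ent31 x).
Definition tuple_triang (u : A1 * A2 * A3 * M21 * M32 * M31) : T :=
  let: (x11, x22, x33, x21, x32, x31) := u in Triang mu x11 x22 x33 x21 x32 x31.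
Fact triang_tupleK : cancel triang_tuple tuple_triang.
Proof. by case. Qed.
HB.instance Definition _ := Choice.copy T (can_type triang_tupleK).

Definition triang0 : T := Triang mu 0 0 0 0 0 0.
Definition triang1 : T := Triang mu 1 1 1 0 0 0.
Definition triang_opp x : T := Triang mu (- ent11 x) (- ent22 x) (- ent33 x)
  (- ent21 x) (- ent32 x) (- ent31 x).
Definition triang_add x y : T :=
  Triang mu (ent11 x + ent11 y) (ent22 x + ent22 y) (ent33 x + ent33 y)
    (ent21 x + ent21 y) (ent32 x + ent32 y) (ent31 x + ent31 y).
Definition triang_scale (c : k) x : T :=
  Triang mu (c *: ent11 x) (c *: ent22 x) (c *: ent33 x)
    (c *: ent21 x) (c *: ent32 x) (c *: ent31 x).
Definition triang_mul x y : T :=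
  Triang mu (ent11 x * ent11 y) (ent22 x * ent22 y) (ent33 x * ent33 y)
    (ract (ent21 x) (ent11 y) + lact (ent22 x) (ent21 y))
    (ract (ent32 x) (ent22 y) + lact (ent33 x) (ent32 y))
    (ract (ent31 x) (ent11 y) + mu (ent32 x) (ent21 y)
       + lact (ent33 x) (ent31 y)).

Fact triang_addA : associative triang_add.
Proof. by move=> x y z; rewrite /triang_add /= !addrA. Qed.
Fact triang_addC : commutative triang_add.
Proof. by move=> x y; congr Triang; apply: addrC. Qed.
Fact triang_add0 : left_id triang0 triang_add.
Proof. by case=> *; rewrite /triang_add /= !add0r. Qed.
Fact triang_addN : left_inverse triang0 triang_opp triang_add.
Proof. by move=> x; rewrite /triang_add /= !addNr. Qed.
HB.instance Definition _ := GRing.isZmodule.Build T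
  triang_addA triang_addC triang_add0 triang_addN.

Fact triang_scaleA c d x :
  triang_scale c (triang_scale d x) = triang_scale (c * d) x.
Proof. by rewrite /triang_scale /= !scalerA. Qed.
Fact triang_scale1 : left_id 1 triang_scale.
Proof. by case=> *; rewrite /triang_scale /= !scale1r. Qed.
Fact triang_scaleDr : right_distributive triang_scale +%R.
Proof. by move=> c x y; congr Triang; apply: scalerDr. Qed.
Fact triang_scaleDl x : {morph triang_scale^~ x : c d / c + d}.
Proof. by move=> c d; congr Triang; apply: scalerDl. Qed.
HB.instance Definition _ := GRing.Zmodule_isLmodule.Build k T
  triang_scaleA triang_scale1 triang_scaleDr triang_scaleDl.

Fact triang_mulA : associative triang_mul.
Proof.
move=> x y z; congr Triang; rewrite ?mulrA //=;
  rewrite ?ractDl ?linearD /= ?balDl ?balDr ?ractDl ?lactA ?ractA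
    ?lractA ?bal_lact ?bal_ract ?bal_balanced -?addrA //.
by do 2!congr (_ + _); rewrite addrCA.
Qed.

Fact triang_mul1x : left_id triang1 triang_mul.
Proof.
case=> *; rewrite /triang_mul /= !mul1r !ract0l !bal0l !lact1.
by rewrite !add0r.
Qed.

Fact triang_mulx1 : right_id triang1 triang_mul.
Proof.
case=> *; rewrite /triang_mul /= !mulr1 !linear0 !bal0r !ract1.
by rewrite !addr0.
Qed.

Fact triang_mulDl : left_distributive triang_mul +%R.
Proof.
move=> x y z; congr Triang; rewrite /= ?mulrDl ?ractDl ?balDl ?lactDl //.
- exact: addrACA.
- exact: addrACA.
by rewrite [RHS]addrACA; congr (_ + _); rewrite addrACA.
Qed.

Fact triang_mulDr : right_distributive triang_mul +%R.
Proof.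
move=> x y z; congr Triang; rewrite /= ?mulrDr ?linearD ?balDr //=.
- exact: addrACA.
- exact: addrACA.
by rewrite [RHS]addrACA; congr (_ + _); rewrite addrACA.
Qed.

Fact triang1_neq0 : triang1 != 0.
Proof. by apply/eqP=> /(congr1 (@ent11 _ _ _ _ _ _ _ _))/eqP; rewrite oner_eq0. Qed.

HB.instance Definition _ := GRing.Zmodule_isNzRing.Build T
  triang_mulA triang_mul1x triang_mulx1 triang_mulDl triang_mulDr triang1_neq0.

Fact triang_scaleAl (c : k) x y : c *: (x * y) = (c *: x) * y.
Proof.
by congr Triang; rewrite /= ?scalerAl // !scalerDr ?ractZl ?balZl ?lactZl.
Qed.
HB.instance Definition _ :=
  GRing.Lmodule_isLalgebra.Build k T triang_scaleAl.

Fact triang_scaleAr (c : k) x y : c *: (x * y) = x * (c *: y).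
Proof.
by congr Triang; rewrite /= ?scalerAr // !scalerDr ?linearZ ?balZr.
Qed.
HB.instance Definition _ :=
  GRing.Lalgebra_isAlgebra.Build k T triang_scaleAr.

End Triangular.

Section Hochschild.
Variables (k : fieldType) (T : algType k) (X : bimod T T).
(* [e] is the family of vertices of the quiver e_0 -> e_1 -> ...; there is one
   path from e_i to e_j when i <= j, and none otherwise. *)
Variables (N : nat) (e : 'I_N -> T).
Implicit Types (l : nat) (r : T).

Definition in_R r : Prop := exists c : 'I_N -> k, r = \sum_i c i *: e i.

Definition multilinear l (f : ('I_l -> T) -> X) : Prop :=
  forall (p : 'I_l) (t : 'I_l -> T) (c : k) (x y : T),
    f [eta t with p |-> c *: x + y]
      = c *: f [eta t with p |-> x] + f [eta t with p |-> y].

(* Moving [r] across the p-th of the l+1 gaps of $(t_1,\dots,t_l)$. *)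
Definition mulr_gap l (p : nat) r (t : 'I_l -> T) : 'I_l -> T :=
  fun j => if j.+1 == p then t j * r else t j.
Definition mull_gap l (p : nat) r (t : 'I_l -> T) : 'I_l -> T :=
  fun j => if j == p :> nat then r * t j else t j.
Definition gapl l p r (f : ('I_l -> T) -> X) (t : 'I_l -> T) : X :=
  if p == 0%N then lact r (f t) else f (mulr_gap p r t).
Definition gapr l p r (f : ('I_l -> T) -> X) (t : 'I_l -> T) : X :=
  if p == l then ract (f t) r else f (mull_gap p r t).

(* For l = 0 this says that the value of [f] commutes with R. *)
Definition balanced l (f : ('I_l -> T) -> X) : Prop :=
  forall p r t, (p <= l)%N -> in_R r -> gapl p r f t = gapr p r f t.

(* $\mathrm{Hom}_{R-R}(T^{\otimes_R l},X)$, through the universal property of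
   the tensor product; for l = 0 a morphism $R\to X$ is encoded by the image
   of 1, which is the value on the empty family. *)
Definition hoch l : {pred ('I_l -> T) -> X} :=
  fun f => `[< multilinear f /\ balanced f >].

(* The factors are numbered from 0: for 0 < i < l+1 the factors i-1 and i are
   multiplied, for i = 0 (resp. l+1) the first (resp. last) one is dropped. *)
Definition contract l (i : nat) (t : 'I_l.+1 -> T) : 'I_l -> T :=
  fun j => if (j.+1 < i)%N then t (widen_ord (leqnSn l) j)
           else if j.+1 == i then t (widen_ord (leqnSn l) j) * t (lift ord0 j)
           else t (lift ord0 j).

Definition hface l (i : nat) (f : ('I_l -> T) -> X) (t : 'I_l.+1 -> T) : X :=
  if i == 0%N then lact (t ord0) (f (contract i t))
  else if i == l.+1 then ract (f (contract i t)) (t ord_max)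
  else f (contract i t).

(* The Hochschild coboundary; for l = 0 it gives [t x - x t]. *)
Definition hdiff l (f : ('I_l -> T) -> X) (t : 'I_l.+1 -> T) : X :=
  \sum_(i < l.+2) (-1) ^+ i *: hface i f t.

Fact hoch_closed l : submod_closed (@hoch l).
Proof.
split=> [|c f g].
  have z0 t : (0 : ('I_l -> T) -> X) t = 0 by [].
  apply/asboolP; split=> [p t c x y|p r t _ _].
    by rewrite !z0 scaler0 addr0.
  by rewrite /gapl /gapr !z0 linear0 ract0l; case: ifP; case: ifP.
move=> /asboolP[fL fb] /asboolP[gL gb]; apply/asboolP; split=> [p t d x y|].
  rewrite !fctE fL gL !scalerDr !scalerA (mulrC c d) -!addrA.
  by congr (_ + _); rewrite addrCA.
move=> p r t pl rR; move: (fb p r t pl rR) (gb p r t pl rR).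
rewrite /gapl /gapr !fctE linearP ractDl ractZl.
by case: (p == 0%N); case: (p == l) => /= -> ->.
Qed.
HB.instance Definition _ l :=
  GRing.isSubmodClosed.Build k _ (@hoch l) (@hoch_closed l).

Definition lin_rel l p (c : k) (t t1 t2 : 'I_l -> T) : Prop :=
  [/\ t p = c *: t1 p + t2 p & forall j, j != p -> t1 j = t j /\ t2 j = t j].

Lemma multilinearP l (f : ('I_l -> T) -> X) : multilinear f <->
  forall p c t t1 t2, lin_rel p c t t1 t2 -> f t = c *: f t1 + f t2.
Proof.
split=> fL => [p c t t1 t2 [tp tj]|p t c x y].
  have := fL p t c (t1 p) (t2 p).
  have E (u : 'I_l -> T) : (forall j, j != p -> u j = t j) ->
      ([eta t with p |-> u p] : 'I_l -> T) = u.
    by move=> uj; apply/funext=> j /=; case: eqP => [->|/eqP/uj].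
  by rewrite -tp !E // => j /tj[].
apply: (fL p); split; rewrite /= ?eqxx // => j /negPf jp.
by rewrite jp.
Qed.

Lemma lift0_inord l (m : 'I_l) : lift ord0 m = inord m.+1.
Proof. by apply: val_inj; rewrite /= inordK ?ltnS. Qed.
Lemma widen_inord l (m : 'I_l) : widen_ord (leqnSn l) m = inord m.
Proof. by apply: val_inj; rewrite /= inordK // ltnS ltnW. Qed.

Lemma contractE l i (t : 'I_l.+1 -> T) j : contract i t j =
  if (j.+1 < i)%N then t (inord j)
  else if j.+1 == i then t (inord j) * t (inord j.+1) else t (inord j.+1).
Proof. by rewrite /contract widen_inord lift0_inord. Qed.

Lemma hface_multilinear l i (f : ('I_l -> T) -> X) :
  (i < l.+2)%N -> multilinear f -> multilinear (hface i f).
Proof.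
move=> il /multilinearP fL; apply/multilinearP=> p c t t1 t2 [tp tj].
have tjN (n : nat) : (n <= l)%N -> n != p ->
    t1 (inord n) = t (inord n) /\ t2 (inord n) = t (inord n).
  by move=> nl np; apply: tj; rewrite -val_eqE /= inordK ?ltnS.
have same : (i == 0%N) && (p == 0%N :> nat) || (i == l.+1) && (p == l :> nat) ->
    contract i t1 = contract i t /\ contract i t2 = contract i t.
  move=> ip.
  have E (j : 'I_l) : let n := (if i == 0 then j.+1 else j)%N in
      t1 (inord n) = t (inord n) /\ t2 (inord n) = t (inord n).
    by apply: tjN; have := ltn_ord j; move: ip; case: eqP => /=; lia.
  split; apply/funext=> j; rewrite !contractE; have [E1 E2] := E j;
  case/orP: ip E1 E2 => /andP[/eqP-> _] //=;
  by rewrite ltnS ltn_ord.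
rewrite /hface.
case: (boolP ((i == 0%N) && (p == 0%N :> nat))) => [/andP[i0 p0]|ip0].
  have [-> ->] : contract i t1 = contract i t /\ contract i t2 = contract i t.
    by apply: same; rewrite i0 p0.
  rewrite i0; have <- : p = ord0 by apply/val_inj/eqP.
  by rewrite tp lactDl lactZl.
case: (boolP ((i == l.+1) && (p == l :> nat))) => [/andP[il1 pl]|ipl].
  have [-> ->] : contract i t1 = contract i t /\ contract i t2 = contract i t.
    by apply: same; rewrite il1 pl orbT.
  rewrite il1 (eqP il1) /=; have <- : p = ord_max by apply/val_inj/eqP.
  by rewrite tp linearP.
have ql : ((if (p < i)%N then nat_of_ord p else p.-1) < l)%N.
  by have := ltn_ord p; case: ifP; lia.
pose q := Ordinal ql.
have rel : lin_rel q c (contract i t) (contract i t1) (contract i t2).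
  split=> [|j jq].
    rewrite !contractE /q /=; case: (ltnP p i) => pi /=.
      rewrite inord_val; case: ltnP => // pi1.
      have -> /= : p.+1 == i by lia.
      have [-> ->] : t1 (inord p.+1) = t (inord p.+1) /\
                     t2 (inord p.+1) = t (inord p.+1) by apply: tjN; lia.
      by rewrite tp mulrDl scalerAl.
    have p1 : p.-1.+1 = p by lia.
    rewrite !p1 inord_val ltnNge pi /=; case: eqP => // ip.
    have [-> ->] : t1 (inord p.-1) = t (inord p.-1) /\
                   t2 (inord p.-1) = t (inord p.-1) by apply: tjN; lia.
    by rewrite tp mulrDr scalerAr.
  have {}jq : nat_of_ord j != if (p < i)%N then nat_of_ord p else p.-1 by [].
  have jl := ltn_ord j; rewrite !contractE.
  case: (ltnP j.+1 i) => ji; first by apply: tjN; [|move: jq; case: ifP]; lia.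
  case: (eqVneq j.+1 i) => ji'.
    have [-> ->] : t1 (inord j) = t (inord j) /\ t2 (inord j) = t (inord j).
      by apply: tjN; move: jq; case: ifP; lia.
    have [-> -> //] : t1 (inord j.+1) = t (inord j.+1) /\
                      t2 (inord j.+1) = t (inord j.+1).
    by apply: tjN; move: jq; case: ifP; lia.
  by apply: tjN; move: jq; case: ifP; lia.
rewrite (fL _ _ _ _ _ rel); case: eqP => i0.
  have [-> ->] : t1 ord0 = t ord0 /\ t2 ord0 = t ord0.
    by apply: tj; rewrite -val_eqE /=; move: ip0; rewrite i0 /= eq_sym.
  by rewrite linearP.
case: eqP => // il1.
have [-> ->] : t1 ord_max = t ord_max /\ t2 ord_max = t ord_max.
  by apply: tj; rewrite -val_eqE /=; move: ipl; rewrite il1 eqxx /= eq_sym.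
by rewrite ractDl ractZl.
Qed.

Lemma mulr_gap0 l r (t : 'I_l -> T) : mulr_gap 0 r t = t.
Proof. by []. Qed.
Lemma mull_gap_max l r (t : 'I_l -> T) : mull_gap l r t = t.
Proof.
by apply/funext=> j; rewrite /mull_gap; case: eqP => // jl; have := ltn_ord j; lia.
Qed.

Lemma contract_gap_lt l i p r (t : 'I_l.+1 -> T) : (p < i)%N ->
  contract i (mulr_gap p r t) = mulr_gap p r (contract i t) /\
  contract i (mull_gap p r t) = mull_gap p r (contract i t).
Proof.
move=> pi; split; apply/funext=> j;
  rewrite /contract /mulr_gap /mull_gap /= /bump /= add1n;
  case: ltnP => ji; try (by case: eqP); case: eqP => ji';
  do ?[case: eqP => ? //]; by [rewrite mulrA | lia].
Qed.

Lemma contract_gap_gt l i p r (t : 'I_l.+1 -> T) : (i < p)%N ->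
  contract i (mulr_gap p r t) = mulr_gap p.-1 r (contract i t) /\
  contract i (mull_gap p r t) = mull_gap p.-1 r (contract i t).
Proof.
move=> pi; split; apply/funext=> j;
  rewrite /contract /mulr_gap /mull_gap /= /bump /= add1n;
  case: ltnP => ji; case: eqP => ji';
  do ?[case: eqP => ? //]; by [rewrite mulrA | lia].
Qed.

Lemma contract_gap_eq l i r (t : 'I_l.+1 -> T) :
  contract i (mulr_gap i r t) = contract i (mull_gap i r t).
Proof.
apply/funext=> j;
  rewrite /contract /mulr_gap /mull_gap /= /bump /= add1n;
  case: ltnP => ji; case: eqP => ji';
  do ?[case: eqP => ? //]; by [rewrite mulrA | lia].
Qed.

Lemma hface_gap_lt l i p r (f : ('I_l -> T) -> X) t :
  (p < i)%N -> (i < l.+2)%N ->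
  gapl p r (hface i f) t = hface i (gapl p r f) t /\
  gapr p r (hface i f) t = hface i (gapr p r f) t.
Proof.
move=> pi il; have i0 : (i == 0%N) = false by lia.
have [cr cl] := contract_gap_lt r t pi.
have pl1 : (p == l.+1) = false by lia.
rewrite /gapl /gapr /hface i0 pl1 cr cl; split.
  case: eqP => [p0|_]; last by rewrite [mulr_gap _ _ t _]/mulr_gap /= [l.+1 == p]eq_sym pl1.
  by case: eqP; rewrite ?lractA.
case: (eqVneq i l.+1) => [il1|il1]; last first.
  by have -> : (p == l) = false by lia.
case: (eqVneq p l) => [pl|pl]; rewrite [mull_gap _ _ t _]/mull_gap /=.
  by rewrite pl eqxx mull_gap_max ractA.
by rewrite [l == p]eq_sym (negPf pl).
Qed.

Lemma hface_gap_gt l i p r (f : ('I_l -> T) -> X) t :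
  (i < p)%N -> (p < l.+2)%N ->
  gapl p r (hface i f) t = hface i (gapl p.-1 r f) t /\
  gapr p r (hface i f) t = hface i (gapr p.-1 r f) t.
Proof.
move=> ip pl; have il : (i == l.+1) = false by lia.
have [cr cl] := contract_gap_gt r t ip.
have p0 : (p == 0%N) = false by lia.
rewrite /gapl /gapr /hface il p0 cr cl; split.
  case: (eqVneq i 0%N) => [i0|i0]; last first.
    by have -> : (p.-1 == 0%N) = false by lia.
  case: (eqVneq p.-1 0%N) => [p1|p1]; rewrite [mulr_gap _ _ t _]/mulr_gap /=.
    have -> : 1%N == p by lia.
    by rewrite p1 mulr_gap0 lactA.
  by have -> : 1%N == p = false by lia.
have -> : (p.-1 == l) = (p == l.+1) by lia.
case: (eqVneq p l.+1) => pl1; first by case: eqP; rewrite ?lractA.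
by rewrite [mull_gap _ _ t _]/mull_gap /= [0%N == p]eq_sym p0.
Qed.

Lemma hface_gap_eq l i r (f : ('I_l -> T) -> X) t : (i < l.+2)%N ->
  gapl i r (hface i f) t = gapr i r (hface i f) t.
Proof.
move=> il; have ce := contract_gap_eq i r t.
rewrite /gapl /gapr /hface ce; case: (eqVneq i 0%N) => [i0|i0].
  have -> : (i == l.+1) = false by lia.
  by rewrite i0 -[in RHS](i0) -ce i0 mulr_gap0 [mull_gap _ _ t _]/mull_gap /= lactA.
case: (eqVneq i l.+1) => // il1.
rewrite [mulr_gap _ _ t _]/mulr_gap /= il1 eqxx.
by rewrite mull_gap_max ractA.
Qed.

Lemma hface_ext l i (f g : ('I_l -> T) -> X) : f =1 g -> hface i f =1 hface i g.
Proof. by move=> /funext->. Qed.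

Lemma hface_balanced l i (f : ('I_l -> T) -> X) :
  (i < l.+2)%N -> balanced f -> balanced (hface i f).
Proof.
move=> il fb p r t pl rR; case: (ltngtP p i) => [pi|ip|->].
- have [-> ->] := hface_gap_lt r f t pi il.
  by apply: hface_ext => u; apply: fb => //; lia.
- have [-> ->] := hface_gap_gt r f t ip pl.
  by apply: hface_ext => u; apply: fb => //; lia.
exact: hface_gap_eq.
Qed.

Lemma hdiff_hoch l (f : ('I_l -> T) -> X) :
  f \in @hoch l -> hdiff f \in @hoch l.+1.
Proof.
move=> /asboolP[fL fb].
have -> : hdiff f = \sum_(i < l.+2) (-1) ^+ i *: hface i f.
  by apply/funext=> t; rewrite fct_sumE.
apply: rpred_sum => i _; apply: rpredZ; apply/asboolP.
by split; [apply: hface_multilinear | apply: hface_balanced].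
Qed.

Lemma contract_contract l i j (t : 'I_l.+2 -> T) : (i < j)%N ->
  contract i (contract j t) = contract j.-1 (contract i t).
Proof.
move=> ij; apply/funext=> m; have ml := ltn_ord m.
rewrite !contractE !inordK ?ltnS //; last by rewrite ltnW.
case: (ltnP m.+1 i) => mi.
  have -> : (m.+1 < j)%N by lia.
  by have -> : (m.+1 < j.-1)%N by lia.
case: (eqVneq m.+1 i) => mi1.
  have -> : (m.+1 < j)%N by lia.
  case: (ltnP m.+2 j) => mj; first by have -> : (m.+1 < j.-1)%N by lia.
  have -> : m.+2 == j by lia.
  have -> : (m.+1 < j.-1)%N = false by lia.
  have -> : m.+1 == j.-1 by lia.
  have -> : (m.+2 < i)%N = false by lia.
  have -> : (m.+2 == i)%N = false by lia.
  by rewrite mulrA.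
have -> : (m.+2 < i)%N = false by lia.
have -> : (m.+2 == i)%N = false by lia.
have -> : (m.+2 < j)%N = (m.+1 < j.-1)%N by lia.
by have -> : (m.+2 == j)%N = (m.+1 == j.-1)%N by lia.
Qed.

Lemma hface_hface l i j (f : ('I_l -> T) -> X) :
  (i < j)%N -> (j < l.+3)%N -> hface j (hface i f) = hface i (hface j.-1 f).
Proof.
move=> ij jl; apply/funext=> t; rewrite /hface contract_contract //.
set Y := f _.
have -> : (j == 0%N) = false by lia.
have -> : (i == l.+2) = false by lia.
have -> : (j.-1 == l.+1) = (j == l.+2) by lia.
case: (eqVneq i 0%N) => [i0|i0].
  rewrite !contractE /=.
  case: (eqVneq j 1%N) => [j1|j1].
    rewrite j1 i0 /= -lactA; congr (lact (_ * _) _).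
    by congr t; apply/val_inj; rewrite /= inordK.
  have -> : (1 < j)%N by lia.
  have -> : (j.-1 == 0%N) = false by lia.
  have -> : inord 0 = ord0 :> 'I_l.+2 by apply/val_inj; rewrite /= inordK.
  rewrite i0 /=; case: (eqVneq j l.+2) => // _.
  rewrite lractA; congr (lact _ (ract _ (t _))).
  by apply/val_inj; rewrite /= inordK.
have -> : (j.-1 == 0%N) = false by lia.
have tm : inord l.+1 = ord_max :> 'I_l.+2 by apply/val_inj; rewrite /= inordK.
case: (eqVneq j l.+2) => [jl2|jl2]; last first.
  by have -> : (i == l.+1) = false by lia.
case: (eqVneq i l.+1) => [il1|il1]; rewrite !contractE /=.
  have -> : (l.+1 < j)%N by lia.
  by rewrite il1 ltnn eqxx -ractA tm.
have -> : (l.+1 < i)%N = false by lia.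
by rewrite eq_sym (negPf il1) tm.
Qed.

Lemma hdiff_hdiff l (f : ('I_l -> T) -> X) t : hdiff (hdiff f) t = 0.
Proof.
have dE m (g : ('I_m -> T) -> X) :
    hdiff g = \sum_(0 <= i < m.+2) (-1) ^+ i *: hface i g.
  by apply/funext=> u; rewrite big_mkord fct_sumE.
have hfaceD m i (g h : ('I_m -> T) -> X) c :
    hface i (c *: g + h) = c *: hface i g + hface i h.
  apply/funext=> u; rewrite /hface !fctE.
  case: ifP => _; first by rewrite linearP.
  by case: ifP => _; rewrite ?ractDl ?ractZl.
have hface0 m i : hface i (0 : ('I_m -> T) -> X) = 0.
  by have := hfaceD m i 0 0 (-1); rewrite scaler0 addr0 scaleN1r addNr.
have hface_sum m i (F : nat -> ('I_m -> T) -> X) n :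
    hface i (\sum_(0 <= q < n) (-1) ^+ q *: F q)
      = \sum_(0 <= q < n) (-1) ^+ q *: hface i (F q).
  elim: n => [|n IH]; first by rewrite !big_geq.
  by rewrite !big_nat_recr //= addrC hfaceD IH addrC.
pose a i j := hface j (hface i f).
suff : hdiff (hdiff f) = 0 by move=> ->.
rewrite !dE.
have -> : \sum_(0 <= j < l.+3) (-1) ^+ j *:
    hface j (\sum_(0 <= i < l.+2) (-1) ^+ i *: hface i f)
  = \sum_(0 <= j < l.+3) \sum_(0 <= i < l.+2) (-1) ^+ (i + j) *: a i j.
  apply: eq_bigr => j _; rewrite hface_sum scaler_sumr.
  by apply: eq_bigr => i _; rewrite scalerA -exprD addnC.
have -> : \sum_(0 <= j < l.+3) \sum_(0 <= i < l.+2) (-1) ^+ (i + j) *: a i j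
  = \sum_(0 <= j < l.+3) \sum_(0 <= i < l.+2 | (i < j)%N) (-1) ^+ (i + j) *: a i j
  + \sum_(0 <= j < l.+3) \sum_(0 <= i < l.+2 | ~~ (i < j)%N)
      (-1) ^+ (i + j) *: a i j.
  by rewrite -big_split; apply: eq_bigr => j _; rewrite (bigID (fun i => i < j)%N).
rewrite big_nat_recl // big1 ?add0r; last by move=> i; rewrite ltn0.
rewrite [X in _ + X]big_nat_recr //= [X in _ + (_ + X)]big_nat_cond.
rewrite [X in _ + (_ + X)]big_pred0 ?addr0; last by move=> i; lia.
rewrite (exchange_big_dep_nat xpredT) //= -big_split big_nat big1 //= => i il.
rewrite [X in X + _]big_mkcond [X in _ + X]big_mkcond -big_split big_nat.
rewrite big1 //= => j jl.
rewrite -leqNgt ltnS; case: leqP => ij; last exact: addr0.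
rewrite /a hface_hface ?ltnS //.
by rewrite /= addnS exprS mulN1r scaleNr [(j + i)%N]addnC addNr.
Qed.

Definition hoch_d l (f : subsp (@hoch l)) : subsp (@hoch l.+1) :=
  Subsp (hdiff_hoch (subsp_valP f)).

Fact hoch_d_linear l : linear (@hoch_d l).
Proof.
move=> c f g; apply/val_inj/funext=> t.
change (hdiff (c *: val f + val g) t = c *: hdiff (val f) t + hdiff (val g) t).
rewrite /hdiff scaler_sumr -big_split; apply: eq_bigr => i _ /=.
rewrite scalerA mulrC -scalerA -scalerDr; congr (_ *: _).
rewrite /hface /= !fctE; case: ifP => _; first by rewrite linearP.
by case: ifP => _; rewrite ?ractDl ?ractZl.
Qed.
HB.instance Definition _ l :=
  GRing.isLinear.Build k _ _ _ (@hoch_d l) (@hoch_d_linear l).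

Fact hoch_dd l (f : subsp (@hoch l)) : hoch_d (hoch_d f) = 0.
Proof. by apply/val_inj/funext=> t; apply: hdiff_hdiff. Qed.

Definition hochschild : complex k :=
  @Complex k (fun l => subsp (@hoch l)) (fun l => @hoch_d l) hoch_dd.

(* A trajectory $(\gamma_l,\dots,\gamma_1)$ is given by the vertices it visits,
   listed from its end to its start like the factors of $t_1\otimes\dots\otimes
   t_l$: the m-th path goes from [v (m+1)] to [v m] and is trivial when these
   are equal. *)
Definition trajectory l (v : 'I_l.+1 -> 'I_N) : Prop :=
  forall m : 'I_l, (v (lift ord0 m) <= v (widen_ord (leqnSn l) m))%N.

Definition traj_length l (v : 'I_l.+1 -> 'I_N) : nat :=
  \sum_(m < l) (v (lift ord0 m) != v (widen_ord (leqnSn l) m)).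

(* The m-th factor belongs to $M_\gamma=e_jTe_i$, where $\gamma:i\to j$. *)
Definition in_traj l (v : 'I_l.+1 -> 'I_N) (t : 'I_l -> T) : Prop :=
  forall m : 'I_l, e (v (widen_ord (leqnSn l) m)) * t m = t m /\
                   t m * e (v (lift ord0 m)) = t m.

(* [lact (e (v ord0))] matters only for l = 0, where the map $R\to X$ with
   $1\mapsto f()$ has value $e_if()$ on $M_\tau=ke_i$; for l > 0 it fixes
   [f t] since [f] is balanced. *)
Definition hochF t l : {pred subsp (@hoch l)} :=
  fun f => `[< forall v u, trajectory v -> (traj_length v < t)%N ->
                 in_traj v u -> lact (e (v ord0)) (val f u) = 0 >].

Fact hochF_closed t l : submod_closed (@hochF t l).
Proof.
split=> [|c f g]; first by apply/asboolP=> v u _ _ _; exact: linear0.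
move=> /asboolP fF /asboolP gF; apply/asboolP=> v u vt vl uv.
have -> : val (c *: f + g) u = c *: val f u + val g u by [].
by rewrite linearP /= fF // gF // scaler0 addr0.
Qed.
HB.instance Definition _ t l :=
  GRing.isSubmodClosed.Build k _ (@hochF t l) (@hochF_closed t l).

Fact hochF_dec t l (f : hochschild l) :
  f \in @hochF t.+1 l -> f \in @hochF t l.
Proof.
move=> /asboolP fF; apply/asboolP=> v u vt vl; apply: fF => //.
exact: ltnW.
Qed.

Lemma lift_inord l (i : 'I_l.+2) m : (m < l.+1)%N ->
  lift i (inord m : 'I_l.+1) = inord (bump i m).
Proof.
by move=> ml; apply: val_inj; rewrite /= !inordK // /bump; case: leqP; lia.
Qed.

Lemma steps_bump (V : nat -> 'I_N) i n :
  (\sum_(m < n) (V (bump i m.+1) != V (bump i m))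
    <= \sum_(m < n + (i <= n)) (V m.+1 != V m))%N.
Proof.
elim: n => [|n IH]; first by rewrite big_ord0.
rewrite big_ord_recr /=; move: IH; rewrite /bump.
case: (ltngtP i n.+1) => [ni|ni|->]; rewrite ?ltnn ?leqnn.
- have -> : (i <= n)%N by lia.
  rewrite !addn1 [X in (_ <= X)%N -> _]big_ord_recr [X in _ -> (_ <= X)%N]big_ord_recr.
  rewrite /= !add1n big_ord_recr /= => IH; exact: leq_add.
- have -> : (i <= n)%N = false by lia.
  by rewrite !addn0 !add0n big_ord_recr /= => IH; apply: leq_add.
rewrite addn0 addn1 add0n add1n => IH.
rewrite !big_ord_recr /= -addnA; apply: leq_add => //.
by case: eqP => //; case: eqP => //= ->; case: eqP.
Qed.

Lemma traj_drop l (v : 'I_l.+2 -> 'I_N) (u : 'I_l.+1 -> T) (i : 'I_l.+2) :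
  trajectory v -> in_traj v u ->
  [/\ trajectory (fun m => v (lift i m)),
      (traj_length (fun m => v (lift i m)) <= traj_length v)%N
    & in_traj (fun m => v (lift i m)) (contract i u)].
Proof.
move=> vt vu.
have st (m : nat) : (m < l.+1)%N -> (v (inord m.+1) <= v (inord m))%N.
  by move=> ml; have := vt (Ordinal ml); rewrite lift0_inord widen_inord.
have uu (m : nat) : (m < l.+1)%N ->
    e (v (inord m)) * u (inord m) = u (inord m) /\
    u (inord m) * e (v (inord m.+1)) = u (inord m).
  move=> ml; have := vu (Ordinal ml); rewrite lift0_inord widen_inord /=.
  by have -> : Ordinal ml = inord m by apply/val_inj; rewrite /= inordK.
split=> [m||m]; rewrite ?lift0_inord ?widen_inord ?lift_inord ?ltnS //;
  try exact: ltnW.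
- have ml := ltn_ord m; rewrite /bump.
  case: (leqP i m) => im; first by rewrite (leqW im) !add1n; apply: st.
  rewrite add0n; case: (leqP i m.+1) => im1; last by rewrite add0n; apply: st; lia.
  by rewrite add1n; apply: leq_trans (st _ _) (st _ _); lia.
- have := steps_bump (fun n => v (inord n)) i l.
  have le : (l + (i <= l) <= l.+1)%N by case: (i <= l)%N; lia.
  move=> /leq_trans; rewrite /traj_length.
  have -> : (\sum_(m < l) (v (lift i (lift ord0 m)) !=
                 v (lift i (widen_ord (leqnSn l) m))) =
            \sum_(m < l) (v (inord (bump i m.+1)) != v (inord (bump i m))))%N.
    apply: eq_bigr => m _; rewrite lift0_inord widen_inord !lift_inord ?ltnS //.
    exact: ltnW.
  apply; rewrite (big_ord_widen _ (fun m => nat_of_bool (v (inord m.+1) != v (inord m))) le).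
  rewrite big_mkcond; apply: leq_sum => m _.
  by rewrite lift0_inord widen_inord; case: ifP.
have ml := ltn_ord m; rewrite contractE /bump.
case: (ltnP m.+1 i) => im.
  have -> : (i <= m)%N = false by lia.
  by rewrite !add0n; apply: uu; lia.
case: (eqVneq m.+1 i) => im1.
  have -> : (i <= m)%N = false by lia.
  rewrite add0n add1n; have [h1 _] := uu m (leqW ml).
  have [_ h2] := uu m.+1 ml.
  by rewrite mulrA h1 -mulrA h2.
have -> : (i <= m)%N by lia.
by rewrite !add1n; apply: uu; lia.
Qed.

Fact hochF_d t l (f : hochschild l) :
  f \in @hochF t l -> cpx_d l f \in @hochF t l.+1.
Proof.
move=> /asboolP fF; apply/asboolP=> v u vt vl uv.
rewrite /= /hdiff linear_sum big1 // => i _; rewrite linearZ /=.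
have [wt wl uw] := traj_drop i vt uv.
have {wt wl uw} := fF _ _ wt (leq_ltn_trans wl vl) uw.
rewrite /hface; set Y := val f _ => Y0.
case: (eqVneq (nat_of_ord i) 0%N) => i0.
  have [_ <-] := uv ord0; rewrite !lactA.
  have E : lift i ord0 = lift ord0 ord0 by apply/val_inj; rewrite /= i0.
  by rewrite -E Y0 !linear0.
have E : lift i ord0 = ord0.
  by apply/val_inj; rewrite /= /bump; case: leqP => //; lia.
rewrite E in Y0; case: ifP => _; last by rewrite Y0 scaler0.
by rewrite -lractA Y0 ract0l scaler0.
Qed.

Definition traj_filtration : fcomplex k :=
  @FComplex k hochschild (fun t l => @hochF t l) hochF_dec hochF_d.

End Hochschild.

(* Algebra morphisms that need not preserve 1. *)
Record nuhom (k : fieldType) (B T : algType k) := NUHom {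
  nuhom_fun :> B -> T;
  nuhom_linear : linear nuhom_fun;
  nuhomM : forall a b, nuhom_fun (a * b) = nuhom_fun a * nuhom_fun b
}.

(* For idempotents $f=i_B(1)$ and $e=i_A(1)$ of T, the B-A-bimodule
   $fXe=\{x\mid fxe=x\}$, on which B and A act through [iB] and [iA]. *)
Section Peirce.
Variables (k : fieldType) (T B A : algType k).
Variables (iB : nuhom B T) (iA : nuhom A T) (X : bimod T T).

Definition peirce_pred : {pred X} := fun x => ract (lact (iB 1) x) (iA 1) == x.

Fact peirce_closed : submod_closed peirce_pred.
Proof.
split=> [|c x y]; rewrite !unfold_in ?linear0 ?ract0l // => /eqP xE /eqP yE.
by rewrite linearP ractDl ractZl xE yE.
Qed.
HB.instance Definition _ :=
  GRing.isSubmodClosed.Build k X peirce_pred peirce_closed.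

Lemma peirce_id (x : subsp peirce_pred) :
  lact (iB 1) (val x) = val x /\ ract (val x) (iA 1) = val x.
Proof.
have /eqP xE : ract (lact (iB 1) (val x)) (iA 1) == val x := subsp_valP x.
split; rewrite -[in LHS]xE; first by rewrite -lractA -lactA -nuhomM mulr1.
by rewrite -ractA -nuhomM mulr1.
Qed.

Fact peirce_lact_subproof b (x : subsp peirce_pred) :
  lact (iB b) (val x) \in peirce_pred.
Proof.
have [_ xE] := peirce_id x; apply/eqP.
by rewrite -lactA -nuhomM mul1r lractA xE.
Qed.
Definition peirce_lact b x := Subsp (peirce_lact_subproof b x).

Fact peirce_ract_subproof (x : subsp peirce_pred) a :
  ract (val x) (iA a) \in peirce_pred.
Proof.
have [xE _] := peirce_id x; apply/eqP.
by rewrite -lractA xE -ractA -nuhomM mulr1.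
Qed.
Definition peirce_ract x a := Subsp (peirce_ract_subproof x a).

Fact peirce_lact_linearl x : linear (peirce_lact^~ x).
Proof.
by move=> c a b; apply: val_inj; rewrite /= nuhom_linear lactDl lactZl.
Qed.
Fact peirce_lact_linearr b : linear (peirce_lact b).
Proof. by move=> c x y; apply: val_inj; apply: lact_linearr. Qed.
Fact peirce_ract_linearl a : linear (peirce_ract^~ a).
Proof. by move=> c x y; apply: val_inj; apply: ract_linearl. Qed.
Fact peirce_ract_linearr x : linear (peirce_ract x).
Proof.
by move=> c a b; apply: val_inj; rewrite /= nuhom_linear linearP.
Qed.
Fact peirce_lact1 x : peirce_lact 1 x = x.
Proof. by apply: val_inj; have [xE _] := peirce_id x. Qed.
Fact peirce_ract1 x : peirce_ract x 1 = x.
Proof. by apply: val_inj; have [_ xE] := peirce_id x. Qed.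
Fact peirce_lactA b c x :
  peirce_lact (b * c) x = peirce_lact b (peirce_lact c x).
Proof. by apply: val_inj; rewrite /= nuhomM lactA. Qed.
Fact peirce_ractA x a c :
  peirce_ract x (a * c) = peirce_ract (peirce_ract x a) c.
Proof. by apply: val_inj; rewrite /= nuhomM ractA. Qed.
Fact peirce_lractA b x a :
  peirce_ract (peirce_lact b x) a = peirce_lact b (peirce_ract x a).
Proof. by apply: val_inj; rewrite /= lractA. Qed.

Definition peirce : bimod B A := @Bimod k B A (subsp peirce_pred)
  peirce_lact peirce_ract peirce_lact_linearl peirce_lact_linearr
  peirce_ract_linearl peirce_ract_linearr peirce_lact1 peirce_ract1
  peirce_lactA peirce_ractA peirce_lractA.

End Peirce.

Section TriangularHochschild.
Variables (k : fieldType) (A1 A2 A3 : algType k).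
Variables (M21 : bimod A2 A1) (M32 : bimod A3 A2) (M31 : bimod A3 A1).
Variable mu : balanced_map M32 M21 M31.
Local Notation T := (triang mu).

Definition diag1_fun (a : A1) : T := Triang mu a 0 0 0 0 0.
Definition diag2_fun (a : A2) : T := Triang mu 0 a 0 0 0 0.
Definition diag3_fun (a : A3) : T := Triang mu 0 0 a 0 0 0.

Fact diag1_linear : linear diag1_fun.
Proof. by move=> c a b; congr Triang; rewrite /= ?scaler0 ?addr0. Qed.
Fact diag2_linear : linear diag2_fun.
Proof. by move=> c a b; congr Triang; rewrite /= ?scaler0 ?addr0. Qed.
Fact diag3_linear : linear diag3_fun.
Proof. by move=> c a b; congr Triang; rewrite /= ?scaler0 ?addr0. Qed.
Fact diag1M a b : diag1_fun (a * b) = diag1_fun a * diag1_fun b.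
Proof.
by congr Triang; rewrite /= ?mulr0 ?ract0l ?bal0l ?linear0 ?addr0.
Qed.
Fact diag2M a b : diag2_fun (a * b) = diag2_fun a * diag2_fun b.
Proof.
by congr Triang; rewrite /= ?mulr0 ?ract0l ?bal0l ?linear0 ?addr0.
Qed.
Fact diag3M a b : diag3_fun (a * b) = diag3_fun a * diag3_fun b.
Proof.
by congr Triang; rewrite /= ?mulr0 ?ract0l ?bal0l ?linear0 ?addr0.
Qed.

Definition diag1 : nuhom A1 T := NUHom diag1_linear diag1M.
Definition diag2 : nuhom A2 T := NUHom diag2_linear diag2M.
Definition diag3 : nuhom A3 T := NUHom diag3_linear diag3M.

(* The vertices $e_1,e_2,e_3$ are numbered 0, 1, 2. *)
Definition vertex (i : 'I_3) : T :=
  match val i with 0%N => diag1 1 | 1%N => diag2 1 | _ => diag3 1 end.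

Variable X : bimod T T.

Definition X21 : bimod A2 A1 := peirce diag2 diag1 X.
Definition X32 : bimod A3 A2 := peirce diag3 diag2 X.
Definition X31 : bimod A3 A1 := peirce diag3 diag1 X.

Definition triang_hochschild : fcomplex k := traj_filtration X vertex.

End TriangularHochschild.

(* Main.v *)
From HB Require Import structures.
Require Import Defs.
From mathcomp Require Import all_boot all_algebra.
From mathcomp Require Import boolp classical_sets functions zify.

Set Implicit Arguments.
Unset Strict Implicit.
Unset Printing Implicit Defensive.

Import GRing.Theory.
Local Open Scope ring_scope.
Local Open Scope classical_set_scope.

(** In total degree $s+1$ the piece $F^1/F^2$ of the Hochschild complex consists
    of the maps on the summands $M_\tau$ with $|\tau|=1$. Such a trajectory has a
    single non-trivial path $\gamma:e_i\to e_j$, so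
    $M_\tau=A_j^{\otimes q}\otimes{}_jM_i\otimes A_i^{\otimes p}$ with $q+p=s$,
    and $d_0$ only keeps the faces that preserve $|\tau|$: products inside
    $A_j$ or $A_i$ and the actions on ${}_jM_i$ and ${}_jX_i$. Hence the column
    $E_0^{1,*}$ is, up to a shift by one, the direct sum over the three arrows
    of the complexes of bimodule morphisms from the two-sided bar resolution of
    ${}_jM_i$ to ${}_jX_i$, and its cohomology is the sum of the Ext spaces.

    The bar complex appears directly as a complex of multilinear functions
    ([bar_complex]), without tensor products. That it computes Ext
    ([cohomology_bar]) is proved by dimension shifting in the coefficients: the
    sequence $0\to N\to\mathrm{coind}\,N\to\mathrm{cosyz}\,N\to0$ with
    $\mathrm{coind}\,N=\mathrm{Hom}_k(B\otimes A,N)$ splits over $k$, hence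
    induces short exact sequences both of bar complexes and of complexes
    $\mathrm{Hom}(P_\bullet,-)$, and both theories vanish on coinduced
    bimodules in positive degrees. For the bar complex ([bar_acyclic]) there is
    an explicit contraction, which absorbs a letter on the left and then one on
    the right into the arguments of the value. For a projective resolution
    ([hom_acyclic]) the complex is $\mathrm{Hom}_k(P_\bullet,N)$ by adjunction,
    and linear maps extend from subspaces by Zorn's lemma ([linear_factor]).
    Two theories with these properties and the same $H^0=\mathrm{Hom}(M,-)$
    agree ([cohomology_resolving]).

    The identification of the column is given by restricting a cochain to the
    words of each arrow ([restrict]); it commutes with the differentials
    ([restrict_d]), its kernel in $F^1$ is $F^2$ ([arrow_parts_ker]), and it is
    onto because a bar cochain extends to the whole algebra through the Peirce
    components of its arguments ([extend]). *)

(** * Linear bijections and cohomology *)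

Section LinearMaps.
Variables (k : fieldType) (U V : lmodType k).

Definition mklin (f : U -> V) of linear f := f.
HB.instance Definition _ f (fL : linear f) :=
  GRing.isLinear.Build k U V _ (mklin fL) fL.

Lemma linear_is0 (f : U -> V) : linear f -> f 0 = 0.
Proof. by move=> fL; apply: (raddf0 (mklin fL)). Qed.
Lemma linear_isB (f : U -> V) : linear f -> {morph f : x y / x - y}.
Proof. by move=> fL; apply: (raddfB (mklin fL)). Qed.
Lemma linear_isD (f : U -> V) : linear f -> {morph f : x y / x + y}.
Proof. by move=> fL; apply: (raddfD (mklin fL)). Qed.
Lemma linear_isZ (f : U -> V) c : linear f -> {morph f : x / c *: x}.
Proof. by move=> fL x; apply: (linearZ_LR (mklin fL)). Qed.

Definition liso : Prop := exists phi : {linear U -> V}, bijective phi.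

(** A linear relation, total and with trivial indeterminacy on both sides, is
    the graph of a linear bijection. Connecting isomorphisms are only given by
    such relations. *)
Lemma linear_rel_iso (R : U -> V -> Prop) :
  (forall c x x' y y', R x y -> R x' y' -> R (c *: x + x') (c *: y + y')) ->
  (forall x, exists y, R x y) -> (forall y, exists x, R x y) ->
  (forall y, R 0 y -> y = 0) -> (forall x, R x 0 -> x = 0) -> liso.
Proof.
move=> RL /choice[f fR] /choice[g gR] R0l R0r.
have Rf x y : R x y -> f x = y.
  move=> xy; have := RL (-1) _ _ _ _ (fR x) xy.
  by rewrite !scaleN1r addNr addrC => /R0l/subr0_eq.
have Rg x y : R x y -> g y = x.
  move=> xy; have := RL (-1) _ _ _ _ (gR y) xy.
  by rewrite !scaleN1r addNr addrC => /R0r/subr0_eq.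
have fL : linear f by move=> c x y; apply/Rf/RL.
by exists (mklin fL), g => [x|y]; [apply/Rg/fR | apply/Rf/gR].
Qed.

End LinearMaps.

Section LinearIso.
Variable k : fieldType.
Implicit Types U V W : lmodType k.

Lemma liso_trans U V W : liso U V -> liso V W -> liso U W.
Proof.
move=> [f fb] [g gb]; exists (g \o f : {linear U -> W}); exact: bij_comp.
Qed.

Lemma liso_sym U V : liso U V -> liso V U.
Proof.
move=> [f [g fK gK]]; apply: (@linear_rel_iso _ _ _ (fun y x => f x = y)).
- by move=> c y y' x x' <- <-; rewrite linearP.
- by move=> y; exists (g y).
- by move=> x; exists (f x).
- by move=> x fx; rewrite -[x]fK fx -(linear0 f) fK.
by move=> y <-; rewrite linear0.
Qed.

Lemma liso_pair U V U' V' :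
  liso U V -> liso U' V' -> liso (U * U')%type (V * V')%type.
Proof.
move=> [f [g fK gK]] [f' [g' fK' gK']].
pose h (u : U * U') : V * V' := (f u.1, f' u.2).
have hL : linear h by move=> c u v; rewrite /h !linearP.
exists (mklin hL), (fun v => (g v.1, g' v.2)).
  by case=> x y; congr pair; [apply: fK | apply: fK'].
by case=> x y; congr pair; [apply: gK | apply: gK'].
Qed.

(** Linear maps extend from the image of [d] because subspaces have
    complements; this is where it matters that [k] is a field. *)
Lemma linear_factor U V W (d : U -> W) (f : U -> V) : linear d -> linear f ->
  (forall u, d u = 0 -> f u = 0) ->
  exists2 g : W -> V, linear g & forall u, g (d u) = f u.
Proof.
move=> dL fL df.
pose ok (G : set (W * V)) :=
  (forall c p q, G p -> G q -> G (c *: p + q)) /\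
  (forall p u, G p -> p.1 = d u -> p.2 = f u).
have [|G [[GL Gf] Gmax]] := @Zorn_bigcup (W * V)%type ok.
  move=> F Fok Ftot; split=> [c p q [A FA Ap] [B FB Bq]|p u [A FA Ap]].
    have [AB|BA] := Ftot _ _ FA FB.
      by exists B => //; apply: (Fok _ FB).1 => //; apply: AB.
    by exists A => //; apply: (Fok _ FA).1 => //; apply: BA.
  exact: (Fok _ FA).2.
pose G0 p := G p \/ p = 0.
have G0L c p q : G0 p -> G0 q -> G0 (c *: p + q).
  move=> [Gp|->] [Gq|->]; rewrite ?scaler0 ?addr0 ?add0r.
  - by left; apply: GL.
  - left; have := GL (c - 1) _ _ Gp Gp.
    by rewrite scalerBl scale1r subrK.
  - by left.
  by right.
have G0f p u : G0 p -> p.1 = d u -> p.2 = f u.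
  by move=> [/Gf|->]; [apply | move=> /= /esym/df->].
(* By maximality, [q] already lies in [G] if the relation spanned by [G] and [q]
   is still compatible with [f] on the image of [d]. *)
have ext q : (forall p a u, G0 p -> p.1 + a *: q.1 = d u ->
    p.2 + a *: q.2 = f u) -> G q.
  move=> qf; pose H r := exists p a, G0 p /\ r = p + a *: q.
  have HG : G `<=` H.
    by move=> p Gp; exists p, 0; rewrite scale0r addr0; split=> //; left.
  apply: contrapT => nGq; apply: (Gmax H).
    split=> // HsG; apply/nGq/HsG.
    by exists 0, 1; rewrite scale1r add0r; split=> //; right.
  split=> [c _ _ [p [a [Gp ->]]] [p' [a' [Gp' ->]]]|_ u [p [a [Gp ->]]] /=].
    exists (c *: p + p'), (c * a + a'); split; first exact: G0L.
    by rewrite scalerDr scalerDl scalerA addrACA.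
  exact: qf.
have Gd u : G (d u, f u).
  apply: ext => p a v Gp /= E.
  have {E} : p.1 = d (v - a *: u).
    by rewrite (linear_isB dL) (linear_isZ _ dL) -E addrK.
  by move=> /(G0f _ _ Gp)->; rewrite (linear_isB fL) (linear_isZ _ fL) subrK.
(* A vector outside the domain could be sent to 0. *)
have Gt w : exists v, G (w, v).
  apply: contrapT => nGw; apply: (nGw); exists 0; apply: ext => p a u Gp /=.
  rewrite scaler0 addr0; have [->|a0] := eqVneq a 0.
    by rewrite scale0r addr0; apply: G0f.
  move=> E; case: nGw; have := G0L (- a^-1) p 0 Gp (or_intror erefl).
  move=> Gp'; have [G1|] := G0L a^-1 _ _ (or_introl (Gd u)) Gp'.
    exists (a^-1 *: f u + (- a^-1 *: p.2 + 0)).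
    suff -> : (w, a^-1 *: f u + (- a^-1 *: p.2 + 0)) =
              a^-1 *: (d u, f u) + (- a^-1 *: p + 0) by [].
    congr pair; rewrite /= -E addr0 scalerDr scalerA mulVf // scale1r.
    by rewrite scaleNr addrAC subrr add0r.
  move=> /(congr1 fst) /=.
  rewrite -E addr0 scalerDr scalerA mulVf // scale1r scaleNr addrAC subrr add0r.
  by move=> ->; exists (f 0); have := Gd 0; rewrite (linear_is0 dL).
have G1 w v v' : G (w, v) -> G (w, v') -> v = v'.
  move=> wv /(GL (-1) _ _ wv) wv'; have := Gf _ 0 wv'.
  rewrite /= scaleN1r addNr (linear_is0 dL) => /(_ erefl).
  by rewrite (linear_is0 fL) scaleN1r addrC => /subr0_eq.
have [g gG] := choice Gt; exists g => [c x y|u]; last exact: G1 (gG _) _.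
by apply: G1 (gG _) _; apply: (GL c _ _ (gG x) (gG y)).
Qed.

End LinearIso.

Section CohomologyIso.
Variable k : fieldType.
Implicit Types C D : complex k.

Definition is_bound C n : C n -> Prop :=
  match n with
  | 0 => fun z => z = 0
  | m.+1 => fun z => exists u : C m, z = cpx_d m u
  end.

Lemma coboundaryP C n (z : subsp (@cocycle k C n)) :
  z \in @coboundary k C n <-> is_bound (val z).
Proof.
case: n z => [|n] z; rewrite unfold_in /=; last by split=> /asboolP.
by split=> [/eqP->|z0] //; apply/eqP/val_inj.
Qed.

(** Isomorphisms of cohomology are obtained from relations between cocycles
    that need not be single-valued before passing to the quotient. *)
Lemma cohomology_iso C D n m (R : C n -> D m -> Prop) :
  (forall c x x' y y', R x y -> R x' y' -> R (c *: x + x') (c *: y + y')) ->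
  (forall x y, R x y -> cpx_d n x = 0 /\ cpx_d m y = 0) ->
  (forall x, cpx_d n x = 0 -> exists y, R x y) ->
  (forall y, cpx_d m y = 0 -> exists x, R x y) ->
  (forall x y, R x y -> (is_bound x <-> is_bound y)) ->
  liso (cohomology C n) (cohomology D m).
Proof.
move=> RL Rz Rt Rt' Rb.
pose S (a : cohomology C n) (b : cohomology D m) := exists x y,
  [/\ a = quotsp_pi _ x, b = quotsp_pi _ y & R (val x) (val y)].
have Zx x : cpx_d n x = 0 -> x \in @cocycle k C n by move=> x0; apply/eqP.
have Zy y : cpx_d m y = 0 -> y \in @cocycle k D m by move=> y0; apply/eqP.
have pi0C (x : subsp (@cocycle k C n)) :
    quotsp_pi (@coboundary k C n) x = 0 <-> is_bound (val x).
  rewrite -coboundaryP -[x in _ <-> x \in _]subr0 -quotsp_piE linear0.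
  by split=> [->|/eqP].
have pi0D (x : subsp (@cocycle k D m)) :
    quotsp_pi (@coboundary k D m) x = 0 <-> is_bound (val x).
  rewrite -coboundaryP -[x in _ <-> x \in _]subr0 -quotsp_piE linear0.
  by split=> [->|/eqP].
apply: (@linear_rel_iso _ _ _ S).
- move=> c _ _ _ _ [x [y [-> -> xy]]] [x' [y' [-> -> xy']]].
  exists (c *: x + x'), (c *: y + y'); rewrite !linearP; split=> //.
  exact: RL.
- move=> a; have /eqP az := subsp_valP (repr a).
  have [y xy] := Rt _ az; have [_ y0] := Rz _ _ xy.
  exists (quotsp_pi _ (Subsp (Zy _ y0))), (repr a), (Subsp (Zy _ y0)).
  by rewrite quotsp_reprK.
- move=> b; have /eqP bz := subsp_valP (repr b).
  have [x xy] := Rt' _ bz; have [x0 _] := Rz _ _ xy.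
  exists (quotsp_pi _ (Subsp (Zx _ x0))), (Subsp (Zx _ x0)), (repr b).
  by rewrite quotsp_reprK.
- by move=> b [x [y [/esym/pi0C x0 -> /Rb[/(_ x0)/pi0D]]]].
by move=> a [x [y [-> /esym/pi0D y0 /Rb[_ /(_ y0)/pi0C]]]].
Qed.

End CohomologyIso.

(** * Coinduced bimodules and their quotients *)

Section Coinduced.
Variables (k : fieldType) (B A : algType k) (V : lmodType k).

Definition bilin : {pred B -> A -> V} :=
  fun f => `[< (forall y, linear (f^~ y)) /\ forall x, linear (f x) >].

Fact bilin_closed : submod_closed bilin.
Proof.
split=> [|c f g]; rewrite !unfold_in.
  have z0 x y : (0 : B -> A -> V) x y = 0 by [].
  by apply/asboolP; split=> u a x y; rewrite /= !z0 scaler0 addr0.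
move=> /asboolP[fl fr] /asboolP[gl gr]; apply/asboolP.
have E x y : (c *: f + g) x y = c *: f x y + g x y by [].
split=> u a x y; rewrite /= !E.
  by have /= -> := fl u a x y; have /= -> := gl u a x y;
    rewrite !scalerDr !scalerA mulrC addrACA.
by rewrite fr gr !scalerDr !scalerA mulrC addrACA.
Qed.
HB.instance Definition _ :=
  GRing.isSubmodClosed.Build k (B -> A -> V) bilin bilin_closed.

Lemma bilinl (f : subsp bilin) y : linear ((val f)^~ y).
Proof. by have /asboolP[fl _] := subsp_valP f; apply: fl. Qed.
Lemma bilinr (f : subsp bilin) x : linear (val f x).
Proof. by have /asboolP[_ fr] := subsp_valP f; apply: fr. Qed.
Lemma bilin_ext (f g : subsp bilin) : (forall x y, val f x y = val g x y) -> f = g.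
Proof. by move=> fg; apply/val_inj/funext => x; apply/funext => y. Qed.

Fact coind_lact_subproof b (f : subsp bilin) :
  (fun x y => val f (x * b) y) \in bilin.
Proof.
apply/asboolP; split=> u a x y /=; last exact: bilinr.
by rewrite mulrDl -scalerAl; apply: (bilinl f).
Qed.
Fact coind_ract_subproof (f : subsp bilin) a :
  (fun x y => val f x (a * y)) \in bilin.
Proof.
apply/asboolP; split=> u c x y /=; first exact: bilinl.
by rewrite mulrDr -scalerAr; apply: bilinr.
Qed.
Definition coind_lact b f := Subsp (coind_lact_subproof b f).
Definition coind_ract f a := Subsp (coind_ract_subproof f a).

(** $\mathrm{Hom}_k(B\otimes A,V)$, the right adjoint of the forgetful functor
    from bimodules to vector spaces. *)
Definition coind : bimod B A.
Proof.
apply: (@Bimod k B A (subsp bilin) coind_lact coind_ract) => *;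
  try (move=> ? ? ?); apply: bilin_ext => u v /=.
- by rewrite mulrDr -scalerAr; apply: bilinl.
- by [].
- by [].
- by rewrite mulrDl -scalerAl; apply: bilinr.
- by rewrite mulr1.
- by rewrite mul1r.
- by rewrite mulrA.
- by rewrite mulrA.
by [].
Defined.

Lemma coind_lactE b (f : coind) x y : val (lact b f) x y = val f (x * b) y.
Proof. by []. Qed.
Lemma coind_ractE a (f : coind) x y : val (ract f a) x y = val f x (a * y).
Proof. by []. Qed.
Lemma coindDE c (f g : coind) x y :
  val (c *: f + g) x y = c *: val f x y + val g x y.
Proof. by rewrite linearP. Qed.
Lemma coindZE c (f : coind) x y : val (c *: f) x y = c *: val f x y.
Proof. by rewrite linearZ. Qed.
Lemma coind0E x y : val (0 : coind) x y = 0.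
Proof. by []. Qed.
Lemma coindBE (f g : coind) x y : val (f - g) x y = val f x y - val g x y.
Proof. by rewrite linearB. Qed.

End Coinduced.

Section Unit.
Variables (k : fieldType) (B A : algType k) (N : bimod B A).

Fact unit_subproof (n : N) : (fun b a => ract (lact b n) a) \in @bilin k B A N.
Proof.
apply/asboolP; split=> u c x y /=; last by rewrite linearP.
by rewrite lactDl lactZl ractDl ractZl.
Qed.
Definition coind_unit n : coind B A N := Subsp (unit_subproof n).

Lemma coind_unit_hom : is_bihom coind_unit.
Proof.
split=> [c x y|b x|x a]; apply: bilin_ext => u v.
- by rewrite coindDE /= linearP ractDl ractZl.
- by rewrite /= lactA.
by rewrite /= -lractA ractA.
Qed.

Lemma coind_unitK n : val (coind_unit n) 1 1 = n.
Proof. by rewrite /= lact1 ract1. Qed.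

End Unit.

Section QuotientBimod.
Variables (k : fieldType) (B A : algType k) (N : bimod B A).
Variable P : submodClosed N.
Hypothesis Pl : forall b x, x \in P -> lact b x \in P.
Hypothesis Pr : forall x a, x \in P -> ract x a \in P.

Local Notation pi := (quotsp_pi P).

Definition quot_lact b (q : quotsp P) : quotsp P := pi (lact b (repr q)).
Definition quot_ract (q : quotsp P) a : quotsp P := pi (ract (repr q) a).

Lemma quot_lact_pi b x : quot_lact b (pi x) = pi (lact b x).
Proof.
apply/eqP; rewrite quotsp_piE -linearB; apply: Pl.
by rewrite -quotsp_piE quotsp_reprK.
Qed.
Lemma quot_ract_pi x a : quot_ract (pi x) a = pi (ract x a).
Proof.
apply/eqP; rewrite quotsp_piE -(linear_isB (ract_linearl a)); apply: Pr.
by rewrite -quotsp_piE quotsp_reprK.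
Qed.

Definition quot_bimod : bimod B A.
Proof.
apply: (@Bimod k B A (quotsp P) quot_lact quot_ract).
- by move=> x c b d; rewrite -[x]quotsp_reprK !quot_lact_pi lactDl lactZl linearP.
- move=> b c x y; rewrite -[x]quotsp_reprK -[y]quotsp_reprK -linearP.
  by rewrite !quot_lact_pi !linearP.
- move=> a c x y; rewrite -[x]quotsp_reprK -[y]quotsp_reprK -linearP.
  by rewrite !quot_ract_pi ractDl ractZl linearP.
- by move=> x c b d; rewrite -[x]quotsp_reprK !quot_ract_pi !linearP.
- by move=> x; rewrite -[x]quotsp_reprK quot_lact_pi lact1.
- by move=> x; rewrite -[x]quotsp_reprK quot_ract_pi ract1.
- by move=> b c x; rewrite -[x]quotsp_reprK !quot_lact_pi lactA.
- by move=> x a c; rewrite -[x]quotsp_reprK !quot_ract_pi ractA.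
by move=> b x a; rewrite -[x]quotsp_reprK quot_ract_pi !quot_lact_pi quot_ract_pi lractA.
Defined.

Lemma quot_pi_hom : @is_bihom k B A N quot_bimod pi.
Proof.
split=> [c x y|b x|x a]; first exact: linearP.
  by rewrite -quot_lact_pi.
by rewrite -quot_ract_pi.
Qed.

End QuotientBimod.

Section Cosyzygy.
Variables (k : fieldType) (B A : algType k) (N : bimod B A).

Definition unit_image : {pred coind B A N} :=
  fun f => `[< exists n, f = coind_unit n >].

Fact unit_image_closed : submod_closed unit_image.
Proof.
have [uL _ _] := coind_unit_hom N.
split=> [|c f g]; rewrite !unfold_in.
  by apply/asboolP; exists 0; rewrite (linear_is0 uL).
by move=> /asboolP[x ->] /asboolP[y ->]; apply/asboolP; exists (c *: x + y); rewrite uL.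
Qed.
HB.instance Definition _ :=
  GRing.isSubmodClosed.Build k (coind B A N) unit_image unit_image_closed.

Fact unit_image_lact b x : x \in unit_image -> lact b x \in unit_image.
Proof.
have [_ ul _] := coind_unit_hom N.
by move=> /asboolP[n ->]; apply/asboolP; exists (lact b n); rewrite ul.
Qed.
Fact unit_image_ract x a : x \in unit_image -> ract x a \in unit_image.
Proof.
have [_ _ ur] := coind_unit_hom N.
by move=> /asboolP[n ->]; apply/asboolP; exists (ract n a); rewrite ur.
Qed.

(** The cokernel of the unit: a cosyzygy of [N] relative to $k$. *)
Definition cosyz : bimod B A := quot_bimod unit_image_lact unit_image_ract.
Definition cosyz_pi : coind B A N -> cosyz := quotsp_pi unit_image.

Lemma cosyz_pi_hom : is_bihom cosyz_pi.
Proof. exact: (quot_pi_hom unit_image_lact unit_image_ract). Qed.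

Lemma cosyz_pi_surj q : exists f, cosyz_pi f = q.
Proof. by exists (repr q); apply: quotsp_reprK. Qed.

Lemma cosyz_pi_eq0 f : cosyz_pi f = 0 <-> exists n, f = coind_unit n.
Proof.
have {}E : (cosyz_pi f = 0) <-> f \in unit_image.
  rewrite -[f in _ <-> is_true (f \in _)]subr0 -quotsp_piE.
  by rewrite (linear0 (quotsp_pi unit_image)); split=> /eqP.
by split=> [/E/asboolP|fu] //; apply/E/asboolP.
Qed.

(** Evaluation at (1, 1) is a linear retraction of the unit, and subtracting
    its composite with the unit defines a section of the projection. *)
Lemma cosyz_section : exists2 h : cosyz -> coind B A N,
  linear h & forall q, cosyz_pi (h q) = q.
Proof.
have [uL _ _] := coind_unit_hom N; have [pL _ _] := cosyz_pi_hom.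
have pu n : cosyz_pi (coind_unit n) = 0 by apply/cosyz_pi_eq0; exists n.
pose r (f : coind B A N) := f - coind_unit (val f 1 1).
have rL c f g : r (c *: f + g) = c *: r f + r g.
  by rewrite /r coindDE uL scalerBr opprD addrACA.
have rpi f g : cosyz_pi f = cosyz_pi g -> r f = r g.
  move=> fg; have /cosyz_pi_eq0[n fgn] : cosyz_pi (f - g) = 0.
    by rewrite (linear_isB pL) fg subrr.
  have -> : f = 1 *: coind_unit n + g by rewrite scale1r -fgn subrK.
  by rewrite rL scale1r {1}/r coind_unitK subrr add0r.
have rK f : cosyz_pi (r f) = cosyz_pi f.
  by rewrite (linear_isB pL) pu subr0.
have [s sP] := choice cosyz_pi_surj.
exists (fun q => r (s q)) => [c x y|q]; last by rewrite rK sP.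
by rewrite -rL; apply: rpi; rewrite pL !sP.
Qed.

End Cosyzygy.

Section Bihom.
Variables (k : fieldType) (B A : algType k).
Implicit Types M N L : bimod B A.

Lemma bihomP M N (f : bihom M N) : is_bihom (val f).
Proof. exact/asboolP/(subsp_valP f). Qed.

Lemma bihom_comp M N L (g : N -> L) (f : M -> N) :
  is_bihom g -> is_bihom f -> is_bihom (g \o f).
Proof.
move=> [gL gl gr] [fL fl fr].
by split=> [c x y|b x|x a] /=; rewrite ?fL ?gL ?fl ?gl ?fr ?gr.
Qed.

Definition mkbihom M N (f : M -> N) (fb : is_bihom f) : bihom M N :=
  @Subsp k _ (@bihom_pred k B A M N) f (introT (asboolP (is_bihom f)) fb).

(** Evaluation at (1, 1) is only linear, but it inverts the unit on its image,
    and this makes the lift a morphism of bimodules. *)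
Lemma bihom_lift_unit M N (f : M -> coind B A N) : is_bihom f ->
  (forall x, cosyz_pi (f x) = 0) ->
  exists2 g : M -> N, is_bihom g & forall x, f x = coind_unit (g x).
Proof.
move=> [fL fl fr] f0; have [uL ul ur] := coind_unit_hom N.
have fE x : f x = coind_unit (val (f x) 1 1).
  by have /cosyz_pi_eq0[n ->] := f0 x; rewrite coind_unitK.
have uI n n' : coind_unit n = coind_unit n' -> n = n'.
  by move=> nn; rewrite -[n]coind_unitK nn coind_unitK.
exists (fun x => val (f x) 1 1) => //; split=> [c x y|b x|x a]; apply: uI.
- by rewrite -fE uL -!fE fL.
- by rewrite -fE ul -fE fl.
by rewrite -fE ur -fE fr.
Qed.

End Bihom.

(** * Uniqueness of effaceable cohomology theories *)

Section DeltaFunctor.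
Variables (k : fieldType) (B A : algType k) (M : bimod B A).

(** Complexes $F(N)$ computing $\mathrm{Ext}^*(M,N)$: exact on the sequences
    $0\to N\to\mathrm{coind}\,N\to\mathrm{cosyz}\,N\to0$, acyclic on coinduced
    bimodules, with $H^0=\mathrm{Hom}(M,N)$. Functoriality is only recorded on
    the maps of these sequences. *)
Record resolving := Resolving {
  rsv_cpx :> bimod B A -> complex k;
  rsv_in : forall (N : bimod B A) n, rsv_cpx N n -> rsv_cpx (coind B A N) n;
  rsv_out : forall (N : bimod B A) n, rsv_cpx (coind B A N) n -> rsv_cpx (cosyz N) n;
  rsv_aug : forall (N : bimod B A), bihom M N -> rsv_cpx N 0;
  rsv_in_lin : forall (N : bimod B A) n, linear (@rsv_in N n);
  rsv_out_lin : forall (N : bimod B A) n, linear (@rsv_out N n);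
  rsv_aug_lin : forall (N : bimod B A), linear (@rsv_aug N);
  rsv_in_d : forall (N : bimod B A) n x, rsv_in (cpx_d n x) = cpx_d n (@rsv_in N n x);
  rsv_out_d : forall (N : bimod B A) n x, rsv_out (cpx_d n x) = cpx_d n (@rsv_out N n x);
  rsv_in_inj : forall (N : bimod B A) n x, @rsv_in N n x = 0 -> x = 0;
  rsv_exact : forall (N : bimod B A) n y, @rsv_out N n y = 0 <-> exists x, y = rsv_in x;
  rsv_out_surj : forall (N : bimod B A) n z, exists y, @rsv_out N n y = z;
  rsv_acyclic : forall (N : bimod B A) n (y : rsv_cpx (coind B A N) n.+1),
    cpx_d _ y = 0 -> exists x, y = cpx_d n x;
  rsv_aug_inj : forall (N : bimod B A) u, @rsv_aug N u = 0 -> u = 0;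
  rsv_aug_cocycle : forall (N : bimod B A) x, cpx_d _ x = 0 <-> exists u, x = @rsv_aug N u;
  rsv_aug_nat : forall (N : bimod B A) (u : bihom M (coind B A N)),
    rsv_out (rsv_aug u)
      = rsv_aug (mkbihom (bihom_comp (cosyz_pi_hom N) (bihomP u)))
}.

Variable F : resolving.
Implicit Type N : bimod B A.

Let iL := @rsv_in_lin F.
Let pL := @rsv_out_lin F.

Lemma rsv_out_in N n (x : F N n) : rsv_out (rsv_in x) = 0.
Proof. by apply/rsv_exact; exists x. Qed.

Lemma rsv_in_cancel N n (x y : F N n) : rsv_in x = rsv_in y -> x = y.
Proof.
move=> xy; apply/eqP; rewrite -subr_eq0; apply/eqP/rsv_in_inj.
by rewrite (linear_isB (@iL N n)) xy subrr.
Qed.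

Lemma rsv_aug_d N u : cpx_d 0%N (@rsv_aug F N u) = 0.
Proof. by apply/rsv_aug_cocycle; exists u. Qed.

(** The graph of the connecting homomorphism, on the level of cochains. *)
Definition connect N n (x : F N n.+1) (u : F (cosyz N) n) : Prop :=
  exists g : F (coind B A N) n, rsv_in x = cpx_d n g /\ rsv_out g = u.

Lemma connect_lin N n c (x x' : F N n.+1) (u u' : F (cosyz N) n) :
  connect x u -> connect x' u' -> connect (c *: x + x') (c *: u + u').
Proof.
move=> [g [xg <-]] [g' [xg' <-]]; exists (c *: g + g').
by rewrite iL pL linearP xg xg'.
Qed.

Lemma connect_cocycle N n (x : F N n.+1) (u : F (cosyz N) n) :
  connect x u -> cpx_d n.+1 x = 0 /\ cpx_d n u = 0.
Proof.
move=> [g [xg <-]]; split; last by rewrite -rsv_out_d -xg rsv_out_in.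
by apply: rsv_in_inj; rewrite rsv_in_d xg cpx_dd.
Qed.

Lemma connect_totl N n (x : F N n.+1) : cpx_d n.+1 x = 0 ->
  exists u, connect x u.
Proof.
move=> x0; have /rsv_acyclic[g xg] : cpx_d n.+1 (rsv_in x) = 0.
  by rewrite -rsv_in_d x0 (linear_is0 (@iL _ _)).
by exists (rsv_out g), g.
Qed.

Lemma connect_totr N n (u : F (cosyz N) n) : cpx_d n u = 0 ->
  exists x, connect x u.
Proof.
move=> u0; have [g gu] := rsv_out_surj u.
have /rsv_exact[x gx] : rsv_out (cpx_d n g) = 0 by rewrite rsv_out_d gu.
by exists x, g.
Qed.

(** The cocycles of the coinduced bimodule are the indeterminacy of the
    connecting relation: coboundaries in positive degree, and
    $\mathrm{Hom}(M,\mathrm{coind}\,N)$ in degree 0. *)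
Lemma connect_bound N n (x : F N n.+1) (u : F (cosyz N) n) : connect x u ->
  (exists v, x = cpx_d n v) <-> exists2 g, cpx_d n g = 0 & rsv_out g = u.
Proof.
move=> [g [xg gu]]; split=> [[v xv]|[g' g'0 g'u]].
  exists (g - rsv_in v); first by rewrite linearB /= -xg -rsv_in_d xv subrr.
  by rewrite (linear_isB (@pL _ _)) gu rsv_out_in subr0.
have /rsv_exact[v gv] : rsv_out (g - g') = 0.
  by rewrite (linear_isB (@pL _ _)) gu g'u subrr.
exists v; apply: rsv_in_cancel.
by rewrite xg rsv_in_d -gv linearB /= g'0 subr0.
Qed.

Lemma cohomology_shift N n :
  liso (cohomology (F N) n.+2) (cohomology (F (cosyz N)) n.+1).
Proof.
apply: (@cohomology_iso _ _ _ _ _ (@connect N n.+1)) => /=.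
- by move=> *; apply: connect_lin.
- exact: connect_cocycle.
- exact: connect_totl.
- exact: connect_totr.
move=> x u xu; rewrite (propext (connect_bound xu)); split.
  move=> [g /rsv_acyclic[h ->] <-]; exists (rsv_out h); exact: rsv_out_d.
move=> [w ->]; have [h <-] := rsv_out_surj w.
by exists (cpx_d n h); [exact: cpx_dd | exact: rsv_out_d].
Qed.

End DeltaFunctor.

Section Uniqueness.
Variables (k : fieldType) (B A : algType k) (M : bimod B A).

Lemma cohomology_resolving0 (F G : resolving M) N :
  liso (cohomology (F N) 0%N) (cohomology (G N) 0%N).
Proof.
apply: (@cohomology_iso _ _ _ _ _
  (fun x y => exists u, x = rsv_aug F u /\ y = rsv_aug G u)).
- move=> c x x' y y' [u [-> ->]] [u' [-> ->]]; exists (c *: u + u').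
  by rewrite !rsv_aug_lin.
- by move=> _ _ [u [-> ->]]; rewrite !rsv_aug_d.
- by move=> x /rsv_aug_cocycle[u ->]; exists (rsv_aug G u), u.
- by move=> y /rsv_aug_cocycle[u ->]; exists (rsv_aug F u), u.
move=> _ _ [u [-> ->]] /=.
by split=> /rsv_aug_inj->; apply: linear_is0; apply: rsv_aug_lin.
Qed.

(** In degree 1 both sides are the cokernel of
    $\mathrm{Hom}(M,\mathrm{coind}\,N)\to\mathrm{Hom}(M,\mathrm{cosyz}\,N)$. *)
Lemma cohomology_resolving1 (F G : resolving M) N :
  liso (cohomology (F N) 1%N) (cohomology (G N) 1%N).
Proof.
pose R x y := exists u,
  connect x (@rsv_aug _ _ _ _ F (cosyz N) u) /\
  connect y (@rsv_aug _ _ _ _ G (cosyz N) u).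
apply: (@cohomology_iso _ _ _ _ _ R).
- move=> c x x' y y' [u [xu yu]] [u' [xu' yu']]; exists (c *: u + u').
  by rewrite !rsv_aug_lin; split; apply: connect_lin.
- by move=> x y [u [/connect_cocycle[-> _] /connect_cocycle[-> _]]].
- move=> x /connect_totl[v xv]; have [_ /rsv_aug_cocycle[u vu]] := connect_cocycle xv.
  have [y yu] := connect_totr (rsv_aug_d G u).
  by exists y, u; rewrite -vu.
- move=> y /connect_totl[v yv]; have [_ /rsv_aug_cocycle[u vu]] := connect_cocycle yv.
  have [x xu] := connect_totr (rsv_aug_d F u).
  by exists x, u; rewrite -vu.
have half (F' G' : resolving M) u :
    (exists2 g, cpx_d 0%N g = 0 & rsv_out g = @rsv_aug _ _ _ _ F' (cosyz N) u) ->
    (exists2 g, cpx_d 0%N g = 0 & rsv_out g = @rsv_aug _ _ _ _ G' (cosyz N) u).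
  move=> [_ /rsv_aug_cocycle[w ->]]; rewrite rsv_aug_nat => wu.
  exists (rsv_aug G' w); first exact: rsv_aug_d.
  rewrite rsv_aug_nat; congr rsv_aug.
  apply/eqP; rewrite -subr_eq0; apply/eqP/(@rsv_aug_inj _ _ _ _ F').
  by rewrite (linear_isB (@rsv_aug_lin _ _ _ _ F' _)) wu subrr.
move=> x y [u [xu yu]] /=.
by rewrite (propext (connect_bound xu)) (propext (connect_bound yu)); split; apply: half.
Qed.

(** Dimension shifting lowers the degree at the price of replacing [N] by
    $\mathrm{cosyz}\,N$, so the induction runs over all coefficients at once. *)
Theorem cohomology_resolving (F G : resolving M) (n : int) N :
  liso (cohomology (F N) n) (cohomology (G N) n).
Proof.
case: n => [[|n]|n]; first exact: cohomology_resolving0; last first.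
  by exists idfun, id.
elim: n N => [|n IH] N; first exact: cohomology_resolving1.
apply: liso_trans (cohomology_shift F N n) _.
apply: liso_trans (IH (cosyz N)) _.
by apply: liso_sym; apply: cohomology_shift.
Qed.

End Uniqueness.

(** * Ext from a projective resolution *)

Section Postcomposition.
Variables (k : fieldType) (B A : algType k) (M N L : bimod B A).
Variables (g : N -> L) (gb : is_bihom g).

Definition bihom_post (f : bihom M N) : bihom M L :=
  mkbihom (bihom_comp gb (bihomP f)).

Lemma bihom_post_lin : linear bihom_post.
Proof.
have [gL _ _] := gb.
by move=> c f f'; apply/val_inj/funext => x; apply: gL.
Qed.

Lemma bihom_ext (f f' : bihom M N) : (forall x, val f x = val f' x) -> f = f'.
Proof. by move=> ff'; apply/val_inj/funext. Qed.

End Postcomposition.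

Section HomResolving.
Variables (k : fieldType) (B A : algType k) (M : bimod B A).
Variable P : proj_resolution M.
Implicit Type N : bimod B A.

Lemma coind_unit_inj N n n' : coind_unit n = coind_unit n' :> coind B A N -> n = n'.
Proof. by move=> nn; rewrite -[n]coind_unitK nn coind_unitK. Qed.

Lemma hom_in_inj N n (f : bihom (P n) N) :
  bihom_post (coind_unit_hom N) f = 0 -> f = 0.
Proof.
have [uL _ _] := coind_unit_hom N.
move=> f0; apply: bihom_ext => x; apply: coind_unit_inj.
have E : coind_unit (val f x) = 0 by have /(congr1 (fun h => val h x)) := f0.
exact: etrans E (esym (linear_is0 uL)).
Qed.

Lemma hom_exact N n (f : bihom (P n) (coind B A N)) :
  bihom_post (cosyz_pi_hom N) f = 0 <->
  exists g, f = bihom_post (coind_unit_hom N) g.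
Proof.
split=> [f0|[g ->]]; last first.
  by apply: bihom_ext => x; apply/cosyz_pi_eq0; exists (val g x).
have [|g gb fg] := bihom_lift_unit (bihomP f).
  by move=> x; have /(congr1 (fun h => val h x)) := f0.
by exists (mkbihom gb); apply: bihom_ext.
Qed.

Lemma hom_out_surj N n (f : bihom (P n) (cosyz N)) :
  exists g, bihom_post (cosyz_pi_hom N) g = f.
Proof.
have [g gb gf] := res_proj (cosyz_pi_hom N) (bihomP f) (@cosyz_pi_surj _ _ _ N).
by exists (mkbihom gb); apply: bihom_ext.
Qed.

(** By adjunction the complex of morphisms into a coinduced bimodule is
    $\mathrm{Hom}_k(P_\bullet,N)$, and vector spaces are injective. *)
Lemma hom_acyclic N n (f : bihom (P n.+1) (coind B A N)) :
  hom_d f = 0 -> exists g, f = hom_d g.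
Proof.
move=> f0; have [fL fl fr] := bihomP f; have [dL dl dr] := res_d_hom P n.
have [||x /res_exact[y ->]|h hL hd] :=
    @linear_factor k (P n.+1) N (P n) (res_d P n) (fun x => val (val f x) 1 1).
- exact: dL.
- by move=> c x y; rewrite fL coindDE.
- by have /(congr1 (fun g => val g y)) /= -> := f0.
have gP x : (fun b a => h (ract (lact b x) a)) \in @bilin k B A N.
  apply/asboolP; split=> u c b d; last by rewrite linearP hL.
  by rewrite lactDl lactZl ractDl ractZl hL.
pose g x : coind B A N := Subsp (gP x).
have gb : is_bihom g.
  split=> [c x y|b x|x a]; apply: bilin_ext => u v.
  - by rewrite coindDE /= linearP ractDl ractZl hL.
  - by rewrite /= lactA.
  by rewrite /= -lractA ractA.
exists (mkbihom gb); apply: bihom_ext => x; apply: bilin_ext => u v /=.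
by rewrite -dl -dr hd fr fl /= mul1r mulr1.
Qed.

Definition hom_aug N (u : bihom M N) : bihom (P 0) N :=
  mkbihom (bihom_comp (bihomP u) (res_aug_hom P)).

Lemma hom_aug_inj N (u : bihom M N) : hom_aug u = 0 -> u = 0.
Proof.
move=> u0; apply: bihom_ext => m; have [x <-] := res_aug_surj P m.
by have /(congr1 (fun g => val g x)) := u0.
Qed.

Lemma hom_aug_cocycle N (f : bihom (P 0) N) :
  hom_d f = 0 <-> exists u, f = hom_aug u.
Proof.
have [aL al ar] := res_aug_hom P.
split=> [f0|[u ->]]; last first.
  apply: bihom_ext => x /=; have [uL _ _] := bihomP u.
  have -> : res_aug (res_d P 0 x) = 0 by apply/res_aug_exact; exists x.
  by rewrite (linear_is0 uL).
have [fL fl fr] := bihomP f.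
have fK x y : res_aug x = res_aug y -> val f x = val f y.
  move=> xy; have [|z zE] := (res_aug_exact (x - y)).1.
    by rewrite (linear_isB aL) xy subrr.
  apply/subr0_eq; rewrite -(linear_isB fL) zE.
  by have /(congr1 (fun g => val g z)) := f0.
have [s sK] := choice (res_aug_surj P).
have ub : is_bihom (fun m => val f (s m)).
  split=> [c x y|b x|x a].
  - by rewrite -fL; apply: fK; rewrite aL !sK.
  - by rewrite -fl; apply: fK; rewrite al !sK.
  by rewrite -fr; apply: fK; rewrite ar !sK.
by exists (mkbihom ub); apply: bihom_ext => x; apply: fK; rewrite sK.
Qed.

Definition hom_resolving : resolving M.
Proof.
apply: (@Resolving k B A M (hom_complex P)
  (fun N n => bihom_post (coind_unit_hom N))
  (fun N n => bihom_post (cosyz_pi_hom N)) hom_aug).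
- by move=> N n; apply: bihom_post_lin.
- by move=> N n; apply: bihom_post_lin.
- by move=> N c u v; apply: bihom_ext.
- by move=> N n x; apply: bihom_ext.
- by move=> N n x; apply: bihom_ext.
- exact: hom_in_inj.
- exact: hom_exact.
- exact: hom_out_surj.
- exact: hom_acyclic.
- exact: hom_aug_inj.
- exact: hom_aug_cocycle.
by move=> N u; apply: bihom_ext.
Defined.

End HomResolving.

(** * The bar complex of a bimodule *)

Section Slots.
Variables (k : fieldType) (E W : lmodType k).

Definition multilin (c : seq E -> W) : Prop := forall s1 s2 u x y,
  c (s1 ++ (u *: x + y) :: s2) = u *: c (s1 ++ x :: s2) + c (s1 ++ y :: s2).

Definition after (x : E) (c : seq E -> W) : seq E -> W := fun s => c (x :: s).

Lemma multilin_after c x : multilin c -> multilin (after x c).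
Proof. by move=> cL s1 s2 u y z; apply: (cL (x :: s1)). Qed.

Lemma after_lin c u x y : multilin c ->
  after (u *: x + y) c = u *: after x c + after y c.
Proof. by move=> cL; apply/funext => s; apply: (cL [::]). Qed.

Lemma multilin_lincomb c c' v : multilin c -> multilin c' ->
  multilin (v *: c + c').
Proof.
move=> cL cL' s1 s2 u x y.
rewrite !fctE cL cL' !scalerDr !scalerA mulrC -!addrA; congr (_ + _).
by rewrite addrCA.
Qed.

End Slots.

Section Bar.
Variables (k : fieldType) (B A : algType k) (M : bimod B A).

Section Operators.
Variable N : bimod B A.
Implicit Types (c : seq A -> N) (f : M -> seq A -> N).
Implicit Types (h : seq B -> M -> seq A -> N).

Definition rmerge x c : seq A -> N :=
  fun s => if s is a :: s' then c (x * a :: s') else ract (c [::]) x.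

(** Recursion on the first letter makes the alternating signs of the faces
    implicit, and reduces identities between faces to one step. *)
Fixpoint rbar c (s : seq A) : N :=
  if s is a :: s' then rmerge a c s' - rbar (after a c) s' else 0.

Definition mmerge f : M -> seq A -> N :=
  fun m s => if s is a :: s' then f (ract m a) s' else 0.

Definition mbar f : M -> seq A -> N := fun m => mmerge f m - rbar (f m).

Definition lmerge x h : seq B -> M -> seq A -> N := fun bs m =>
  if bs is b :: bs' then h (x * b :: bs') m else h [::] (lact x m).

Fixpoint lbar h (bs : seq B) : M -> seq A -> N :=
  if bs is b :: bs' then lmerge b h bs' - lbar (after b h) bs'
  else mbar (h [::]).

Definition lfirst h : seq B -> M -> seq A -> N := fun bs m s =>
  if bs is b :: bs' then lact b (h bs' m s) else 0.

Definition bar_diff h : seq B -> M -> seq A -> N := lfirst h - lbar h.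

Lemma bar_diffE h bs m s : bar_diff h bs m s = lfirst h bs m s - lbar h bs m s.
Proof. by []. Qed.
Lemma lbar_cons h b bs m s :
  lbar h (b :: bs) m s = lmerge b h bs m s - lbar (after b h) bs m s.
Proof. by []. Qed.
Lemma mbarE f m s : mbar f m s = mmerge f m s - rbar (f m) s.
Proof. by []. Qed.

(** ** Linearity *)

Lemma rmerge_linr u x c c' :
  rmerge x (u *: c + c') = u *: rmerge x c + rmerge x c'.
Proof.
by apply/funext => -[|a s] //; apply: ract_linearl.
Qed.

Lemma rbar_lin : linear rbar.
Proof.
move=> u c c'; apply/funext => s; rewrite !fctE.
elim: s c c' => [|a s IH] c c' /=; first by rewrite scaler0 addr0.
have -> : after a (u *: c + c') = u *: after a c + after a c' by [].
by rewrite rmerge_linr !fctE IH scalerBr opprD addrACA.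
Qed.

Lemma mbar_lin : linear mbar.
Proof.
move=> u f f'; apply/funext => m.
change (mmerge (u *: f + f') m - rbar ((u *: f + f') m) =
  u *: (mmerge f m - rbar (f m)) + (mmerge f' m - rbar (f' m))).
have -> : mmerge (u *: f + f') m = u *: mmerge f m + mmerge f' m.
  apply/funext => -[|a s] //.
  by change (0 = u *: 0 + 0 :> N); rewrite scaler0 addr0.
have -> : rbar ((u *: f + f') m) = u *: rbar (f m) + rbar (f' m).
  exact: rbar_lin.
by rewrite scalerBr opprD addrACA.
Qed.

Lemma lmerge_linr u x h h' :
  lmerge x (u *: h + h') = u *: lmerge x h + lmerge x h'.
Proof. by apply/funext => -[]. Qed.

Lemma lbar_lin : linear lbar.
Proof.
move=> u h h'; apply/funext => s; rewrite [in RHS]fctE.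
elim: s h h' => [|b s IH] h h'; first exact: mbar_lin.
change (lmerge b (u *: h + h') s - lbar (u *: after b h + after b h') s =
  u *: (lmerge b h s - lbar (after b h) s)
    + (lmerge b h' s - lbar (after b h') s)).
rewrite lmerge_linr IH.
change ((u *: lmerge b h + lmerge b h') s) with (u *: lmerge b h s + lmerge b h' s).
change ((u *: lbar (after b h) + lbar (after b h')) s) with
  (u *: lbar (after b h) s + lbar (after b h') s).
by rewrite scalerBr opprD addrACA.
Qed.

Lemma lfirst_lin : linear lfirst.
Proof.
move=> u h h'; apply/funext => -[|b s]; apply/funext => m; apply/funext => t.
  by change (0 = u *: 0 + 0 :> N); rewrite scaler0 addr0.
exact: (lact_linearr b u (h s m t) (h' s m t)).
Qed.

Lemma bar_diff_lin : linear bar_diff.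
Proof.
by move=> u h h'; rewrite /bar_diff lfirst_lin lbar_lin scalerBr opprD addrACA.
Qed.

(** ** The square of the differential *)

Lemma rmerge_rmerge x y c : rmerge y (rmerge x c) = rmerge (x * y) c.
Proof. by apply/funext => -[|a s] /=; rewrite ?ractA ?mulrA. Qed.

Lemma after_rbar x c : after x (rbar c) = rmerge x c - rbar (after x c).
Proof. by apply/funext. Qed.

Lemma rbar_rmerge x c : rbar (rmerge x c) = rmerge x (rbar c).
Proof.
apply/funext => -[|y s] /=; first by rewrite ract0l.
by rewrite rmerge_rmerge.
Qed.

Lemma rbar_rbar c : rbar (rbar c) = 0.
Proof.
apply/funext => s; change (rbar (rbar c) s = 0).
elim: s c => [|x s IH] c //=.
rewrite after_rbar (linear_isB rbar_lin) rbar_rmerge.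
change (rmerge x (rbar c) s - (rmerge x (rbar c) s - rbar (rbar (after x c)) s) = 0).
by rewrite IH subr0 subrr.
Qed.

Lemma mmerge_mmerge f m x s :
  mmerge (mmerge f) m (x :: s) = rmerge x (mmerge f m) s.
Proof. by case: s => [|y s] /=; rewrite ?ract0l ?ractA. Qed.

(** Since [rbar] squares to zero, only faces that involve [m] remain, and these
    cancel by associativity of the right action on [M]. *)
Lemma mbar_mbar f : mbar (mbar f) = 0.
Proof.
apply/funext => m; apply/funext => s; rewrite mbarE.
have -> : rbar (mbar f m) s = rbar (mmerge f m) s.
  have -> : mbar f m = mmerge f m - rbar (f m) by [].
  rewrite (linear_isB rbar_lin) rbar_rbar.
  by rewrite subr0.
case: s => [|x s]; first by rewrite /= subrr.
have -> : mmerge (mbar f) m (x :: s)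
          = mmerge (mmerge f) m (x :: s) - mmerge (fun m => rbar (f m)) m (x :: s).
  by [].
by rewrite mmerge_mmerge /= subrr.
Qed.

Lemma lmerge_lmerge x y h : lmerge y (lmerge x h) = lmerge (x * y) h.
Proof.
by apply/funext => -[|b s]; apply/funext => m /=; rewrite ?lactA ?mulrA.
Qed.

Lemma lbar_lmerge x h : lbar (lmerge x h) = lmerge x (lbar h).
Proof.
apply/funext => -[|y bs]; apply/funext => m; last by rewrite /= lmerge_lmerge.
by apply/funext => -[|a s]; rewrite /= !mbarE /= ?lractA.
Qed.

Lemma lbar_lbar h : lbar (lbar h) = 0.
Proof.
apply/funext => s; elim: s h => [|x s IH] h; first exact: mbar_mbar.
have E : after x (lbar h) = lmerge x h - lbar (after x h) by [].
change (lmerge x (lbar h) s - lbar (after x (lbar h)) s = 0).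
rewrite E (linear_isB lbar_lin) lbar_lmerge.
change (lmerge x (lbar h) s - (lmerge x (lbar h) s - lbar (lbar (after x h)) s) = 0).
by rewrite IH subr0 subrr.
Qed.

End Operators.

(** The faces only use subtraction and the right action, and are evaluated on
    words that are one letter shorter. *)
Lemma rbar_rel (N N' : bimod B A) (R : N -> N' -> Prop) c c' s :
  R 0 0 -> (forall x y x' y', R x x' -> R y y' -> R (x - y) (x' - y')) ->
  (forall x x' a, R x x' -> R (ract x a) (ract x' a)) ->
  (forall s', (size s').+1 = size s -> R (c s') (c' s')) ->
  R (rbar c s) (rbar c' s).
Proof.
move=> R0 RB Ra; elim: s c c' => [|a s IH] c c' cc' //=.
apply: (RB); last by apply: IH => s' s's; apply: cc'; rewrite /= s's.
by case: s {IH} cc' => [|b s] cc' /=; [apply: Ra; apply: cc' | apply: cc'].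
Qed.

Lemma lbar_rel (N N' : bimod B A) (R : N -> N' -> Prop) h h' bs m s :
  R 0 0 -> (forall x y x' y', R x x' -> R y y' -> R (x - y) (x' - y')) ->
  (forall x x' a, R x x' -> R (ract x a) (ract x' a)) ->
  (forall bs' m' s', (size bs' + size s').+1 = (size bs + size s)%N ->
     R (h bs' m' s') (h' bs' m' s')) ->
  R (lbar h bs m s) (lbar h' bs m s).
Proof.
move=> R0 RB Ra; elim: bs h h' m => [|b bs IH] h h' m hh'.
  rewrite /= !mbarE; apply: (RB).
    by case: s hh' => [|a s] hh' //=; apply: hh'.
  by apply: rbar_rel => // s' s's; apply: hh'.
rewrite !lbar_cons; apply: (RB).
  by case: bs {IH} hh' => [|b' bs] hh' /=; apply: hh'.
by apply: IH => bs' m' s' e; apply: hh'; rewrite /= addSn e.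
Qed.

Lemma bar_diff_post (N L : bimod B A) (g : N -> L) h bs m s : is_bihom g ->
  bar_diff (fun bs m s => g (h bs m s)) bs m s = g (bar_diff h bs m s).
Proof.
move=> [gL gl gr]; rewrite !bar_diffE (linear_isB gL); congr (_ - _).
  by case: bs => [|b bs] /=; rewrite ?(linear_is0 gL) ?gl.
apply: (@lbar_rel _ _ (fun x y => x = g y)) => //.
- by rewrite (linear_is0 gL).
- by move=> x y x' y' -> ->; rewrite (linear_isB gL).
by move=> x x' a ->; rewrite gr.
Qed.

Lemma bar_diff_eq (N : bimod B A) (h h' : seq B -> M -> seq A -> N) bs m s :
  (forall bs' m' s', (size bs' + size s').+1 = (size bs + size s)%N ->
     h bs' m' s' = h' bs' m' s') ->
  bar_diff h bs m s = bar_diff h' bs m s.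
Proof.
move=> hh'; rewrite !bar_diffE; congr (_ - _).
  by case: bs hh' => [|b bs] hh' //=; rewrite hh'.
by apply: (@lbar_rel _ _ eq) => // [x y x' y' -> -> | x x' a ->].
Qed.

Section Square.
Variable N : bimod B A.
Implicit Type h : seq B -> M -> seq A -> N.

Lemma lbar_lfirst h x bs m s :
  lbar (lfirst h) (x :: bs) m s
    = lfirst (lfirst h) (x :: bs) m s - lact x (lbar h bs m s).
Proof.
rewrite lbar_cons; congr (_ - _); first by case: bs => [|y bs] /=; rewrite ?linear0 ?lactA.
apply: (@lbar_rel _ _ (fun u v => u = lact x v)) => //.
- by rewrite linear0.
- by move=> u v u' v' -> ->; rewrite linearB.
by move=> u u' a ->; rewrite lractA.
Qed.

(** Since [lbar] squares to zero, only terms with a left action remain. On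
    [lfirst h], [lbar] merges the two outer letters, or else commutes with the
    left action; the outcome is what [lfirst] gives on [bar_diff h]. *)
Lemma bar_diff_diff h : bar_diff (bar_diff h) = 0.
Proof.
rewrite {1}/bar_diff (linear_isB (@lbar_lin N)) lbar_lbar subr0.
apply/funext => -[|x bs]; apply/funext => m; apply/funext => s.
  change (0 - lbar (lfirst h) [::] m s = 0); rewrite sub0r.
  suff -> : lbar (lfirst h) [::] m s = 0 by rewrite oppr0.
  have -> : lbar (lfirst h) [::] = mbar (0 : M -> seq A -> N) by [].
  by rewrite (linear_is0 (@mbar_lin N)).
change (lact x (bar_diff h bs m s) - lbar (lfirst h) (x :: bs) m s = 0).
by rewrite lbar_lfirst /= bar_diffE linearB subrr.
Qed.

End Square.

(** ** Multilinearity *)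

Section Multilinear.
Variable N : bimod B A.
Implicit Types (c : seq A -> N) (f : M -> seq A -> N).
Implicit Types (h : seq B -> M -> seq A -> N).

Lemma rmerge_multilin x c : multilin c -> multilin (rmerge x c).
Proof.
move=> cL [|a s1] s2 u y z /=; last exact: (cL (x * a :: s1)).
by rewrite mulrDr -scalerAr; apply: (cL [::]).
Qed.

Lemma rmerge_linl u x y c : multilin c ->
  rmerge (u *: x + y) c = u *: rmerge x c + rmerge y c.
Proof.
move=> cL; apply/funext => -[|a s]; first exact: ract_linearr.
by rewrite /= mulrDl -scalerAl; apply: (cL [::]).
Qed.

Lemma rbar_multilin c : multilin c -> multilin (rbar c).
Proof.
move=> cL s1; elim: s1 c cL => [|a s1 IH] c cL s2 u x y /=.
  rewrite rmerge_linl // after_lin // rbar_lin.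
  change (u *: rmerge x c s2 + rmerge y c s2
      - (u *: rbar (after x c) s2 + rbar (after y c) s2) =
    u *: (rmerge x c s2 - rbar (after x c) s2)
      + (rmerge y c s2 - rbar (after y c) s2)).
  by rewrite scalerBr opprD addrACA.
rewrite rmerge_multilin // IH; last exact: multilin_after.
by rewrite scalerBr opprD addrACA.
Qed.

Lemma mmerge_multilin f m : linear f -> (forall m, multilin (f m)) ->
  multilin (mmerge f m).
Proof.
move=> fL fm [|a s1] s2 u x y /=; last exact: fm.
by rewrite linearP fL.
Qed.

Lemma mmerge_linm f : linear f -> linear (mmerge f).
Proof.
move=> fL u m m'; apply/funext => -[|a s] /=.
  by change (0 = u *: 0 + 0 :> N); rewrite scaler0 addr0.
by rewrite ractDl ractZl fL.
Qed.

Lemma mbar_linm f : linear f -> linear (mbar f).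
Proof.
move=> fL u m m'; rewrite /mbar mmerge_linm // fL rbar_lin.
by rewrite scalerBr opprD addrACA.
Qed.

Lemma mbar_multilin f m : linear f -> (forall m, multilin (f m)) ->
  multilin (mbar f m).
Proof.
move=> fL fm; have -> : mbar f m = -1 *: rbar (f m) + mmerge f m.
  by rewrite scaleN1r addrC.
by apply: multilin_lincomb; [apply: rbar_multilin | apply: mmerge_multilin].
Qed.

Definition word_multilin h : Prop :=
  [/\ multilin h, forall bs, linear (h bs) & forall bs m, multilin (h bs m)].

Lemma word_multilinP h : word_multilin h <->
  [/\ forall s1 s2 u x y m s, h (s1 ++ (u *: x + y) :: s2) m s
        = u *: h (s1 ++ x :: s2) m s + h (s1 ++ y :: s2) m s,
      forall bs u m m' s, h bs (u *: m + m') s = u *: h bs m s + h bs m' s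
    & forall bs m s1 s2 u x y, h bs m (s1 ++ (u *: x + y) :: s2)
        = u *: h bs m (s1 ++ x :: s2) + h bs m (s1 ++ y :: s2)].
Proof.
split=> -[hb hm ha]; split=> //.
- by move=> s1 s2 u x y m s; rewrite hb.
- by move=> bs u m m' s; rewrite hm.
- move=> s1 s2 u x y; apply/funext => m; apply/funext => s; exact: hb.
by move=> bs u m m'; apply/funext => s; apply: hm.
Qed.

Lemma word_multilin_after x h : word_multilin h -> word_multilin (after x h).
Proof.
move=> [hb hm ha]; split=> *; [exact: multilin_after | exact: hm | exact: ha].
Qed.

Lemma word_multilin_lincomb u h h' : word_multilin h -> word_multilin h' ->
  word_multilin (u *: h + h').
Proof.
move=> [hb hm ha] [hb' hm' ha']; split; first exact: multilin_lincomb.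
  move=> bs v m m'.
  change (u *: h bs (v *: m + m') + h' bs (v *: m + m') =
    v *: (u *: h bs m + h' bs m) + (u *: h bs m' + h' bs m')).
  rewrite hm hm' !scalerDr !scalerA mulrC -!addrA.
  by congr (_ + _); rewrite addrCA.
by move=> bs m; apply: multilin_lincomb; [apply: ha | apply: ha'].
Qed.

Lemma lmerge_linl u x y h : word_multilin h ->
  lmerge (u *: x + y) h = u *: lmerge x h + lmerge y h.
Proof.
move=> [hb hm ha]; apply/funext => -[|b s]; apply/funext => m /=.
  by rewrite lactDl lactZl hm.
rewrite mulrDl -scalerAl.
exact: (congr1 (fun g => g m) (hb [::] s u (x * b) (y * b))).
Qed.

Lemma lmerge_word_multilin x h : word_multilin h -> word_multilin (lmerge x h).
Proof.
move=> [hb hm ha]; split=> [s1 s2 u y z|[|b bs] u m m'|[|b bs] m] /=;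
  try by [apply: ha | apply: hm].
- apply/funext => m; case: s1 => [|b s1] /=.
    rewrite mulrDr -scalerAr.
    exact: (congr1 (fun g => g m) (hb [::] s2 u (x * y) (x * z))).
  exact: (congr1 (fun g => g m) (hb (x * b :: s1) s2 u y z)).
by rewrite linearP hm.
Qed.

Lemma lbar_multilin h : word_multilin h -> multilin (lbar h).
Proof.
move=> hL s1; elim: s1 h hL => [|b s1 IH] h hL s2 u x y /=.
  have [hb hm ha] := hL; rewrite lmerge_linl // after_lin // lbar_lin.
  change (u *: lmerge x h s2 + lmerge y h s2
      - (u *: lbar (after x h) s2 + lbar (after y h) s2) =
    u *: (lmerge x h s2 - lbar (after x h) s2)
      + (lmerge y h s2 - lbar (after y h) s2)).
  by rewrite scalerBr opprD addrACA.
have [lb _ _] := lmerge_word_multilin b hL.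
rewrite lb IH; last exact: word_multilin_after.
by rewrite scalerBr opprD addrACA.
Qed.

Lemma lbar_word_multilin h : word_multilin h -> word_multilin (lbar h).
Proof.
move=> hL; split; first exact: lbar_multilin.
  move=> bs; elim: bs h hL => [|b bs IH] h hL /=.
    by have [_ hm _] := hL; apply: mbar_linm.
  have [_ lm _] := lmerge_word_multilin b hL.
  have am := IH _ (word_multilin_after b hL).
  move=> u m m'; rewrite -[LHS]/(lmerge b h bs _ - lbar (after b h) bs _).
  by rewrite lm am scalerBr opprD addrACA.
move=> bs; elim: bs h hL => [|b bs IH] h hL m /=.
  by have [_ hm ha] := hL; apply: mbar_multilin.
have [_ _ la] := lmerge_word_multilin b hL.
rewrite -[X in multilin X]/(lmerge b h bs m - lbar (after b h) bs m) addrC.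
rewrite -scaleN1r; apply: multilin_lincomb; last exact: la.
exact: IH (word_multilin_after b hL) m.
Qed.

Lemma lfirst_word_multilin h : word_multilin h -> word_multilin (lfirst h).
Proof.
move=> [hb hm ha]; split=> [[|b s1] s2 u x y|[|b bs] u m m'|[|b bs] m s1 s2 u x y] /=.
- apply/funext => m; apply/funext => s; exact: lact_linearl.
- apply/funext => m; apply/funext => s.
  by rewrite /lfirst /= hb; apply: lact_linearr.
- by apply/funext => s; change (0 = u *: 0 + 0 :> N); rewrite scaler0 addr0.
- by apply/funext => s; rewrite /lfirst /= hm; apply: lact_linearr.
- by rewrite scaler0 addr0.
by rewrite ha linearP.
Qed.

Lemma bar_diff_word_multilin h : word_multilin h -> word_multilin (bar_diff h).
Proof.
move=> hL; rewrite /bar_diff addrC -scaleN1r; apply: word_multilin_lincomb.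
  exact: lbar_word_multilin.
exact: lfirst_word_multilin.
Qed.

Lemma word_multilin0 : word_multilin 0.
Proof.
split=> [s1 s2 u x y|bs u m m'|bs m s1 s2 u x y];
  [change (0 = u *: 0 + 0 :> (M -> seq A -> N))
  |change (0 = u *: 0 + 0 :> (seq A -> N)) |change (0 = u *: 0 + 0 :> N)];
  by rewrite scaler0 addr0.
Qed.

(** ** The complex *)

(** Multilinear maps $B^{\otimes q}\otimes M\otimes A^{\otimes p}\to N$ with
    $q+p=n$, all packed into one function of words. *)
Definition bar_cochain n : {pred seq B -> M -> seq A -> N} := fun h =>
  `[< word_multilin h /\
      forall bs m s, (size bs + size s)%N <> n -> h bs m s = 0 >].

Fact bar_cochain_closed n : submod_closed (bar_cochain n).
Proof.
split=> [|u h h']; rewrite !unfold_in.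
  by apply/asboolP; split=> //; exact: word_multilin0.
move=> /asboolP[hL hS] /asboolP[hL' hS']; apply/asboolP; split.
  exact: word_multilin_lincomb.
move=> bs m s ne; change (u *: h bs m s + h' bs m s = 0).
by rewrite hS // hS' // scaler0 addr0.
Qed.
HB.instance Definition _ n :=
  GRing.isSubmodClosed.Build k _ (bar_cochain n) (bar_cochain_closed n).

Definition bar_space n : lmodType k := subsp (bar_cochain n).

Lemma bar_cochainP n (c : bar_space n) : word_multilin (val c) /\
  forall bs m s, (size bs + size s)%N <> n -> val c bs m s = 0.
Proof. exact/asboolP/(subsp_valP c). Qed.

Lemma bar_cochain_ext n (c c' : bar_space n) :
  (forall bs m s, (size bs + size s)%N = n -> val c bs m s = val c' bs m s) ->
  c = c'.
Proof.
move=> cc; apply/val_inj/funext => bs; apply/funext => m; apply/funext => s.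
have [/cc //|/eqP ne] := eqVneq (size bs + size s)%N n.
by rewrite (bar_cochainP c).2 // (bar_cochainP c').2.
Qed.

Lemma bar_cochainD n u (c c' : bar_space n) bs m s :
  val (u *: c + c') bs m s = u *: val c bs m s + val c' bs m s.
Proof. by rewrite linearP. Qed.

Lemma bar_cochainB n (c c' : bar_space n) bs m s :
  val (c - c') bs m s = val c bs m s - val c' bs m s.
Proof. by rewrite linearB. Qed.

Lemma bar_cochainZ n u (c : bar_space n) bs m s :
  val (u *: c) bs m s = u *: val c bs m s.
Proof. by rewrite -[c in LHS]addr0 scalerDr scaler0 bar_cochainD linear0 addr0. Qed.

Lemma bar_cochain0 n bs m s : val (0 : bar_space n) bs m s = 0.
Proof. by rewrite linear0. Qed.

Fact bar_d_subproof n (c : bar_space n) :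
  bar_diff (val c) \in bar_cochain n.+1.
Proof.
have [cL cS] := bar_cochainP c; apply/asboolP; split.
  exact: bar_diff_word_multilin.
move=> bs m s ne; rewrite (@bar_diff_eq _ _ 0).
  by rewrite (linear_is0 (@bar_diff_lin N)).
by move=> bs' m' s' e; apply: cS => e'; apply: ne; rewrite -e e'.
Qed.

Definition bar_d n (c : bar_space n) : bar_space n.+1 :=
  Subsp (bar_d_subproof c).

Lemma bar_dE n (c : bar_space n) : val (bar_d c) = bar_diff (val c).
Proof. by []. Qed.

Fact bar_d_linear n : linear (@bar_d n).
Proof.
move=> u c c'; apply/val_inj.
by rewrite bar_dE [in LHS]linearP bar_diff_lin [RHS]linearP.
Qed.
HB.instance Definition _ n :=
  GRing.isLinear.Build k _ _ _ (@bar_d n) (@bar_d_linear n).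

Fact bar_dd n (c : bar_space n) : bar_d (bar_d c) = 0.
Proof. by apply/val_inj; rewrite !bar_dE bar_diff_diff linear0. Qed.

Definition bar_complex : complex k :=
  @Complex k bar_space (fun n => @bar_d n) bar_dd.

End Multilinear.

End Bar.

(** * The bar complexes form a resolving family *)

Section BarPost.
Variables (k : fieldType) (B A : algType k) (M : bimod B A).

Fact bar_post_subproof (N L : bimod B A) (g : N -> L) n
    (c : @bar_space k B A M N n) : linear g ->
  (fun bs m s => g (val c bs m s)) \in @bar_cochain k B A M L n.
Proof.
move=> gL; have [[cb cm ca] cS] := bar_cochainP c.
apply/asboolP; split=> [|bs m s ne]; last by rewrite cS // (linear_is0 gL).
split=> [s1 s2 u x y|bs u m m'|bs m s1 s2 u x y].
- by apply/funext => m; apply/funext => s; rewrite cb; apply: gL.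
- by apply/funext => s; rewrite cm; apply: gL.
by rewrite ca; apply: gL.
Qed.

Definition bar_post (N L : bimod B A) (g : N -> L) (gL : linear g) n
    (c : @bar_space k B A M N n) : @bar_space k B A M L n :=
  Subsp (bar_post_subproof c gL).

Lemma bar_postE N L g gL n c bs m s :
  val (@bar_post N L g gL n c) bs m s = g (val c bs m s).
Proof. by []. Qed.

Lemma bar_post_lin N L g gL n : linear (@bar_post N L g gL n).
Proof.
move=> u c c'; apply: bar_cochain_ext => bs m s _.
by rewrite bar_cochainD !bar_postE bar_cochainD gL.
Qed.

Lemma bar_post_d N L g gL n c : is_bihom g ->
  @bar_post N L g gL n.+1 (bar_d c) = bar_d (bar_post gL c).
Proof.
move=> gb; apply: bar_cochain_ext => bs m s _.
by rewrite bar_postE !bar_dE -(bar_diff_post _ _ _ _ gb).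
Qed.

End BarPost.

Section BarEfface.
Variables (k : fieldType) (B A : algType k) (M : bimod B A) (V : lmodType k).
Local Notation CV := (coind B A V).
Implicit Types (h : seq B -> M -> seq A -> CV) (f : M -> seq A -> CV).
Implicit Types (c : seq A -> CV).

(** The first contraction: on coinduced coefficients the first letter may be
    absorbed into the left argument of the value. The displayed function is
    bilinear only for multilinear [h], hence the default value 0. *)
Definition absorbl h : seq B -> M -> seq A -> CV := fun bs m s =>
  insubd (0 : CV) (fun x y => val (h (x :: bs) m s) 1 y).

Lemma absorblE h bs m s x y : word_multilin h ->
  val (absorbl h bs m s) x y = val (h (x :: bs) m s) 1 y.
Proof.
move=> /word_multilinP[hb _ _]; rewrite /absorbl insubdK //; apply/asboolP.
split=> [v u a b|a] /=; last exact: bilinr.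
by rewrite (hb [::]).
Qed.

Lemma absorbl_cochain n h : h \in @bar_cochain k B A M CV n.+1 ->
  absorbl h \in @bar_cochain k B A M CV n.
Proof.
move=> /asboolP[hL hS]; have /word_multilinP[hb hm ha] := hL.
apply/asboolP; split.
  apply/word_multilinP; split=> *; apply: bilin_ext => v w;
    rewrite coindDE !absorblE ?hm ?ha ?coindDE //.
  by rewrite -cat_cons hb coindDE.
move=> bs m s ne; apply: bilin_ext => v w; rewrite absorblE // hS //.
by move=> /= /eq_add_S.
Qed.

(** All faces of [absorbl h] occur with the opposite sign among those of [h] on
    a word with one more letter [x], except the merging of [x] with the middle
    variable when there is no other letter on the left. *)
Lemma absorbl_homotopy h bs m s x y : word_multilin h ->
  val (bar_diff (absorbl h) bs m s) x y + val (bar_diff h (x :: bs) m s) 1 y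
    = val (h bs m s) x y
      - (if bs is [::] then val (h [::] (lact x m) s) 1 y else 0).
Proof.
move=> hL; rewrite !bar_diffE lbar_cons !coindBE.
have -> : val (lbar (absorbl h) bs m s) x y = val (lbar (after x h) bs m s) 1 y.
  move: y; apply: (@lbar_rel _ _ _ _ _ _
    (fun u v : CV => forall y, val u x y = val v 1 y)) => //.
  - by move=> u v u' v' uu vv y; rewrite !coindBE uu vv.
  - by move=> u v a uv y; rewrite !coind_ractE uv.
  by move=> bs' m' s' _ y; rewrite absorblE.
have -> : val (lfirst h (x :: bs) m s) 1 y = val (h bs m s) x y.
  by rewrite /= mul1r.
have -> : val (lfirst (absorbl h) bs m s) x y =
    val (lmerge x h bs m s) 1 y
      - (if bs is [::] then val (h [::] (lact x m) s) 1 y else 0).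
  case: bs => [|b bs]; first by rewrite /= subrr.
  by rewrite subr0 [LHS]coind_lactE absorblE.
by rewrite opprB addrCA subrKA addrAC subrr add0r.
Qed.

(** The second contraction, on the right, applied to cochains without letters
    on the left. *)
Definition absorbr f : M -> seq A -> CV := fun m s =>
  insubd (0 : CV) (fun x y => val (f m (rcons s y)) x 1).

Lemma absorbrE f m s x y : (forall m, multilin (f m)) ->
  val (absorbr f m s) x y = val (f m (rcons s y)) x 1.
Proof.
move=> fL; rewrite /absorbr insubdK //; apply/asboolP.
split=> [v u a b|a u v w] /=; first exact: bilinl.
by rewrite -!cats1 fL.
Qed.

(** The face that survives is the last one, where the last letter acts on the
    value; all others have a counterpart on the shorter word. *)
Lemma rbar_rcons (g : seq A -> CV) c s x y :
  (forall s y, val (g s) x y = val (c (rcons s y)) x 1) ->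
  val (rbar c (rcons s y)) x 1
    = val (rbar g s) x y + (-1) ^+ size s *: val (c s) x y.
Proof.
elim: s g c => [|a s IH] g c gc.
  have -> : rbar c (rcons [::] y) = ract (c [::]) y by rewrite /= subr0.
  by rewrite coind_ractE mulr1 coind0E add0r scale1r.
change (val (rmerge a c (rcons s y) - rbar (after a c) (rcons s y)) x 1 =
  val (rmerge a g s - rbar (after a g) s) x y
    + (-1) ^+ (size s).+1 *: val (c (a :: s)) x y).
rewrite !coindBE (IH (after a g)) => [|s' y']; last by rewrite [LHS]gc.
have -> : val (rmerge a c (rcons s y)) x 1 = val (rmerge a g s) x y.
  by case: s {IH} => [|b s]; rewrite /= gc.
by rewrite opprD addrA exprS mulN1r scaleNr.
Qed.

Lemma mbar_rcons f m a s x y : (forall m, multilin (f m)) ->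
  val (mbar f m (rcons (a :: s) y)) x 1
    = val (mbar (absorbr f) m (a :: s)) x y
      - (-1) ^+ (size s).+1 *: val (f m (a :: s)) x y.
Proof.
move=> fL; rewrite !mbarE coindBE [X in _ = X - _]coindBE.
rewrite (@rbar_rcons (absorbr f m)) => [|s' y'].
  rewrite opprD addrA; congr (_ - _ - _).
  by rewrite [mmerge (absorbr f) _ _]/= absorbrE.
by rewrite absorbrE.
Qed.

Definition only_right f : seq B -> M -> seq A -> CV :=
  fun bs m s => if bs is [::] then f m s else 0.

Lemma absorbr_cochain n h : h \in @bar_cochain k B A M CV n.+1 ->
  only_right (absorbr (h [::])) \in @bar_cochain k B A M CV n.
Proof.
move=> /asboolP[[hb hm ha] hS]; apply/asboolP.
have fL := ha [::]; have fm := hm [::].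
split; last first.
  move=> [|b bs] m s ne //; apply: bilin_ext => x y; rewrite [LHS]absorbrE //.
  by rewrite hS // size_rcons => /= /eq_add_S.
apply/word_multilinP; split=> [[|a s1] s2 u x y m s|[|b bs] u m m' s|
  [|b bs] m s1 s2 u x y]; rewrite ?scaler0 ?addr0 //=.
  apply: bilin_ext => x y; rewrite coindDE !(absorbrE _ _ _ _ fL).
  by rewrite fm coindDE.
apply: bilin_ext => v w; rewrite coindDE !(absorbrE _ _ _ _ fL).
by rewrite !rcons_cat !rcons_cons fL coindDE.
Qed.

Lemma bar_diff_only_right f bs m s :
  (forall b m s, lact b (f m s) = f (lact b m) s) ->
  bar_diff (only_right f) bs m s = only_right (- mbar f) bs m s.
Proof.
move=> fb; rewrite bar_diffE; case: bs => [|b bs].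
  by change (0 - mbar f m s = - mbar f m s); rewrite sub0r.
have -> : lbar (only_right f) (b :: bs) m s = lmerge b (only_right f) bs m s.
  rewrite lbar_cons; have -> : after b (only_right f) = 0 by [].
  by rewrite (linear_is0 (@lbar_lin _ _ _ M CV)) [X in _ - X](_ : _ = 0) ?subr0.
case: bs => [|b' bs].
  by change (lact b (f m s) - f (lact b m) s = 0); rewrite fb subrr.
by change (lact b (0 : CV) - 0 = 0); rewrite linear0 subrr.
Qed.

(** Subtracting the coboundary of [absorbl c] leaves, by the homotopy formula,
    only the exceptional face. *)
Lemma bar_reduce n (c : @bar_space k B A M CV n.+1) : bar_d c = 0 ->
  exists e, forall bs m s x y, val (val (c - bar_d e) bs m s) x y =
    if bs is [::] then val (val c [::] (lact x m) s) 1 y else 0.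
Proof.
move=> c0; have [cL cS] := bar_cochainP c.
have Dc bs m s : bar_diff (val c) bs m s = 0.
  by rewrite -bar_dE c0 bar_cochain0.
exists (Subsp (absorbl_cochain (subsp_valP c))) => bs m s x y.
rewrite bar_cochainB coindBE bar_dE.
have := absorbl_homotopy bs m s x y cL; rewrite Dc coind0E addr0 => ->.
by rewrite opprB addrC subrK.
Qed.

(** Without letters on the left the differential is [- mbar], which [absorbr]
    contracts; the left linearity of [c] passes to the contraction and kills
    its faces on the left. *)
Lemma bar_acyclic_right n (c : @bar_space k B A M CV n.+1) : bar_d c = 0 ->
  (forall b bs m s, val c (b :: bs) m s = 0) ->
  (forall m s x y,
    val (val c [::] m s) x y = val (val c [::] (lact x m) s) 1 y) ->
  exists e, c = bar_d e.
Proof.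
move=> c0 cB cl; have [[_ _ ca] _] := bar_cochainP c.
have fL := ca [::]; set f := val c [::] in fL cl.
have fb b m s : lact b (absorbr f m s) = absorbr f (lact b m) s.
  apply: bilin_ext => x y; rewrite coind_lactE !(absorbrE _ _ _ _ fL).
  by rewrite cl [in RHS]cl lactA.
pose e : @bar_space k B A M CV n := Subsp (absorbr_cochain (subsp_valP c)).
(* The sign is that of the last face in [mbar_rcons], times the sign of [mbar]
   in the differential. *)
exists ((-1) ^+ n *: e); apply: bar_cochain_ext => bs m s sz.
rewrite linearZ bar_cochainZ bar_dE (bar_diff_only_right _ _ _ fb).
apply: bilin_ext => x y; rewrite coindZE.
case: bs sz => [|b bs] sz; last by rewrite cB coind0E scaler0.
case: s sz => [//|a s] [sz].
have := mbar_rcons m a s x y fL.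
have -> : mbar f m (rcons (a :: s) y) = 0.
  have : bar_diff (val c) [::] m (rcons (a :: s) y) = 0.
    by rewrite -bar_dE c0 bar_cochain0.
  by rewrite bar_diffE [lfirst _ _ _ _]/= sub0r => /eqP; rewrite oppr_eq0 => /eqP.
rewrite coind0E => /esym/eqP; rewrite subr_eq0 => /eqP E.
have -> : val (only_right (- mbar (absorbr f)) [::] m (a :: s)) x y =
    - val (mbar (absorbr f) m (a :: s)) x y by [].
rewrite E sz exprS mulN1r scaleNr opprK scalerA -exprMn mulrNN mulr1.
by rewrite expr1n scale1r.
Qed.

Lemma bar_acyclic n (c : @bar_space k B A M CV n.+1) :
  bar_d c = 0 -> exists e, c = bar_d e.
Proof.
move=> c0; have [e ce] := bar_reduce c0.
have [|b bs m s|m s x y|e' ee] := @bar_acyclic_right n (c - bar_d e).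
- by rewrite linearB /= c0 bar_dd subrr.
- by apply: bilin_ext => x y; rewrite ce.
- by rewrite ce [in RHS]ce lact1.
by exists (e + e'); rewrite linearD /= -ee addrC subrK.
Qed.

End BarEfface.

Section BarResolving.
Variables (k : fieldType) (B A : algType k) (M : bimod B A).
Implicit Type N : bimod B A.

Lemma unit_lin N : linear (@coind_unit k B A N).
Proof. by have [uL _ _] := coind_unit_hom N. Qed.
Lemma cosyz_pi_lin N : linear (@cosyz_pi k B A N).
Proof. by have [pL _ _] := cosyz_pi_hom N. Qed.

Arguments unit_lin N : clear implicits.
Arguments cosyz_pi_lin N : clear implicits.

Lemma bar_in_inj N n (c : @bar_space k B A M N n) :
  bar_post (unit_lin N) c = 0 -> c = 0.
Proof.
move=> c0; apply: bar_cochain_ext => bs m s _; apply: coind_unit_inj.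
by rewrite -(bar_postE (unit_lin N)) c0 !bar_cochain0 (linear_is0 (unit_lin N)).
Qed.

Lemma bar_exact N n (c : @bar_space k B A M (coind B A N) n) :
  bar_post (cosyz_pi_lin N) c = 0 <-> exists e, c = bar_post (unit_lin N) e.
Proof.
split=> [c0|[e ->]]; last first.
  apply: bar_cochain_ext => bs m s _; rewrite !bar_postE bar_cochain0.
  by apply/cosyz_pi_eq0; exists (val e bs m s).
have evL : linear (fun x : coind B A N => val x 1 1).
  by move=> u x y; rewrite coindDE.
exists (bar_post evL c); apply: bar_cochain_ext => bs m s _.
rewrite !bar_postE; have [|x ->] := (cosyz_pi_eq0 (val c bs m s)).1.
  by rewrite -(bar_postE (cosyz_pi_lin N)) c0 bar_cochain0.
by rewrite coind_unitK.
Qed.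

Lemma bar_out_surj N n (c : @bar_space k B A M (cosyz N) n) :
  exists e, bar_post (cosyz_pi_lin N) e = c.
Proof.
have [h hL hK] := cosyz_section N.
by exists (bar_post hL c); apply: bar_cochain_ext => bs m s _; rewrite !bar_postE hK.
Qed.

Fact bar_aug_subproof N (u : bihom M N) :
  (fun bs m s => if bs is [::] then if s is [::] then val u m else 0 else 0)
    \in @bar_cochain k B A M N 0.
Proof.
have [uL _ _] := bihomP u.
apply/asboolP; split=> [|[|b bs] m [|a s] //].
apply/word_multilinP; split=> [[|b s1] s2 v x y m s|[|b bs] v m m' [|a s]|
  [|b bs] m [|a s1] s2 v x y]; rewrite ?scaler0 ?addr0 //; exact: uL.
Qed.

Definition bar_aug N (u : bihom M N) : @bar_space k B A M N 0 :=
  Subsp (bar_aug_subproof u).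

Lemma bar_cochain0_ext N (c c' : @bar_space k B A M N 0) :
  (forall m, val c [::] m [::] = val c' [::] m [::]) -> c = c'.
Proof.
by move=> cc; apply: bar_cochain_ext => -[|b bs] m [|a s].
Qed.

Lemma bar_aug_inj N u : @bar_aug N u = 0 -> u = 0.
Proof.
move=> u0; apply: bihom_ext => m.
by have /(congr1 (fun c => val c [::] m [::])) := u0.
Qed.

Lemma bar_diffl1 N (h : seq B -> M -> seq A -> N) b m :
  bar_diff h [:: b] m [::] = lact b (h [::] m [::]) - h [::] (lact b m) [::].
Proof. by rewrite bar_diffE lbar_cons /= mbarE /= subrr subr0. Qed.

Lemma bar_diffr1 N (h : seq B -> M -> seq A -> N) m a :
  bar_diff h [::] m [:: a] = ract (h [::] m [::]) a - h [::] (ract m a) [::].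
Proof. by rewrite bar_diffE /= mbarE /= subr0 sub0r opprB. Qed.

Lemma bar_aug_cocycle N (c : @bar_space k B A M N 0) :
  bar_d c = 0 <-> exists u, c = bar_aug u.
Proof.
split=> [c0|[u ->]]; last first.
  have [_ ul ur] := bihomP u.
  apply: bar_cochain_ext => -[|b [|b' bs]] m [|a [|a' s]] // _;
    rewrite bar_dE bar_cochain0.
    by rewrite bar_diffr1 /= ur subrr.
  by rewrite bar_diffl1 /= ul subrr.
have [[cb cm ca] _] := bar_cochainP c.
have D0 bs m s : bar_diff (val c) bs m s = 0.
  by rewrite -bar_dE c0 bar_cochain0.
have ub : is_bihom (fun m => val c [::] m [::]).
  split=> [v x y|b x|x a]; first by rewrite cm.
    by apply/esym/subr0_eq; rewrite -bar_diffl1.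
  by apply/esym/subr0_eq; rewrite -bar_diffr1.
by exists (mkbihom ub); apply: bar_cochain0_ext.
Qed.

Definition bar_resolving : resolving M.
Proof.
apply: (@Resolving k B A M (bar_complex M)
  (fun N n => @bar_post k B A M _ _ _ (unit_lin N) n)
  (fun N n => @bar_post k B A M _ _ _ (cosyz_pi_lin N) n) bar_aug).
- by move=> N n; apply: bar_post_lin.
- by move=> N n; apply: bar_post_lin.
- by move=> N c u v; apply: bar_cochain0_ext.
- by move=> N n x; apply: bar_post_d; apply: coind_unit_hom.
- by move=> N n x; apply: bar_post_d; apply: cosyz_pi_hom.
- exact: bar_in_inj.
- exact: bar_exact.
- exact: bar_out_surj.
- by move=> N n; apply: bar_acyclic.
- exact: bar_aug_inj.
- exact: bar_aug_cocycle.
by move=> N u; apply: bar_cochain0_ext.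
Defined.

Theorem cohomology_bar (P : proj_resolution M) N (s : int) :
  liso (cohomology (bar_complex M N) s) (Ext P N s).
Proof. exact: (cohomology_resolving bar_resolving (hom_resolving P)). Qed.

End BarResolving.

(** * The relative Hochschild complex on words *)

Section HochschildWords.
Variables (k : fieldType) (T : algType k) (X : bimod T T).

Definition tup l (s : seq T) : 'I_l -> T := fun j => nth 0 s j.

(** Extended by zero to words of other lengths, because members of
    [bar_cochain] are functions of words of all lengths. *)
Definition on_words l (f : ('I_l -> T) -> X) (s : seq T) : X :=
  if size s == l then f (tup s) else 0.

Lemma on_wordsE l (f : ('I_l -> T) -> X) s : size s = l ->
  on_words f s = f (tup s).
Proof. by rewrite /on_words => ->; rewrite eqxx. Qed.

Lemma on_words_multilin l (f : ('I_l -> T) -> X) :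
  multilinear f -> multilin (on_words f).
Proof.
move=> /multilinearP fL s1 s2 u x y; rewrite /on_words !size_cat /=.
case: eqP => [sz|_]; last by rewrite scaler0 addr0.
have pl : (size s1 < l)%N by rewrite -sz addnS ltnS leq_addr.
apply: (fL (Ordinal pl)); split=> [|j]; first by rewrite /tup !nth_cat ltnn subnn.
rewrite -val_eqE /= /tup !nth_cat; case: ltngtP => // jp _.
by rewrite -(subnSK jp).
Qed.

Fixpoint rface i (c : seq T -> X) (s : seq T) : X :=
  if s is x :: s' then
    if i is j.+1 then rface j (after x c) s' else rmerge x c s'
  else 0.

Lemma rbar_rface (c : seq T -> X) s :
  rbar c s = \sum_(i < size s) (-1) ^+ i *: rface i c s.
Proof.
elim: s c => [|x s IH] c; first by rewrite big_ord0.
rewrite /= big_ord_recl expr0 scale1r IH -sumrN; congr (_ + _).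
by apply: eq_bigr => i _; rewrite exprS mulN1r scaleNr.
Qed.

Lemma rfaceE i c s : (i < size s)%N -> rface i c s =
  if i.+1 == size s then ract (c (take i s)) (nth 0 s i)
  else c (take i s ++ nth 0 s i * nth 0 s i.+1 :: drop i.+2 s).
Proof.
elim: s i c => [|x s IH] [|i] c //= si; last by rewrite IH.
by case: s {IH si} => [|y s] //=; rewrite drop0.
Qed.

Lemma hface_rface l i (f : ('I_l -> T) -> X) s : size s = l.+1 -> (i < l.+1)%N ->
  hface i.+1 f (tup s) = rface i (on_words f) s.
Proof.
move=> sz il; rewrite rfaceE sz // /hface /= eqSS.
have [il1|il1] := eqVneq i l.
  rewrite on_wordsE ?size_takel ?sz // ?il1 //.
  congr (ract (f _) _); apply/funext => j; rewrite /contract ltnS ltn_ord.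
  by rewrite /tup nth_take.
have {}il1 : (i < l)%N by rewrite ltn_neqAle il1 -ltnS.
have st : size (take i s) = i by rewrite size_takel // sz ltnW // ltnW.
rewrite on_wordsE; last by rewrite size_cat /= size_drop st sz; lia.
congr f; apply/funext => j; rewrite /contract /tup /= nth_cat st ltnS eqSS.
case: ltngtP => ji; first by rewrite nth_take.
  rewrite -(subnSK ji) /= nth_drop /bump /= add1n; congr nth.
  by lia.
by rewrite ji subnn.
Qed.

(** Letting the last letter act on the value is the last face of [rbar] too, so
    only the face on the left is added. *)
Lemma hdiff_words l (f : ('I_l -> T) -> X) x s : size s = l ->
  hdiff f (tup (x :: s)) = lact x (on_words f s) - rbar (on_words f) (x :: s).
Proof.
move=> sz; rewrite /hdiff big_ord_recl expr0 scale1r rbar_rface -sumrN.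
congr (_ + _).
  by rewrite /hface /= on_wordsE //; congr (lact _ (f _)); apply/funext.
rewrite /= sz; apply: eq_bigr => i _; rewrite exprS mulN1r scaleNr.
by rewrite hface_rface //= sz.
Qed.

End HochschildWords.

Section Balanced.
Variables (k : fieldType) (T : algType k) (X : bimod T T).
Variables (N : nat) (e : 'I_N -> T).

Lemma vertex_in_R i : in_R e (e i).
Proof.
exists (fun j => (j == i)%:R); rewrite (bigD1 i) //= eqxx scale1r big1 ?addr0 //.
by move=> j /negPf->; rewrite scale0r.
Qed.

Lemma balanced_first l (f : ('I_l.+1 -> T) -> X) r t :
  balanced e f -> in_R e r -> r * t ord0 = t ord0 -> lact r (f t) = f t.
Proof.
move=> fb rR rt; have := fb 0%N r t (leq0n _) rR.
rewrite /gapl /gapr /= => ->; congr f; apply/funext => j; rewrite /mull_gap.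
by case: eqP => // j0; have -> : j = ord0 by apply: val_inj.
Qed.

Lemma balanced_last l (f : ('I_l.+1 -> T) -> X) r t :
  balanced e f -> in_R e r -> t ord_max * r = t ord_max -> ract (f t) r = f t.
Proof.
move=> fb rR rt; have := fb l.+1 r t (leqnn _) rR.
rewrite /gapl /gapr eqxx /= => <-; congr f; apply/funext => j; rewrite /mulr_gap.
by case: eqP => // - [jl]; have -> : j = ord_max by apply: val_inj.
Qed.

Lemma hochP l (f : subsp (@hoch k T X N e l)) :
  multilinear (val f) /\ balanced e (val f).
Proof. exact/asboolP/(subsp_valP f). Qed.

(** The trajectory constant at $e_i$ has length 0, and $e_i$ fixes the value
    because [f] is balanced. *)
Lemma hochF1_corner l (f : subsp (@hoch k T X N e l.+1)) i t :
  f \in @hochF k T X N e 1 l.+1 ->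
  (forall m, e i * t m = t m /\ t m * e i = t m) -> val f t = 0.
Proof.
move=> /asboolP fF tc; have [_ fb] := hochP f.
rewrite -(balanced_first fb (vertex_in_R i)); last by have [] := tc ord0.
apply: (fF (fun _ => i)) => //.
by rewrite /traj_length big1 // => m _; rewrite eqxx.
Qed.

Lemma traj_length0 l (v : 'I_l.+1 -> 'I_N) : (traj_length v < 1)%N ->
  forall m, v m = v ord0.
Proof.
rewrite ltnS leqn0 /traj_length sum_nat_eq0 => /forallP h m.
rewrite -[m]inord_val; have := ltn_ord m; elim: (nat_of_ord m) => [|n IH] nl.
  by congr v; apply: val_inj; rewrite /= inordK.
have nl' : (n < l)%N by [].
have := h (Ordinal nl'); rewrite implyTb eqb0 negbK => /eqP.
by rewrite lift0_inord widen_inord => ->; apply: IH; apply: ltnW.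
Qed.

Lemma traj_length1 l (v : 'I_l.+1 -> 'I_N) : traj_length v = 1%N ->
  exists q : 'I_l, [/\ forall m : 'I_l.+1, (m <= q)%N -> v m = v ord0,
    forall m : 'I_l.+1, (q < m)%N -> v m = v ord_max & v ord_max != v ord0].
Proof.
rewrite /traj_length => h1.
have [q _ vq] : exists2 q : 'I_l, true & v (lift ord0 q) != v (widen_ord (leqnSn l) q).
  apply/exists_inP; apply: contraTT (isT) => /exists_inPn h; exfalso.
  move: h1; rewrite big1 // => m _; have := h m isT.
  by rewrite negbK => /eqP->; rewrite eqxx.
move: h1; rewrite (bigD1 q) //= vq add1n => - [] /eqP.
rewrite sum_nat_eq0 => /forallP h.
have st n : (n < l)%N -> n != q -> v (inord n.+1) = v (inord n).
  move=> nl nq; have := h (Ordinal nl); rewrite -val_eqE /= nq implyTb eqb0 negbK.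
  by rewrite lift0_inord widen_inord => /eqP.
have low n : (n <= q)%N -> v (inord n) = v ord0.
  elim: n => [|n IH] nq; first by congr v; apply: val_inj; rewrite /= inordK.
  have ql := ltn_ord q; rewrite st; [by apply: IH; lia | by lia | by lia].
have high n : (q < n)%N -> (n <= l)%N -> v (inord n) = v ord_max.
  move=> qn; move: {2}(l - n)%N (erefl (l - n)%N) => d; elim: d n qn => [|d IH] n qn.
    move=> d0 nl; congr v; apply: val_inj; rewrite /= inordK //; lia.
  by move=> dn nl; rewrite -st; [apply: IH; lia | lia | lia].
exists q; split=> [m mq|m qm|].
- by rewrite -[m]inord_val low.
- by rewrite -[m]inord_val high // -ltnS.
by move: vq; rewrite lift0_inord widen_inord (low q) // (high q.+1).
Qed.

End Balanced.

(** * The part of the first column carried by one arrow *)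

Lemma mkseq_split (E : Type) (F : nat -> E) p n : (p < n)%N ->
  mkseq F n = mkseq F p ++ F p :: mkseq (fun i => F (p.+1 + i)%N) (n - p.+1).
Proof.
move=> pn; rewrite /mkseq -{1}(subnKC pn) addSnnS iotaD map_cat /= add0n.
by congr (_ ++ _ :: _); rewrite -[p.+1]addn0 iotaDl -map_comp addn0.
Qed.

Lemma eq_mkseq_lt (E : Type) (F G : nat -> E) n :
  (forall i, (i < n)%N -> F i = G i) -> mkseq F n = mkseq G n.
Proof. by move=> FG; apply/eq_in_map => i; rewrite mem_iota => /FG. Qed.

Lemma multilin_mkseq (k : fieldType) (E W : lmodType k) (c : seq E -> W)
    (F F1 F2 : nat -> E) n p u : multilin c -> (p < n)%N ->
  F p = u *: F1 p + F2 p ->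
  (forall i, (i < n)%N -> i != p -> F1 i = F i /\ F2 i = F i) ->
  c (mkseq F n) = u *: c (mkseq F1 n) + c (mkseq F2 n).
Proof.
move=> cL pn Fp Fi; rewrite !(mkseq_split _ pn) Fp cL.
have E1 : mkseq F1 p = mkseq F p /\ mkseq F2 p = mkseq F p.
  by split; apply: eq_mkseq_lt => i ip; have [] := Fi i; lia || by [].
have E2 : mkseq (fun i => F1 (p.+1 + i)%N) (n - p.+1)
            = mkseq (fun i => F (p.+1 + i)%N) (n - p.+1) /\
          mkseq (fun i => F2 (p.+1 + i)%N) (n - p.+1)
            = mkseq (fun i => F (p.+1 + i)%N) (n - p.+1).
  by split; apply: eq_mkseq_lt => i ip; have [] := Fi (p.+1 + i)%N; lia || by [].
by have [-> ->] := E1; have [-> ->] := E2.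
Qed.

(** An arrow of the quiver of [T], with its bimodule [M] and the algebras [B],
    [A] at its ends: [M] is the corner $e_{tgt}Te_{src}$, and [B], [A] are the
    corners at the two vertices. *)
Record arrow (k : fieldType) (T : algType k) (n : nat) (e : 'I_n -> T)
    (B A : algType k) (M : bimod B A) := Arrow {
  src : 'I_n; tgt : 'I_n;
  jB : nuhom B T; jA : nuhom A T; jM : M -> T;
  pB : T -> B; pA : T -> A; pM : T -> M;
  src_lt_tgt : (src < tgt)%N;
  jM_lin : linear jM;
  pB_lin : linear pB; pA_lin : linear pA; pM_lin : linear pM;
  jB1 : jB 1 = e tgt; jA1 : jA 1 = e src;
  jBM : forall b m, jB b * jM m = jM (lact b m);
  jMA : forall m a, jM m * jA a = jM (ract m a);
  jpB : forall t, jB (pB t) = e tgt * t * e tgt;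
  jpA : forall t, jA (pA t) = e src * t * e src;
  jpM : forall t, jM (pM t) = e tgt * t * e src;
  pjB : forall b, pB (jB b) = b;
  pjA : forall a, pA (jA a) = a;
  pjM : forall m, pM (jM m) = m
}.

Section ArrowPart.
Variables (k : fieldType) (T : algType k) (n : nat) (e : 'I_n -> T).
Hypothesis e_orth : forall i j, e i * e j = if i == j then e i else 0.
Variables (B A : algType k) (M : bimod B A) (g : arrow e M).
Variable X : bimod T T.

Local Notation s0 := (src g).
Local Notation t0 := (tgt g).
Local Notation XM := (peirce (jB g) (jA g) X).

Lemma vertex_idem i : e i * e i = e i.
Proof. by rewrite e_orth eqxx. Qed.

Lemma src_neq_tgt : s0 != t0.
Proof. by rewrite -val_eqE /= ltn_eqF // (src_lt_tgt g). Qed.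

Lemma jB_corner b : e t0 * jB g b = jB g b /\ jB g b * e t0 = jB g b.
Proof. by rewrite -jB1 -!nuhomM mul1r mulr1. Qed.
Lemma jA_corner a : e s0 * jA g a = jA g a /\ jA g a * e s0 = jA g a.
Proof. by rewrite -jA1 -!nuhomM mul1r mulr1. Qed.
Lemma jM_corner m : e t0 * jM g m = jM g m /\ jM g m * e s0 = jM g m.
Proof. by rewrite -jB1 -jA1 jBM jMA lact1 ract1. Qed.

Lemma pM_corner i j t : e i * t = t -> t * e j = t ->
  (i != t0) || (j != s0) -> pM g t = 0.
Proof.
move=> it tj ij; rewrite -[LHS](pjM g) jpM -it -tj !mulrA e_orth -!mulrA e_orth.
rewrite -[RHS](linear_is0 (pM_lin g)); congr pM.
case/orP: ij => [i0|j0]; first by rewrite eq_sym (negPf i0) mul0r.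
by rewrite (negPf j0) !mulr0.
Qed.

(** ** Restriction of cochains to the arrow *)

Definition word (bs : seq B) (m : M) (s : seq A) : seq T :=
  map (jB g) bs ++ jM g m :: map (jA g) s.

Lemma size_word bs m s : size (word bs m s) = (size bs + size s).+1.
Proof. by rewrite size_cat /= !size_map addnS. Qed.

Lemma word_letter bs m s t : t \in word bs m s ->
  exists i j, [/\ e i * t = t, t * e j = t
    & (i, j) \in [:: (t0, t0); (t0, s0); (s0, s0)]].
Proof.
rewrite mem_cat inE => /orP[/mapP[b _ ->]|/orP[/eqP->|/mapP[a _ ->]]].
- by exists t0, t0; rewrite !inE eqxx; have [] := jB_corner b.
- by exists t0, s0; rewrite !inE eqxx orbT; have [] := jM_corner m.
by exists s0, s0; rewrite !inE eqxx !orbT; have [] := jA_corner a.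
Qed.

Lemma nth_word bs m s i :
  nth 0 (word bs m s) i =
    if (i < size bs)%N then jB g (nth 0 bs i)
    else if i == size bs then jM g m
    else if (i < (size bs + size s).+1)%N then jA g (nth 0 s (i - (size bs).+1))
    else 0.
Proof.
rewrite nth_cat size_map; case: ltngtP => h.
- by rewrite (nth_map 0).
- rewrite -(subnSK h) /=; case: ifP => h'; first by rewrite (nth_map 0) // ltn_subLR.
  by rewrite nth_default // size_map leq_subRL // addSn leqNgt h'.
by rewrite h subnn.
Qed.

Section Restrict.
Variables (l : nat) (f : subsp (@hoch k T X n e l.+1)).

Fact restrict_peirce bs m s :
  on_words (val f) (word bs m s) \in peirce_pred (jB g) (jA g) (X := X).
Proof.
have [_ fb] := hochP f.
rewrite /on_words; case: eqP => [sz|_]; last exact: rpred0.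
apply/eqP; rewrite jB1 jA1.
rewrite (balanced_first fb (vertex_in_R e t0)); last first.
  rewrite /tup /word; case: bs {sz} => [|b bs] /=; first by case: (jM_corner m).
  by case: (jB_corner b).
rewrite (balanced_last fb (vertex_in_R e s0)) //.
rewrite /tup nth_word /=; move: sz; rewrite size_word => -[<-].
rewrite ltnNge leq_addr /= ltnSn; case: eqP => _; last first.
  by have [] := jA_corner (nth 0 s (size bs + size s - (size bs).+1)).
by have [] := jM_corner m.
Qed.

Definition restrict_fun bs m s : XM := Subsp (restrict_peirce bs m s).

Fact restrict_cochain : restrict_fun \in @bar_cochain k B A M XM l.
Proof.
have [/on_words_multilin fL _] := hochP f.
apply/asboolP; split; last first.
  move=> bs m s ne; apply: val_inj => /=; rewrite /on_words.
  by case: eqP => //; rewrite size_word => - [/ne].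
apply/word_multilinP; split=> *; apply: val_inj;
  rewrite linearP /= /word ?map_cat /= ?nuhom_linear ?jM_lin ?fL //.
- by rewrite -!catA !cat_cons fL.
by rewrite -!cat_cons !catA fL.
Qed.

Definition restrict : @bar_space k B A M XM l := Subsp restrict_cochain.

Lemma restrictE bs m s :
  val (val restrict bs m s) = on_words (val f) (word bs m s).
Proof. by []. Qed.

End Restrict.

Lemma rbar_words (h : seq T -> X) (c : seq A -> XM) s :
  (forall s, val (c s) = h (map (jA g) s)) ->
  rbar h (map (jA g) s) = val (rbar c s).
Proof.
elim: s h c => [|a s IH] h c hc //.
change (rmerge (jA g a) h (map (jA g) s) - rbar (after (jA g a) h) (map (jA g) s)
  = val (rmerge a c s) - val (rbar (after a c) s)).
rewrite (IH _ (after a c)) => [|s']; last exact: (hc (a :: s')).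
congr (_ - _); case: s {IH} => [|b s]; last by rewrite [RHS]hc /= nuhomM.
by change (ract (h [::]) (jA g a) = ract (val (c [::])) (jA g a)); rewrite hc.
Qed.

Lemma rbar_word (h : seq T -> X) (c : seq B -> M -> seq A -> XM) bs m s :
  (forall bs m s, val (c bs m s) = h (word bs m s)) ->
  (forall bs m, ract (h (map (jB g) bs)) (jM g m) = 0) ->
  rbar h (word bs m s) = val (lbar c bs m s).
Proof.
elim: bs h c => [|b bs IH] h c hc h0.
  change (rmerge (jM g m) h (map (jA g) s)
      - rbar (after (jM g m) h) (map (jA g) s)
    = val (mmerge (c [::]) m s) - val (rbar (c [::] m) s)).
  rewrite (@rbar_words _ (c [::] m)); last by move=> s'; rewrite hc.
  congr (_ - _); case: s => [|a s]; first exact: (h0 [::] m).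
  by rewrite [RHS]hc /word /= jMA.
change (rmerge (jB g b) h (word bs m s) - rbar (after (jB g b) h) (word bs m s)
  = val (lmerge b c bs m s) - val (lbar (after b c) bs m s)).
rewrite (IH _ (after b c)) => [|bs' m' s'|bs' m'].
- by congr (_ - _); case: bs {IH} => [|b' bs] /=; rewrite hc /word /= ?jBM ?nuhomM.
- exact: (hc (b :: bs')).
exact: (h0 (b :: bs')).
Qed.

Lemma hochF1_map (C : eqType) (j : C -> T) i cs l
    (f : subsp (@hoch k T X n e l.+1)) :
  (forall c, e i * j c = j c /\ j c * e i = j c) ->
  f \in @hochF k T X n e 1 l.+1 -> on_words (val f) (map j cs) = 0.
Proof.
move=> jc f1; rewrite /on_words; case: eqP => // sz.
apply: (hochF1_corner (i := i) f1) => m.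
have /mapP[c _ E] : nth 0 (map j cs) m \in map j cs by rewrite mem_nth ?sz.
by rewrite /tup E.
Qed.

(** Faces of the Hochschild complex on a word of the arrow are faces of the bar
    complex, except for an outer face that splits off the letter in [M]: it
    leaves a word inside one corner, on which members of $F^1$ vanish. *)
Lemma restrict_d l (f : subsp (@hoch k T X n e l.+1)) :
  f \in @hochF k T X n e 1 l.+1 -> restrict (hoch_d f) = bar_d (restrict f).
Proof.
move=> f1; apply: bar_cochain_ext => bs m s sz; apply: val_inj.
have fB bs' : on_words (val f) (map (jB g) bs') = 0.
  exact: hochF1_map jB_corner f1.
have fA s' : on_words (val f) (map (jA g) s') = 0.
  exact: hochF1_map jA_corner f1.
rewrite restrictE bar_dE bar_diffE on_wordsE ?size_word ?sz //.
change (hdiff (val f) (tup (word bs m s)) =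
  val (lfirst (val (restrict f)) bs m s) - val (lbar (val (restrict f)) bs m s)).
rewrite -(@rbar_word (on_words (val f)) (val (restrict f))) => [|//|bs' m'];
  last by rewrite fB ract0l.
case: bs sz => [|b bs] sz; rewrite [word _ _ _]/= hdiff_words ?size_map //.
  by rewrite fA linear0.
by rewrite size_cat /= !size_map addnS -sz.
Qed.

(** ** Extension of bar cochains to the algebra *)

Section Extend.
Variables (l : nat) (c : @bar_space k B A M XM l).
Implicit Types (t : 'I_l.+1 -> T) (q : 'I_l.+1).

Definition left_part q t := mkseq (fun i => pB g (t (inord i))) q.
Definition right_part q t :=
  mkseq (fun i => pA g (t (inord (q.+1 + i)))) (l - q).

(** The contribution of the trajectories whose non-trivial path is the [q]-th:
    [c] is applied to the Peirce components of the arguments. *)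
Definition extend_at q t : XM :=
  val c (left_part q t) (pM g (t q)) (right_part q t).

Definition extend_fun t : X := \sum_q val (extend_at q t).

Lemma extend_at_lin q (p : 'I_l.+1) u t t1 t2 :
  (forall j, j != p -> t1 j = t j /\ t2 j = t j) ->
  ((p < q)%N -> pB g (t p) = u *: pB g (t1 p) + pB g (t2 p)) ->
  (p = q -> pM g (t p) = u *: pM g (t1 p) + pM g (t2 p)) ->
  ((q < p)%N -> pA g (t p) = u *: pA g (t1 p) + pA g (t2 p)) ->
  extend_at q t = u *: extend_at q t1 + extend_at q t2.
Proof.
move=> tj tB tM tA; have [[cb cm ca] _] := bar_cochainP c.
have ql := ltn_ord q; have pl := ltn_ord p.
have tjn i : (i < l.+1)%N -> i != p ->
    t1 (inord i) = t (inord i) /\ t2 (inord i) = t (inord i).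
  by move=> il ip; apply: tj; rewrite -val_eqE /= inordK.
have sameB : (q <= p)%N ->
    left_part q t1 = left_part q t /\ left_part q t2 = left_part q t.
  move=> qp; split; apply: eq_mkseq_lt => i iq; congr (pB g _);
    by have [|/=|] := tjn i; rewrite ?ltn_eqF ?(leq_trans iq) // ltnW.
have sameA : (p <= q)%N ->
    right_part q t1 = right_part q t /\ right_part q t2 = right_part q t.
  move=> pq; split; apply: eq_mkseq_lt => i iq; congr (pA g _);
    have [|/=|] := tjn (q.+1 + i)%N; rewrite ?gtn_eqF ?ltn_addr ?ltnS //;
    by rewrite -ltn_subRL.
rewrite /extend_at; case: (ltngtP p q) => [pq|qp|/val_inj pq].
- have qp : q != p by rewrite -val_eqE /= gtn_eqF.
  have [-> ->] := sameA (ltnW pq); have [-> ->] := tj q qp.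
  rewrite /left_part.
  rewrite (@multilin_mkseq _ _ _ (val c) _ (fun i => pB g (t1 (inord i)))
    (fun i => pB g (t2 (inord i))) q p u cb pq) //=.
    by rewrite inord_val tB.
  by move=> i iq ip; have [|//|-> ->] := tjn i; first exact: leq_trans iq (ltnW ql).
- have qp' : q != p by rewrite -val_eqE /= ltn_eqF.
  have [-> ->] := sameB (ltnW qp); have [-> ->] := tj q qp'.
  have E : (q.+1 + (p - q.+1))%N = p by rewrite subnKC.
  rewrite /right_part.
  rewrite (@multilin_mkseq _ _ _ (val c _ _) _ (fun i => pA g (t1 (inord (q.+1 + i))))
    (fun i => pA g (t2 (inord (q.+1 + i)))) (l - q) (p - q.+1) u (ca _ _)) //=.
  + by rewrite ltn_subLR // addSn subnKC.
  + by rewrite E inord_val tA.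
  move=> i iq ip; have [||-> ->] := tjn (q.+1 + i)%N => //.
    by rewrite addSn ltnS -ltn_subRL.
  by apply: contraNneq ip => <-; rewrite addKn.
have pq' : (p <= q)%N by rewrite pq.
have qp' : (q <= p)%N by rewrite pq.
have [-> ->] := sameA pq'; have [-> ->] := sameB qp'.
by rewrite -pq tM // cm.
Qed.

Lemma extend_at_eq0 q t (p : 'I_l.+1) :
  ((p < q)%N -> pB g (t p) = 0) -> (p = q -> pM g (t p) = 0) ->
  ((q < p)%N -> pA g (t p) = 0) -> extend_at q t = 0.
Proof.
move=> tB tM tA; rewrite (@extend_at_lin q p (-1) t t t) ?scaleN1r ?addNr //;
  by move=> h; rewrite scaleN1r addNr; first [exact: tB | exact: tM | exact: tA].
Qed.

Lemma extend_at_scale q (p : 'I_l.+1) u t t' :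
  (forall j, j != p -> t' j = t j) ->
  ((p < q)%N -> pB g (t' p) = u *: pB g (t p)) ->
  (p = q -> pM g (t' p) = u *: pM g (t p)) ->
  ((q < p)%N -> pA g (t' p) = u *: pA g (t p)) ->
  extend_at q t' = u *: extend_at q t.
Proof.
move=> tj tB tM tA; pose t2 j := if j == p then 0 else t j.
have [pB0 pA0 pM0] : [/\ pB g 0 = 0, pA g 0 = 0 & pM g 0 = 0].
  by split; apply: linear_is0; [apply: pB_lin|apply: pA_lin|apply: pM_lin].
have t2p : t2 p = 0 by rewrite /t2 eqxx.
rewrite (@extend_at_lin q p u t' t t2).
- rewrite (@extend_at_eq0 q t2 p) ?addr0 // => _; rewrite t2p //.
- by move=> j jp; rewrite tj // /t2 (negPf jp).
- by move=> /tB->; rewrite t2p pB0 addr0.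
- by move=> /tM->; rewrite t2p pM0 addr0.
by move=> /tA->; rewrite t2p pA0 addr0.
Qed.

Lemma extend_multilinear : multilinear extend_fun.
Proof.
apply/multilinearP => p u t t1 t2 [tp tj].
rewrite /extend_fun scaler_sumr -big_split; apply: eq_bigr => q _ /=.
rewrite (@extend_at_lin q p u t t1 t2) // tp;
  by move=> _; first [exact: pB_lin | exact: pM_lin | exact: pA_lin].
Qed.

Lemma in_R_scalar r : in_R e r ->
  exists x, forall j, e j * r = x j *: e j /\ r * e j = x j *: e j.
Proof.
move=> [x ->]; exists x => j; split.
  rewrite mulr_sumr (bigD1 j) //= big1 => [|i ij].
    by rewrite -scalerAr vertex_idem addr0.
  by rewrite -scalerAr e_orth eq_sym (negPf ij) scaler0.
rewrite mulr_suml (bigD1 j) //= big1 => [|i ij].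
  by rewrite -scalerAl vertex_idem addr0.
by rewrite -scalerAl e_orth (negPf ij) scaler0.
Qed.

(** The subalgebra [R] acts by one scalar at each end of the arrow, so moving
    an element of [R] across any gap of a word multiplies by the same scalar on
    both sides. *)
Lemma extend_balanced : balanced e extend_fun.
Proof.
move=> p r t pl /in_R_scalar[x xE].
have [et et'] := xE t0; have [es es'] := xE s0.
have pBl y : pB g (r * y) = x t0 *: pB g y.
  by rewrite -[LHS](pjB g) jpB mulrA et -!scalerAl (linear_isZ _ (pB_lin g)) -jpB pjB.
have pBr y : pB g (y * r) = x t0 *: pB g y.
  rewrite -[LHS](pjB g) jpB -!mulrA et' -!scalerAr (linear_isZ _ (pB_lin g)) mulrA.
  by rewrite -jpB pjB.
have pAl y : pA g (r * y) = x s0 *: pA g y.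
  by rewrite -[LHS](pjA g) jpA mulrA es -!scalerAl (linear_isZ _ (pA_lin g)) -jpA pjA.
have pAr y : pA g (y * r) = x s0 *: pA g y.
  rewrite -[LHS](pjA g) jpA -!mulrA es' -!scalerAr (linear_isZ _ (pA_lin g)) mulrA.
  by rewrite -jpA pjA.
have pMl y : pM g (r * y) = x t0 *: pM g y.
  by rewrite -[LHS](pjM g) jpM mulrA et -!scalerAl (linear_isZ _ (pM_lin g)) -jpM pjM.
have pMr y : pM g (y * r) = x s0 *: pM g y.
  rewrite -[LHS](pjM g) jpM -!mulrA es' -!scalerAr (linear_isZ _ (pM_lin g)) mulrA.
  by rewrite -jpM pjM.
have rl (y : XM) : lact r (val y) = x t0 *: val y.
  have [yl _] := peirce_id y; rewrite jB1 in yl.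
  by rewrite -{1}yl -lactA et' lactZl yl.
have rr (y : XM) : ract (val y) r = x s0 *: val y.
  have [_ yr] := peirce_id y; rewrite jA1 in yr.
  by rewrite -{1}yr -ractA es linearZ /= yr.
pose z q := (if (p <= q)%N then x t0 else x s0) *: val (extend_at q t).
transitivity (\sum_q z q).
  rewrite /gapl; have [p0|p0] := eqVneq p 0%N.
    rewrite /extend_fun linear_sum; apply: eq_bigr => q _.
    by rewrite /z p0; apply: rl.
  have pl' : (p.-1 < l.+1)%N by lia.
  apply: eq_bigr => q _; rewrite (@extend_at_scale q (Ordinal pl')
    (if (p <= q)%N then x t0 else x s0) t) //.
  - move=> j; rewrite -val_eqE /= => jp; rewrite /mulr_gap.
    by case: eqP => // jp1; move: jp; rewrite -jp1 eqxx.
  - by rewrite /mulr_gap /= prednK ?lt0n // eqxx pBr => pq; rewrite pq.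
  - move=> pq; rewrite /mulr_gap /= prednK ?lt0n // eqxx pMr -pq /=.
    by have -> : (p <= p.-1)%N = false by lia.
  rewrite /mulr_gap /= prednK ?lt0n // eqxx pAr => qp.
  by have -> : (p <= q)%N = false by lia.
rewrite /gapr; have [pl1|pl1] := eqVneq p l.+1.
  have -> : ract (extend_fun t) r = \sum_q ract (val (extend_at q t)) r.
    exact: (raddf_sum (mklin (@ract_linearl k T T X r))).
  apply: eq_bigr => q _.
  by rewrite /z pl1 leqNgt ltn_ord; apply: esym; apply: rr.
have pl' : (p < l.+1)%N by rewrite ltn_neqAle pl1.
apply: eq_bigr => q _; apply: esym.
rewrite (@extend_at_scale q (Ordinal pl') (if (p <= q)%N then x t0 else x s0) t) //.
- by move=> j; rewrite -val_eqE /= /mull_gap => /negPf->.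
- by rewrite /mull_gap /= eqxx pBl => pq; rewrite ltnW.
- by move=> pq; rewrite /mull_gap /= eqxx pMl -pq leqnn.
by rewrite /mull_gap /= eqxx pAl => qp; rewrite leqNgt qp.
Qed.

Definition extend : subsp (@hoch k T X n e l.+1) :=
  @Subsp _ _ (@hoch k T X n e l.+1) extend_fun
    (introT (asboolP _) (conj extend_multilinear extend_balanced)).

Lemma extend_eq0 t : (forall q, pM g (t q) = 0) -> val extend t = 0.
Proof.
move=> t0; apply: big1 => q _; rewrite (@extend_at_eq0 q t q) ?ltnn //.
Qed.

(** A word inside one corner has no component in [M]. *)
Lemma extend_hochF1 : extend \in @hochF k T X n e 1 l.+1.
Proof.
apply/asboolP => v t _ /traj_length0 v0 tv.
rewrite extend_eq0 ?linear0 // => q; have [tl tr] := tv q.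
rewrite !v0 in tl tr; apply: pM_corner tl tr _.
by case: (eqVneq (v ord0) t0) => //= ->; rewrite eq_sym src_neq_tgt.
Qed.

Lemma restrict_extend : restrict extend = c.
Proof.
apply: bar_cochain_ext => bs m s sz; apply: val_inj.
have szw : size (word bs m s) = l.+1 by rewrite size_word sz.
rewrite restrictE on_wordsE //.
have bl : (size bs < l.+1)%N by rewrite ltnS -sz leq_addr.
have tE i : (i < l.+1)%N -> tup (word bs m s) (inord i : 'I_l.+1) = nth 0 (word bs m s) i.
  by move=> il; rewrite /tup inordK.
rewrite [LHS](bigD1 (Ordinal bl)) //= big1 => [|q qb].
  rewrite addr0; congr (val _); rewrite /extend_at.
  have -> : pM g (tup (word bs m s) (Ordinal bl)) = m.
    by rewrite /tup nth_word /= ltnn eqxx pjM.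
  have -> : left_part (Ordinal bl) (tup (word bs m s)) = bs.
    rewrite -[RHS](mkseq_nth 0); apply: eq_mkseq_lt => i ib.
    by rewrite tE ?nth_word ?ib ?pjB // (leq_trans ib) // ltnW.
  have -> : right_part (Ordinal bl) (tup (word bs m s)) = s.
    have sl : (l - size bs)%N = size s by rewrite -sz addKn.
    rewrite -[RHS](mkseq_nth 0) /right_part /= sl.
    apply: eq_mkseq_lt => i si; rewrite tE; last by rewrite addSn ltnS -sz ltn_add2l.
    rewrite nth_word ltnNge addSnnS leq_addr /= -addSnnS.
    by rewrite gtn_eqF ?leq_addr // addSn ltnS ltn_add2l si -addSn addKn pjA.
  by [].
rewrite (@extend_at_eq0 q _ q) ?ltnn // => _.
have {}qb : q != size bs :> nat by [].
rewrite /tup nth_word (negPf qb); case: ifP => _.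
  have [bl' br'] := jB_corner (nth 0 bs q).
  by apply: pM_corner bl' br' _; rewrite eqxx eq_sym src_neq_tgt.
case: ifP => _; last exact: linear_is0 (pM_lin g).
have [al ar] := jA_corner (nth 0 s (q - (size bs).+1)).
by apply: pM_corner al ar _; rewrite src_neq_tgt.
Qed.

End Extend.

Lemma restrict_linear l u (f f' : subsp (@hoch k T X n e l.+1)) :
  restrict (u *: f + f') = u *: restrict f + restrict f'.
Proof.
apply: bar_cochain_ext => bs m s sz; apply: val_inj.
rewrite bar_cochainD; change (on_words (val (u *: f + f')) (word bs m s) =
  u *: on_words (val f) (word bs m s) + on_words (val f') (word bs m s)).
by rewrite !on_wordsE ?size_word ?sz.
Qed.

(** ** Cochains that restrict to zero *)

Lemma restrict_hochF2 l (f : subsp (@hoch k T X n e l.+1)) :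
  f \in @hochF k T X n e 2 l.+1 -> restrict f = 0.
Proof.
move=> /asboolP fF; apply: bar_cochain_ext => bs m s sz; apply: val_inj.
rewrite bar_cochain0 linear0; have [<- _] := peirce_id (val (restrict f) bs m s).
rewrite restrictE jB1 on_wordsE ?size_word ?sz //.
have bl : (size bs < l.+1)%N by rewrite ltnS -sz leq_addr.
pose v (i : 'I_l.+2) := if (i <= size bs)%N then t0 else s0.
apply: (fF v) => [i||i].
- rewrite /v /= /bump /= add1n; case: ltnP => ib; first by rewrite (ltnW ib).
  by case: ifP => _ //; apply: ltnW; apply: src_lt_tgt.
- rewrite /traj_length (bigD1 (Ordinal bl)) //= big1 => [|i ib].
    by rewrite addn0 ltnS leq_b1.
  have {}ib : i != size bs :> nat by [].
  rewrite /v /= /bump /= add1n [(i <= _)%N]leq_eqVlt (negPf ib) /=.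
  by rewrite eqxx.
rewrite /v /= /bump /= add1n /tup nth_word.
case: ltngtP => [ib|ib|ib].
- exact: jB_corner.
- have -> : (i < (size bs + size s).+1)%N by rewrite sz.
  exact: jA_corner.
by apply: jM_corner.
Qed.

(** Words along a trajectory with one non-trivial path are the words of the
    arrow, up to the identifications of the corners with [B], [M] and [A]. *)
Lemma restrict_eq0 l (f : subsp (@hoch k T X n e l.+1)) (v : 'I_l.+2 -> 'I_n) u :
  restrict f = 0 -> traj_length v = 1%N -> v ord0 = t0 -> v ord_max = s0 ->
  in_traj e v u -> val f u = 0.
Proof.
move=> f0 /traj_length1[q [vl vr _]] v0 vm uv.
rewrite v0 in vl; rewrite vm in vr; have ql := ltn_ord q.
pose bs := mkseq (fun i => pB g (u (inord i))) q.
pose s := mkseq (fun i => pA g (u (inord (q.+1 + i)))) (l - q).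
have sz : (size bs + size s)%N = l by rewrite !size_mkseq subnKC.
suff -> : u = tup (word bs (pM g (u q)) s).
  rewrite -(@on_wordsE _ _ _ _ (val f)) ?size_word ?sz // -restrictE f0.
  by rewrite bar_cochain0 linear0.
apply/funext => i; have [ul ur] := uv i; have il := ltn_ord i.
rewrite /tup nth_word sz il !size_mkseq; case: ltngtP => [iq|qi|/val_inj iq].
- rewrite nth_mkseq // inord_val jpB.
  rewrite vl /= ?(ltnW iq) // in ul; rewrite vl /bump //= in ur.
  by rewrite ul ur.
- rewrite nth_mkseq; last by rewrite ltn_subLR // addSn subnKC.
  rewrite subnKC // inord_val jpA.
  rewrite vr /= // in ul; rewrite vr /bump /= ?ltnS ?(ltnW qi) // in ur.
  by rewrite ul ur.
rewrite -iq jpM; rewrite vl /= ?iq // in ul; rewrite vr /bump /= ?iq // in ur.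
by rewrite -iq in ul ur *; rewrite ul ur.
Qed.

End ArrowPart.

(** The letters of an arrow lie in the corners at its ends or in its own
    bimodule, so they have no component in the bimodule of another arrow. *)
Lemma restrict_extend_neq (k : fieldType) (T : algType k) (n : nat)
    (e : 'I_n -> T) (e_orth : forall i j, e i * e j = if i == j then e i else 0)
    (B A B' A' : algType k) (M : bimod B A) (M' : bimod B' A')
    (g : arrow e M) (g' : arrow e M') (X : bimod T T) l c :
  (tgt g, src g) != (tgt g', src g') ->
  restrict g' (@extend k T n e e_orth B A M g X l c) = 0.
Proof.
move=> gg; apply: bar_cochain_ext => bs m s sz; apply: val_inj.
rewrite bar_cochain0 linear0 restrictE on_wordsE ?size_word ?sz //.
apply: extend_eq0 => q.
have : nth 0 (word g' bs m s) q \in word g' bs m s.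
  by rewrite mem_nth // size_word sz.
move=> /word_letter[i [j [tl tr ij]]]; apply: (pM_corner e_orth) tl tr _.
rewrite -negb_and; apply: contra gg => /andP[/eqP it /eqP js].
have := src_neq_tgt g; rewrite it js in ij; move: ij.
by rewrite !inE => /or3P[/eqP[-> ->]|//|/eqP[-> ->]]; rewrite eqxx.
Qed.

(** * A column of the spectral sequence *)

Section Column.
Variables (k : fieldType) (C : fcomplex k) (t : nat) (D : complex k).
Variable th : forall n, subsp (fcpx_F C t n.+1) -> D n.
Hypothesis th_lin : forall n, linear (@th n).
Hypothesis th_ker : forall n f, @th n f = 0 <-> val f \in fcpx_F C t.+1 n.+1.
Hypothesis th_surj : forall n c, exists f, @th n f = c.
Hypothesis th_d : forall n (f : subsp (fcpx_F C t n.+1)) g,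
  val g = cpx_d n.+1 (val f) -> th g = cpx_d n (th f).
Hypothesis F0 : forall f : subsp (fcpx_F C t 0), f = 0.

Lemma E0_pi_eq0 n (f : subsp (fcpx_F C t n.+1)) :
  quotsp_pi (@Fnext k C t n.+1) f = 0 <-> th f = 0.
Proof.
rewrite th_ker -(linear0 (quotsp_pi (@Fnext k C t n.+1))).
rewrite -[f in _ <-> is_true (val f \in _)]subr0.
rewrite -[X in _ <-> is_true X](quotsp_piE (@Fnext k C t n.+1)).
by split=> [->|/eqP].
Qed.

(** The maps [th] identify the column with [D] shifted by one degree. The shift
    is harmless for coboundaries of lowest degree because the column vanishes in
    total degree 0. *)
Lemma column_cohomology n : liso (cohomology (E0 C t) n.+1) (cohomology D n).
Proof.
pose next m (f : subsp (fcpx_F C t m)) : subsp (fcpx_F C t m.+1) :=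
  Subsp (fcpx_Fd (subsp_valP f)).
have dE m f : E0_d (quotsp_pi (@Fnext k C t m) f) =
    quotsp_pi (@Fnext k C t m.+1) (next m f).
  exact: E0_d_pi.
have dth m f : th (next m.+1 f) = cpx_d m (th f) by apply: th_d.
apply: (@cohomology_iso _ (E0 C t) D _ _ (fun x c => exists f,
  [/\ x = quotsp_pi (@Fnext k C t n.+1) f, c = th f & cpx_d n c = 0])).
- move=> u _ _ _ _ [f [-> -> f0]] [f' [-> -> f'0]]; exists (u *: f + f').
  by rewrite linearP th_lin linearP f0 f'0 scaler0 addr0.
- move=> _ _ [f [-> -> f0]]; split=> //.
  by rewrite /= dE; apply/E0_pi_eq0; rewrite dth.
- move=> x; rewrite -[x]quotsp_reprK /= dE => /E0_pi_eq0; rewrite dth => x0.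
  by exists (th (repr x)), (repr x); rewrite quotsp_reprK.
- move=> c c0; have [f fc] := th_surj c.
  by exists (quotsp_pi (@Fnext k C t n.+1) f), f; rewrite fc.
move=> _ _ [f [-> -> _]]; case: n f => [|n] f; split=> /=.
- move=> [u fu]; apply/E0_pi_eq0; rewrite fu -[u]quotsp_reprK (F0 (repr u)).
  by rewrite linear0 -(linear0 (@E0_d k C t 0)).
- by move=> f0; exists 0; rewrite (linear0 (@E0_d k C t 0)); apply/E0_pi_eq0.
- move=> [u fu]; exists (th (repr u)); rewrite -dth.
  apply/subr0_eq; rewrite -(linear_isB (@th_lin n.+1)); apply/E0_pi_eq0.
  by rewrite linearB /= fu -[in X in X - _](quotsp_reprK u) dE subrr.
move=> [c fc]; have [g gc] := th_surj c; exists (quotsp_pi (@Fnext k C t n.+1) g).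
rewrite dE; apply/subr0_eq; rewrite -linearB; apply/E0_pi_eq0.
by rewrite (linear_isB (@th_lin n.+1)) fc dth gc subrr.
Qed.

End Column.

Section ProductComplex.
Variables (k : fieldType) (C D : complex k).

Definition prod_d n (x : C n * D n) : C n.+1 * D n.+1 :=
  (cpx_d n x.1, cpx_d n x.2).

Fact prod_d_linear n : linear (@prod_d n).
Proof. by move=> u x y; congr pair; rewrite linearP. Qed.
HB.instance Definition _ n :=
  GRing.isLinear.Build k _ _ _ (@prod_d n) (@prod_d_linear n).

Fact prod_dd n (x : C n * D n) : prod_d (prod_d x) = 0.
Proof. by congr pair; rewrite cpx_dd. Qed.

Definition prod_complex : complex k :=
  @Complex k (fun n => (C n * D n)%type) (fun n => @prod_d n) prod_dd.

Lemma cohomology_prod (n : nat) :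
  liso (cohomology prod_complex n) (cohomology C n * cohomology D n)%type.
Proof.
have pizero (E : complex k) (z : subsp (@cocycle k E n)) :
    quotsp_pi (@coboundary k E n) z = 0 <-> is_bound (val z).
  rewrite -coboundaryP -[z in _ <-> is_true (z \in _)]subr0 -quotsp_piE linear0.
  by split=> [->|/eqP].
have bP (z : prod_complex n) : is_bound z <-> is_bound z.1 /\ is_bound z.2.
  case: n {pizero} z => [|n] [x y] /=; first by split=> [[-> ->]|[-> ->]].
  split=> [[[u v] [-> ->]]|[[u ->] [v ->]]]; last by exists (u, v).
  by split; [exists u | exists v].
apply: (@linear_rel_iso _ _ _ (fun a b => exists z x y,
  [/\ a = quotsp_pi (@coboundary k prod_complex n) z,
      b = (quotsp_pi (@coboundary k C n) x, quotsp_pi (@coboundary k D n) y)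
    & val z = (val x, val y)])).
- move=> u _ _ _ _ [z [x [y [-> -> e]]]] [z' [x' [y' [-> -> e']]]].
  exists (u *: z + z'), (u *: x + x'), (u *: y + y'); split.
  + by rewrite linearP.
  + by congr pair; rewrite linearP.
  have -> : val (u *: z + z') = u *: val z + val z' by [].
  by rewrite e e'.
- move=> a; have /eqP[x0 y0] := subsp_valP (repr a).
  have xP : (val (repr a)).1 \in @cocycle k C n by apply/eqP.
  have yP : (val (repr a)).2 \in @cocycle k D n by apply/eqP.
  exists (quotsp_pi _ (Subsp xP), quotsp_pi _ (Subsp yP)).
  exists (repr a), (Subsp xP), (Subsp yP); rewrite quotsp_reprK.
  by split=> //=; apply: surjective_pairing.
- move=> [b c]; have /eqP x0 := subsp_valP (repr b); have /eqP y0 := subsp_valP (repr c).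
  have zP : (val (repr b), val (repr c)) \in @cocycle k prod_complex n.
    by apply/eqP; congr pair.
  exists (quotsp_pi _ (Subsp zP)), (Subsp zP), (repr b), (repr c).
  by rewrite !quotsp_reprK.
- move=> b [z [x [y [/esym/pizero/bP[zx zy] -> e]]]].
  by rewrite e in zx zy; congr pair; apply/pizero.
move=> a [z [x [y [-> [/esym/pizero x0 /esym/pizero y0] e]]]].
by apply/pizero/bP; rewrite e.
Qed.

End ProductComplex.

(** * Triangular algebras of size three *)

Lemma triple_eq (U V W : Type) (x x' : U) (y y' : V) (z z' : W) :
  x = x' -> y = y' -> z = z' -> (x, y, z) = (x', y', z').
Proof. by move=> -> -> ->. Qed.

Section TriangularArrows.
Variables (k : fieldType) (A1 A2 A3 : algType k).
Variables (M21 : bimod A2 A1) (M32 : bimod A3 A2) (M31 : bimod A3 A1).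
Variable mu : balanced_map M32 M21 M31.
Local Notation T := (triang mu).
Local Notation vtx := (vertex mu).

Let zeros := (mulr0, mul0r, mulr1, mul1r, scaler0, (@bal0l _ _ _ _ _ _ _ mu),
  (@bal0r _ _ _ _ _ _ _ mu), addr0, add0r).

Ltac entries := congr Triang; rewrite /= ?zeros ?ract0l ?lact0l ?linear0
  ?ract1 ?lact1 ?zeros ?ract0l ?lact0l ?linear0 ?zeros //.

Lemma vertex_orth i j : vtx i * vtx j = if i == j then vtx i else 0.
Proof.
case: i j => [[|[|[|i]]] hi] [[|[|[|j]]] hj] //; rewrite -val_eqE /=; entries.
Qed.

Definition vtx1 : 'I_3 := Ordinal (isT : (0 < 3)%N).
Definition vtx2 : 'I_3 := Ordinal (isT : (1 < 3)%N).
Definition vtx3 : 'I_3 := Ordinal (isT : (2 < 3)%N).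

Definition arrow21 : arrow vtx M21.
Proof.
apply: (@Arrow k T 3 vtx A2 A1 M21 vtx1 vtx2 (diag2 mu) (diag1 mu)
  (fun m => Triang mu 0 0 0 m 0 0) (@ent22 _ _ _ _ _ _ _ mu)
  (@ent11 _ _ _ _ _ _ _ mu) (@ent21 _ _ _ _ _ _ _ mu)) => //.
- by move=> u x y; entries.
- by move=> b m; entries.
- by move=> m a; entries.
- by move=> t; entries.
- by move=> t; entries.
by move=> t; entries.
Defined.

Definition arrow32 : arrow vtx M32.
Proof.
apply: (@Arrow k T 3 vtx A3 A2 M32 vtx2 vtx3 (diag3 mu) (diag2 mu)
  (fun m => Triang mu 0 0 0 0 m 0) (@ent33 _ _ _ _ _ _ _ mu)
  (@ent22 _ _ _ _ _ _ _ mu) (@ent32 _ _ _ _ _ _ _ mu)) => //.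
- by move=> u x y; entries.
- by move=> b m; entries.
- by move=> m a; entries.
- by move=> t; entries.
- by move=> t; entries.
by move=> t; entries.
Defined.

Definition arrow31 : arrow vtx M31.
Proof.
apply: (@Arrow k T 3 vtx A3 A1 M31 vtx1 vtx3 (diag3 mu) (diag1 mu)
  (fun m => Triang mu 0 0 0 0 0 m) (@ent33 _ _ _ _ _ _ _ mu)
  (@ent11 _ _ _ _ _ _ _ mu) (@ent31 _ _ _ _ _ _ _ mu)) => //.
- by move=> u x y; entries.
- by move=> b m; entries.
- by move=> m a; entries.
- by move=> t; entries.
- by move=> t; entries.
by move=> t; entries.
Defined.

Lemma vertex_sum (X : bimod T T) (x : X) : (forall i, lact (vtx i) x = 0) -> x = 0.
Proof.
move=> x0; rewrite -[x]lact1.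
have -> : 1 = vtx vtx1 + vtx vtx2 + vtx vtx3 :> T by entries.
by rewrite !lactDl !x0 !addr0.
Qed.

Lemma path_cases (i j : 'I_3) : (j < i)%N ->
  [\/ (i, j) = (vtx2, vtx1), (i, j) = (vtx3, vtx2) | (i, j) = (vtx3, vtx1)].
Proof.
case: i j => [[|[|[|i]]] hi] [[|[|[|j]]] hj] //= _;
  by [apply: Or31; congr pair; apply: val_inj
     |apply: Or32; congr pair; apply: val_inj
     |apply: Or33; congr pair; apply: val_inj].
Qed.

Variable X : bimod T T.
Local Notation C := (triang_hochschild X).

Definition D21 := bar_complex M21 (X21 X).
Definition D32 := bar_complex M32 (X32 X).
Definition D31 := bar_complex M31 (X31 X).
Definition column_complex := prod_complex (prod_complex D21 D32) D31.

Definition arrow_parts l (f : subsp (fcpx_F C 1 l.+1)) : column_complex l :=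
  (restrict arrow21 (val f), restrict arrow32 (val f), restrict arrow31 (val f)).

Lemma arrow_parts_lin l : linear (@arrow_parts l).
Proof.
move=> u f f'; rewrite /arrow_parts.
have -> : val (u *: f + f') = u *: val f + val f' by [].
exact: triple_eq (restrict_linear arrow21 _ _ _)
  (restrict_linear arrow32 _ _ _) (restrict_linear arrow31 _ _ _).
Qed.

(** A trajectory of length one runs along one of the three arrows, and those of
    length zero are already killed in $F^1$. *)
Lemma arrow_parts_ker l f :
  @arrow_parts l f = 0 <-> val f \in fcpx_F C 2 l.+1.
Proof.
split=> [f0|f2]; last first.
  rewrite /arrow_parts (restrict_hochF2 arrow21 f2) (restrict_hochF2 arrow32 f2).
  by rewrite (restrict_hochF2 arrow31 f2).
apply/asboolP => v u vt vl uv.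
have [l0|l0] := ltnP (traj_length v) 1.
  by have /asboolP f1 := subsp_valP f; apply: f1 uv.
have l1 : traj_length v = 1%N by apply/eqP; rewrite eqn_leq -ltnS vl.
suff -> : val (val f) u = 0 by rewrite linear0.
have [q [vq vr vne]] := traj_length1 l1.
have lt : (v ord_max < v ord0)%N.
  rewrite ltn_neqAle; apply/andP; split; first exact: vne.
  by rewrite -(vr (lift ord0 q)) // -(vq (widen_ord (leqnSn _) q)) // vt.
have [[v0 vm]|[v0 vm]|[v0 vm]] := path_cases lt.
- have f21 : restrict arrow21 (val f) = 0 := congr1 (fun c => c.1.1) f0.
  exact: (restrict_eq0 f21 l1 v0 vm uv).
- have f32 : restrict arrow32 (val f) = 0 := congr1 (fun c => c.1.2) f0.
  exact: (restrict_eq0 f32 l1 v0 vm uv).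
have f31 : restrict arrow31 (val f) = 0 := congr1 (fun c => c.2) f0.
exact: (restrict_eq0 f31 l1 v0 vm uv).
Qed.

Lemma arrow_parts_surj l c : exists f, @arrow_parts l f = c.
Proof.
case: c => [[c21 c32] c31].
have [f1 f1E] : exists f, @arrow_parts l f = (c21, 0, 0).
  exists (Subsp (extend_hochF1 vertex_orth (g := arrow21) c21)).
  apply: triple_eq; first exact: (restrict_extend vertex_orth (g := arrow21)).
    exact: (restrict_extend_neq vertex_orth (g := arrow21) (g' := arrow32)).
  exact: (restrict_extend_neq vertex_orth (g := arrow21) (g' := arrow31)).
have [f2 f2E] : exists f, @arrow_parts l f = (0, c32, 0).
  exists (Subsp (extend_hochF1 vertex_orth (g := arrow32) c32)).
  apply: triple_eq; last exact:
      (restrict_extend_neq vertex_orth (g := arrow32) (g' := arrow31)).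
    exact: (restrict_extend_neq vertex_orth (g := arrow32) (g' := arrow21)).
  exact: (restrict_extend vertex_orth (g := arrow32)).
have [f3 f3E] : exists f, @arrow_parts l f = (0, 0, c31).
  exists (Subsp (extend_hochF1 vertex_orth (g := arrow31) c31)).
  apply: triple_eq; last exact: (restrict_extend vertex_orth (g := arrow31)).
    exact: (restrict_extend_neq vertex_orth (g := arrow31) (g' := arrow21)).
  exact: (restrict_extend_neq vertex_orth (g := arrow31) (g' := arrow32)).
exists (f1 + f2 + f3).
rewrite !(linear_isD (@arrow_parts_lin l)) f1E f2E f3E.
by apply: triple_eq; rewrite /= ?addr0 ?add0r.
Qed.

Lemma arrow_parts_d l (f : subsp (fcpx_F C 1 l.+1)) g :
  val g = cpx_d l.+1 (val f) -> arrow_parts g = cpx_d l (arrow_parts f).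
Proof.
have f1 := subsp_valP f.
move=> gf; rewrite /arrow_parts gf.
exact: triple_eq (restrict_d arrow21 f1) (restrict_d arrow32 f1)
  (restrict_d arrow31 f1).
Qed.

(** In degree 0 all trajectories have length zero and the vertices sum to 1. *)
Lemma hochF1_degree0 (f : subsp (fcpx_F C 1 0)) : f = 0.
Proof.
have /asboolP f1 := subsp_valP f.
apply/val_inj/val_inj/funext => t; apply: vertex_sum => i.
apply: (f1 (fun _ => i)) => //.
- by rewrite /traj_length big_ord0.
by move=> [].
Qed.

Lemma cohomology_column (n : nat) :
  liso (cohomology (E0 C 1) n.+1)
    (cohomology D21 n * cohomology D32 n * cohomology D31 n)%type.
Proof.
apply: liso_trans (column_cohomology arrow_parts_lin arrow_parts_ker
  arrow_parts_surj arrow_parts_d hochF1_degree0 n) _.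
apply: liso_trans (cohomology_prod _ _ n) _.
apply: liso_pair (cohomology_prod _ _ n) _.
by exists idfun, id.
Qed.

Lemma cohomology_column0 (x : cohomology (E0 C 1) 0%N) : x = 0.
Proof.
rewrite -[x]quotsp_reprK -[RHS](linear0 (quotsp_pi _)); congr quotsp_pi.
apply: val_inj; rewrite linear0 -[LHS]quotsp_reprK (hochF1_degree0 (repr _)).
exact: linear0.
Qed.

End TriangularArrows.

Lemma liso_trivial (k : fieldType) (U V : lmodType k) :
  (forall x : U, x = 0) -> (forall y : V, y = 0) -> liso U V.
Proof.
move=> U0 V0; apply: (@linear_rel_iso _ _ _ (fun _ _ => True)) => // _.
  by exists 0.
by exists 0.
Qed.

Theorem proposition4p2 (k : fieldType) (A1 A2 A3 : algType k)
    (M21 : bimod A2 A1) (M32 : bimod A3 A2) (M31 : bimod A3 A1)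
    (M21_neq0 : exists m : M21, m != 0)
    (M32_neq0 : exists m : M32, m != 0)
    (M31_neq0 : exists m : M31, m != 0)
    (mu : balanced_map M32 M21 M31)
    (X : bimod (triang mu) (triang mu))
    (P21 : proj_resolution M21) (P32 : proj_resolution M32)
    (P31 : proj_resolution M31) (s : int) :
  exists phi : {linear E1 (triang_hochschild X) 1%N s ->
      (Ext P21 (X21 X) s * Ext P32 (X32 X) s * Ext P31 (X31 X) s)%type},
    bijective phi.
Proof.
have z0 (x : 'rV[k]_0 * 'rV[k]_0 * 'rV[k]_0) : x = 0.
  by case: x => [[x y] z]; rewrite !thinmx0.
rewrite -/(liso _ _); case: s => [n|[|n]].
- apply: liso_trans (cohomology_column X n) _.
  by apply: liso_pair; [apply: liso_pair |]; apply: cohomology_bar.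
(* For s = -1 the total degree is 0; below it there are no cochains at all. *)
- by apply: liso_trivial => //; apply: cohomology_column0.
by apply: liso_trivial => // x; apply: thinmx0.
Qed.
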